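(* Let $\mathbf k$ be a field, $\Gamma=(I,H)$ a quiver without 1-loops, $I=I_0\sqcup I_1$ a decomposition with no arrows between vertices of $I_1$, and $\overline\Gamma=(\overline I,\overline H)$ the doubled quiver. Let $\overline{\mathcal C}$ be a $\mathrm{Hom}$-finite abelian $\mathbf k$-linear category with a $\mathfrak g_{\overline I}$-quasi-categorical representation given by $\overline E=\bigoplus_{i\in\overline I}\overline E_i$, $\overline F=\bigoplus_{i\in\overline I}\overline F_i$ and homomorphisms $\overline\psi_d\colon R_{d,\mathbf k}(\overline\Gamma)\to\mathrm{End}(\overline F^d)^{\rm op}$. Let $\mathcal C\subset\overline{\mathcal C}$ be an abelian subcategory such that (a) $\mathcal C$ is stable by $\overline F_{i^0}$ and $\overline E_{i^0}$ for each $i\in I_0$; (b) $\mathcal C$ is stable by $\overline F_{i^2}\overline F_{i^1}$ and $\overline E_{i^1}\overline E_{i^2}$ for each $i\in I_1$; (c) $\overline F_{i^2}(\mathcal C)=0$ for each $i\in I_1$; (d) $\mathcal C=\bigoplus_{\alpha\in Q_I}\mathcal C\cap\overline{\mathcal C}_{\phi(\alpha)}$. Put $\mathcal C_\alpha=\mathcal C\cap\overline{\mathcal C}_{\phi(\alpha)}$ and define endofunctors of $\mathcal C$ by $F_i=\overline F_{i^0}|_{\mathcal C}$, $E_i=\overline E_{i^0}|_{\mathcal C}$ for $i\in I_0$ and $F_i=\overline F_{i^2}\overline F_{i^1}|_{\mathcal C}$, $E_i=\overline E_{i^1}\overline E_{i^2}|_{\mathcal C}$ for $i\in I_1$. For $\alpha\in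 Q_I^+$ let $F_\alpha=\bigoplus_{\mathbf i\in I^\alpha}F_{i_{|\alpha|}}\cdots F_{i_1}$, and let $\psi_\alpha=\overline\psi'_{\overline\alpha}\circ\Phi_{\alpha,\mathbf k}\colon R_{\alpha,\mathbf k}(\Gamma)\to\mathrm{End}(F_\alpha)^{\rm op}$ (defined in the context). Then the functors $F_i,E_i$ ($i\in I$) and the algebra homomorphisms $\psi_\alpha$ define a $\mathfrak g_I$-quasi-categorical representation in $\mathcal C$.
   Context: Subcategories are understood to be full, with exact inclusion. **KLR algebra.** For a quiver with vertex set $I$ and no 1-loops let $h_{i,j}$ be the number of arrows from $i$ to $j$; $Q_I=\bigoplus_{i\in I}\mathbb Z\alpha_i$, $Q_I^+=\bigoplus_{i\in I}\mathbb N\alpha_i$. For $\alpha=\sum_{i}d_i\alpha_i\in Q_I^+$ put $|\alpha|=\sum d_i$ and $I^\alpha=\{\mathbf i\in I^{|\alpha|}:\sum_r\alpha_{i_r}=\alpha\}$. Put $Q_{i,j}(u,v)=0$ if $i=j$ and $(v-u)^{h_{i,j}}(u-v)^{h_{j,i}}$ if $i\neq j$. Let $s_r(\mathbf i)$ be $\mathbf i$ with $i_r,i_{r+1}$ exchanged. With $d=|\alpha|$, $R_{\alpha,\mathbf k}$ is the $\mathbf k$-algebra generated by $e(\mathbf i)$ ($\mathbf i\in I^\alpha$), $x_1,\dots,x_d$, $\tau_1,\dots,\tau_{d-1}$ with relations: $e(\mathbf i)e(\mathbf j)=\delta_{\mathbf i,\mathbf j}e(\mathbf i)$; $\sum_{\mathbf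 i}e(\mathbf i)=1$; $x_re(\mathbf i)=e(\mathbf i)x_r$; $\tau_re(\mathbf i)=e(s_r(\mathbf i))\tau_r$; $x_rx_s=x_sx_r$; $\tau_rx_{r+1}e(\mathbf i)=(x_r\tau_r+\delta_{i_r,i_{r+1}})e(\mathbf i)$; $x_{r+1}\tau_re(\mathbf i)=(\tau_rx_r+\delta_{i_r,i_{r+1}})e(\mathbf i)$; $\tau_rx_s=x_s\tau_r$ if $s\ne r,r+1$; $\tau_r\tau_s=\tau_s\tau_r$ if $|r-s|>1$; $\tau_r^2e(\mathbf i)=Q_{i_r,i_{r+1}}(x_r,x_{r+1})e(\mathbf i)$; $(\tau_{r+1}\tau_r\tau_{r+1}-\tau_r\tau_{r+1}\tau_r)e(\mathbf i)$ equals $(x_{r+2}-x_r)^{-1}\big(Q_{i_r,i_{r+1}}(x_{r+2},x_{r+1})-Q_{i_r,i_{r+1}}(x_r,x_{r+1})\big)e(\mathbf i)$ if $i_r=i_{r+2}$ and $0$ otherwise. $R_{d,\mathbf k}=\bigoplus_{|\alpha|=d}R_{\alpha,\mathbf k}$. **Quasi-categorical representation.** A $\mathfrak g_I$-quasi-categorical representation in a $\mathrm{Hom}$-finite $\mathbf k$-linear abelian category $\mathcal D$ is: a decomposition $\mathcal D=\bigoplus_{\alpha\in Q_I}\mathcal D_\alpha$; a pair $(E,F)$ of biadjoint exact endofunctors; morphisms of functors $x\colon F\to F$, $\tau\colon F^2\to F^2$; decompositions $E=\bigoplus_{i\in I}E_i$, $F=\bigoplus_{i\in I}F_i$ (if $I$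 is infinite, for each object $M$ only finitely many $E_i(M),F_i(M)$ are nonzero), such that: $E_i(\mathcal D_\alpha)\subset\mathcal D_{\alpha-\alpha_i}$ and $F_i(\mathcal D_\alpha)\subset\mathcal D_{\alpha+\alpha_i}$; for each $d\in\mathbb N$ there is an algebra homomorphism $\psi_d\colon R_{d,\mathbf k}\to\mathrm{End}(F^d)^{\rm op}$ with $\psi_d(e(\mathbf i))$ the projector to $F_{i_d}\cdots F_{i_1}$, $\psi_d(x_r)=F^{d-r}xF^{r-1}$, $\psi_d(\tau_r)=F^{d-r-1}\tau F^{r-1}$; and for each $M\in\mathcal D$ the endomorphism of $F(M)$ induced by $x$ is nilpotent. **Doubled quiver.** $\overline I=\{i^0:i\in I_0\}\sqcup\overline I_1\sqcup\overline I_2$, $\overline I_1=\{i^1:i\in I_1\}$, $\overline I_2=\{i^2:i\in I_1\}$. Arrows: $i^0\to j^0$ for each arrow $i\to j$ of $\Gamma$ with $i,j\in I_0$; $i^0\to j^1$ for each arrow $i\to j$ with $i\in I_0,j\in I_1$; $i^2\to j^0$ for each arrow $i\to j$ with $i\in I_1,j\in I_0$; one $i^1\to i^2$ for each $i\in I_1$. $\phi$ on sequences: morphism of monoids with $\phi(i)=i^0$ ($i\in I_0$), $\phi(i)=(i^1,i^2)$ ($i\in I_1$); $\phi\colon Q_I\to Q_{\overline I}$ linear with $\phi(\alpha_i)=\alpha_{i^0}$ ($i\in I_0$), $\alpha_{i^1}+\alpha_{i^2}$ ($i\in I_1$). Write $\overline\alpha=\phi(\alpha)$. **Balanced KLR algebra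 and $\Phi_{\alpha,\mathbf k}$.** $\mathbf i\in\overline I^d$ is unordered if some prefix $(i_1,\dots,i_r)$ has strictly more entries in $\overline I_2$ than in $\overline I_1$; well-ordered if $i_a=i^1$ implies $a<d$ and $i_{a+1}=i^2$. With $\mathbf e$ the sum of $e(\mathbf i)$ over the set $\overline I^{\overline\alpha}_{\rm ord}$ of well-ordered $\mathbf i\in\overline I^{\overline\alpha}$, $S_{\overline\alpha,\mathbf k}=\mathbf eR_{\overline\alpha,\mathbf k}(\overline\Gamma)\mathbf e/\sum_{\mathbf i\text{ unordered}}\mathbf eR_{\overline\alpha,\mathbf k}(\overline\Gamma)e(\mathbf i)R_{\overline\alpha,\mathbf k}(\overline\Gamma)\mathbf e$. There is an isomorphism $\Phi_{\alpha,\mathbf k}\colon R_{\alpha,\mathbf k}(\Gamma)\to S_{\overline\alpha,\mathbf k}$ with $e(\mathbf i)\mapsto e(\phi(\mathbf i))$, $x_re(\mathbf i)\mapsto x_{r'}e(\phi(\mathbf i))$ and $\tau_re(\mathbf i)\mapsto c\cdot e(\phi(\mathbf i))$, where $r'-1$ is the length of $\phi(i_1,\dots,i_{r-1})$ and $c=\tau_{r'}$ if $i_r,i_{r+1}\in I_0$; $\tau_{r'}\tau_{r'+1}$ if $i_r\in I_1,i_{r+1}\in I_0$; $\tau_{r'+1}\tau_{r'}$ if $i_r\in I_0,i_{r+1}\in I_1$; $\tau_{r'+1}\tau_{r'+2}\tau_{r'}\tau_{r'+1}$ if $i_r\ne i_{r+1}$ in $I_1$; $-\tau_{r'+1}\tau_{r'+2}\tau_{r'}\tau_{r'+1}$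 if $i_r=i_{r+1}\in I_1$. **The map $\overline\psi'_{\overline\alpha}$.** Since $F_{\alpha}=\bigoplus_{\mathbf i\in\overline I^{\overline\alpha}_{\rm ord}}\overline F_{i_{|\overline\alpha|}}\cdots\overline F_{i_1}|_{\mathcal C}$, the $\overline\alpha$-component of $\overline\psi_{|\overline\alpha|}$ yields a homomorphism $\mathbf eR_{\overline\alpha,\mathbf k}(\overline\Gamma)\mathbf e\to\mathrm{End}(F_\alpha)^{\rm op}$; under (a)–(c) it factors through $S_{\overline\alpha,\mathbf k}$, and $\overline\psi'_{\overline\alpha}\colon S_{\overline\alpha,\mathbf k}\to\mathrm{End}(F_\alpha)^{\rm op}$ is the resulting homomorphism. *)

(* Defs.v *)
From HB Require Import structures.
From mathcomp Require Import all_boot all_order all_algebra.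
From mathcomp Require Import generic_quotient boolp.
From mathcomp.finmap Require Import finmap.
From mathcomp.multinomials Require Import monalg freeg.

Set Implicit Arguments.
Unset Strict Implicit.
Unset Printing Implicit Defensive.
Import Order.TTheory GRing.Theory Num.Theory.
Local Open Scope ring_scope.
Local Open Scope quotient_scope.

(* Unital associative k-algebras in which 1 = 0 is allowed. The library's
   lalgType and algType extend nzRingType and so exclude the zero algebra,
   whereas a presented algebra may collapse. *)
HB.mixin Record Lmodule_isKAlgebra (k : pzRingType) A of GRing.Lmodule k A := {
  kone : A;
  kmul : A -> A -> A;
  kmulA : associative kmul;
  kmul1x : left_id kone kmul;
  kmulx1 : right_id kone kmul;
  kmulDl : left_distributive kmul +%R;
  kmulDr : right_distributive kmul +%R;
  kmulZl : forall c x y, kmul (c *: x) y = c *: kmul x y;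
  kmulZr : forall c x y, kmul x (c *: y) = c *: kmul x y
}.

#[short(type="kalgType")]
HB.structure Definition KAlgebra (k : pzRingType) :=
  {A of GRing.Lmodule k A & Lmodule_isKAlgebra k A}.

Notation "x *k y" := (kmul x y)
  (at level 40, left associativity) : ring_scope.

Definition kalg_morphism (k : pzRingType) (A B : kalgType k) (f : A -> B) : Prop :=
  [/\ linear f, f kone = kone & {morph f : x y / x *k y}].

Section KAlgebraTheory.
Variables (k : pzRingType) (A : kalgType k).
Implicit Types x y : A.

Lemma kmul0x x : 0 *k x = 0.
Proof. by apply: (addIr (0 *k x)); rewrite -kmulDl !add0r. Qed.
Lemma kmulx0 x : x *k 0 = 0.
Proof. by apply: (addIr (x *k 0)); rewrite -kmulDr !add0r. Qed.
Lemma kmulNx x y : (- x) *k y = - (x *k y).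
Proof. by rewrite -scaleN1r kmulZl scaleN1r. Qed.
Lemma kmulxN x y : x *k (- y) = - (x *k y).
Proof. by rewrite -scaleN1r kmulZr scaleN1r. Qed.
Lemma kmul_suml (T : Type) (s : seq T) (P : pred T) (F : T -> A) y :
  (\sum_(i <- s | P i) F i) *k y = \sum_(i <- s | P i) F i *k y.
Proof.
exact: (big_morph (fun x => x *k y) (fun a b => kmulDl a b y) (kmul0x y)).
Qed.
Lemma kmul_sumr (T : Type) (s : seq T) (P : pred T) (F : T -> A) x :
  x *k (\sum_(i <- s | P i) F i) = \sum_(i <- s | P i) x *k F i.
Proof. exact: (big_morph (kmul x) (kmulDr x) (kmulx0 x)). Qed.
End KAlgebraTheory.

(* The free k-algebra on a set X: noncommutative polynomials. *)
Definition free_alg (k : comNzRingType) (X : choiceType) := {malg k[{fmonom X}]}.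

Section FreeAlg.
Variables (k : comNzRingType) (X : choiceType).

Lemma malg_scaleAr (c : k) (x y : {malg k[{fmonom X}]}) : x * (c *: y) = c *: (x * y).
Proof.
apply/malgP => m; rewrite mcoeffZ (mcoeffMlw m (fsubset_refl _) (msuppZ_le c y)).
rewrite mcoeffMl mulr_sumr; apply: eq_bigr => i _; rewrite mulr_sumr.
by apply: eq_bigr => j _; rewrite mcoeffZ mulrCA mulrnAr.
Qed.

HB.instance Definition _ := GRing.NzRing.on (free_alg k X).
HB.instance Definition _ := GRing.Lalgebra.on (free_alg k X).

HB.instance Definition _ := Lmodule_isKAlgebra.Build k (free_alg k X)
  (@mulrA _) (@mul1r _) (@mulr1 _) (@mulrDl _) (@mulrDr _)
  (fun c x y => esym (scalerAl c x y)) malg_scaleAr.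

Definition free_gen (x : X) : free_alg k X := mkmalgU (fmu x) 1.
End FreeAlg.

Section Quotient.
Variables (k : pzRingType) (A : kalgType k).

Inductive two_sided_ideal (G : A -> Prop) : A -> Prop :=
| ideal_zero : two_sided_ideal G 0
| ideal_step a g b x :
    G g -> two_sided_ideal G x -> two_sided_ideal G (a *k g *k b + x).

Variable G : A -> Prop.
Local Notation J := (two_sided_ideal G).

Lemma idealD x y : J x -> J y -> J (x + y).
Proof. by elim=> [|a g b z Gg _ IH] Jy; rewrite ?add0r // -addrA; constructor; auto. Qed.

Lemma idealM a x b : J x -> J (a *k x *k b).
Proof.
elim=> [|a' g b' z Gg _ IH]; first by rewrite kmulx0 kmul0x; constructor.
have -> : a *k (a' *k g *k b' + z) *k b = (a *k a') *k g *k (b' *k b) + a *k z *k b.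
  by rewrite kmulDr kmulDl !kmulA.
by constructor.
Qed.

Lemma idealN x : J x -> J (- x).
Proof. by move=> Jx; have := idealM (- kone) kone Jx; rewrite kmulNx kmul1x kmulx1. Qed.

Definition ideal_rel (x y : A) : bool := `[< J (x - y) >].

Lemma ideal_relP : equiv_class_of ideal_rel.
Proof.
split=> [x|x y|y x z].
- by apply/asboolP; rewrite subrr; constructor.
- by apply/asboolP/asboolP => /idealN; rewrite opprB.
- move=> /asboolP Jxy /asboolP Jyz; apply/asboolP.
  by have := idealD Jxy Jyz; rewrite addrA subrK.
Qed.
Canonical ideal_equiv := EquivRelPack ideal_relP.
Canonical ideal_encModRel := defaultEncModRel ideal_rel.

Definition quot := {eq_quot ideal_rel}.
HB.instance Definition _ := Choice.on quot.
HB.instance Definition _ := EqQuotient.on quot.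

Lemma quotP (x y : A) : reflect (J (x - y)) (x == y %[mod quot]).
Proof. by rewrite eqmodE; apply: asboolP. Qed.

Definition quot_add := lift_op2 quot +%R.
Definition quot_opp := lift_op1 quot -%R.
Definition quot_mul := lift_op2 quot (@kmul k A).
Definition quot_scale (c : k) := lift_op1 quot ( *:%R c).

Lemma pi_quot_add : {morph \pi_quot : x y / x + y >-> quot_add x y}.
Proof.
move=> x y; unlock quot_add; apply/eqP/quotP.
rewrite opprD addrACA; apply: idealD; apply/quotP; by rewrite reprK.
Qed.
Canonical pi_quot_add_morph := PiMorph2 pi_quot_add.

Lemma pi_quot_opp : {morph \pi_quot : x / - x >-> quot_opp x}.
Proof.
move=> x; unlock quot_opp; apply/eqP/quotP.
by rewrite -opprD; apply: idealN; apply/quotP; rewrite reprK.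
Qed.
Canonical pi_quot_opp_morph := PiMorph1 pi_quot_opp.

Lemma pi_quot_mul : {morph \pi_quot : x y / x *k y >-> quot_mul x y}.
Proof.
move=> x y; unlock quot_mul; apply/eqP/quotP.
set x' := repr _; set y' := repr _.
have Jx : J (x - x') by apply/quotP; rewrite reprK.
have Jy : J (y - y') by apply/quotP; rewrite reprK.
have -> : x *k y - x' *k y' = kone *k (x - x') *k y + x' *k (y - y') *k kone.
  by rewrite kmul1x kmulx1 kmulDl kmulDr kmulNx kmulxN addrA subrK.
by apply: idealD; apply: idealM.
Qed.
Canonical pi_quot_mul_morph := PiMorph2 pi_quot_mul.

Lemma pi_quot_scale c : {morph \pi_quot : x / c *: x >-> quot_scale c x}.
Proof.
move=> x; unlock quot_scale; apply/eqP/quotP; rewrite -scalerBr.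
set z := _ - _; have Jz : J z by apply/quotP; rewrite reprK.
by have := idealM (c *: kone) kone Jz; rewrite kmulx1 kmulZl kmul1x.
Qed.
Canonical pi_quot_scale_morph c := PiMorph1 (pi_quot_scale c).

Lemma quot_addA : associative quot_add.
Proof. by move=> x y z; rewrite -[x]reprK -[y]reprK -[z]reprK !piE addrA. Qed.
Lemma quot_addC : commutative quot_add.
Proof. by move=> x y; rewrite -[x]reprK -[y]reprK !piE addrC. Qed.
Lemma quot_add0 : left_id (\pi_quot 0) quot_add.
Proof. by move=> x; rewrite -[x]reprK !piE add0r. Qed.
Lemma quot_addN : left_inverse (\pi_quot 0) quot_opp quot_add.
Proof. by move=> x; rewrite -[x]reprK !piE addNr. Qed.
HB.instance Definition _ :=
  GRing.isZmodule.Build quot quot_addA quot_addC quot_add0 quot_addN.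

Lemma quot_scaleA a b x : quot_scale a (quot_scale b x) = quot_scale (a * b) x.
Proof. by rewrite -[x]reprK !piE scalerA. Qed.
Lemma quot_scale1 : left_id 1 quot_scale.
Proof. by move=> x; rewrite -[x]reprK !piE scale1r. Qed.
Lemma quot_scaleDr : right_distributive quot_scale quot_add.
Proof. by move=> c x y; rewrite -[x]reprK -[y]reprK !piE scalerDr. Qed.
Lemma quot_scaleDl x : {morph quot_scale^~ x : a b / a + b >-> quot_add a b}.
Proof. by move=> a b; rewrite -[x]reprK !piE scalerDl. Qed.
HB.instance Definition _ := GRing.Zmodule_isLmodule.Build k quot
  quot_scaleA quot_scale1 quot_scaleDr quot_scaleDl.

Lemma quot_mulA : associative quot_mul.
Proof. by move=> x y z; rewrite -[x]reprK -[y]reprK -[z]reprK !piE kmulA. Qed.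
Lemma quot_mul1x : left_id (\pi_quot kone) quot_mul.
Proof. by move=> x; rewrite -[x]reprK !piE kmul1x. Qed.
Lemma quot_mulx1 : right_id (\pi_quot kone) quot_mul.
Proof. by move=> x; rewrite -[x]reprK !piE kmulx1. Qed.
Lemma quot_mulDl : left_distributive quot_mul quot_add.
Proof. by move=> x y z; rewrite -[x]reprK -[y]reprK -[z]reprK !piE kmulDl. Qed.
Lemma quot_mulDr : right_distributive quot_mul quot_add.
Proof. by move=> x y z; rewrite -[x]reprK -[y]reprK -[z]reprK !piE kmulDr. Qed.
Lemma quot_mulZl c x y : quot_mul (quot_scale c x) y = quot_scale c (quot_mul x y).
Proof. by rewrite -[x]reprK -[y]reprK !piE kmulZl. Qed.
Lemma quot_mulZr c x y : quot_mul x (quot_scale c y) = quot_scale c (quot_mul x y).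
Proof. by rewrite -[x]reprK -[y]reprK !piE kmulZr. Qed.
HB.instance Definition _ := Lmodule_isKAlgebra.Build k quot
  quot_mulA quot_mul1x quot_mulx1 quot_mulDl quot_mulDr quot_mulZl quot_mulZr.

Definition qclass (x : A) : quot := \pi x.

Lemma qclass_morphism : kalg_morphism qclass.
Proof.
split=> [c x y||x y] //; rewrite /qclass.
- change (\pi_quot (c *: x + y) = quot_add (quot_scale c (\pi x)) (\pi y)).
  by rewrite !piE.
- exact: pi_quot_mul.
Qed.
End Quotient.

(* The corner e A e, an algebra with unit e. *)
Section Corner.
Variables (k : pzRingType) (A : kalgType k) (e : A).
Hypothesis ee : e *k e = e.

Definition corner_pred : pred A := fun a => e *k a *k e == a.

Fact corner_submod : submod_closed corner_pred.
Proof.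
split=> [|c x y]; rewrite !unfold_in ?kmulx0 ?kmul0x // => /eqP hx /eqP hy.
by rewrite kmulDr kmulDl kmulZr kmulZl hx hy.
Qed.
HB.instance Definition _ := GRing.isSubmodClosed.Build k A corner_pred corner_submod.

Definition corner of e *k e = e := {a : A | corner_pred a}.
Local Notation eAe := (corner ee).
HB.instance Definition _ := SubChoice.on eAe.
HB.instance Definition _ := [SubChoice_isSubLmodule of eAe by <:].

Fact corner_proj_subproof a : corner_pred (e *k a *k e).
Proof. by rewrite /corner_pred !kmulA ee -!kmulA ee. Qed.
Definition corner_proj (a : A) : eAe := Sub _ (corner_proj_subproof a).

Fact corner_one_subproof : corner_pred e.
Proof. by rewrite /corner_pred !ee. Qed.
Definition corner_one : eAe := Sub e corner_one_subproof.

Lemma corner_e (x : eAe) : e *k val x = val x /\ val x *k e = val x.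
Proof.
by case: x => a /= /eqP ha; split; rewrite -ha ?kmulA ?ee // -!kmulA ee.
Qed.

Fact corner_mul_subproof (x y : eAe) : corner_pred (val x *k val y).
Proof. by rewrite /corner_pred -!kmulA (corner_e y).2 kmulA (corner_e x).1. Qed.
Definition corner_mul (x y : eAe) : eAe := Sub _ (corner_mul_subproof x y).

Fact corner_mulA : associative corner_mul.
Proof. by move=> x y z; apply: val_inj; rewrite /= kmulA. Qed.
Fact corner_mul1x : left_id corner_one corner_mul.
Proof. by move=> x; apply: val_inj; rewrite /= (corner_e x).1. Qed.
Fact corner_mulx1 : right_id corner_one corner_mul.
Proof. by move=> x; apply: val_inj; rewrite /= (corner_e x).2. Qed.
Fact corner_mulDl : left_distributive corner_mul +%R.
Proof. by move=> x y z; apply: val_inj; rewrite /= kmulDl. Qed.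
Fact corner_mulDr : right_distributive corner_mul +%R.
Proof. by move=> x y z; apply: val_inj; rewrite /= kmulDr. Qed.
Fact corner_mulZl c x y : corner_mul (c *: x) y = c *: corner_mul x y.
Proof. by apply: val_inj; rewrite /= kmulZl. Qed.
Fact corner_mulZr c x y : corner_mul x (c *: y) = c *: corner_mul x y.
Proof. by apply: val_inj; rewrite /= kmulZr. Qed.
HB.instance Definition _ := Lmodule_isKAlgebra.Build k eAe
  corner_mulA corner_mul1x corner_mulx1 corner_mulDl corner_mulDr
  corner_mulZl corner_mulZr.
End Corner.

(* Q_I, with Q_I^+ the elements satisfying rpos. *)
Definition root_lattice (I : choiceType) := {freeg I / int}.

Section RootLattice.
Variable I : choiceType.
Local Notation Q := (root_lattice I).
Implicit Types (i : I) (w : seq I) (al : Q).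

Definition sroot i : Q := [freeg [:: (1, i)]].
Definition rpos al : bool := fgle 0 al.
Definition height al : nat := absz (deg al).
Definition wt w : Q := \sum_(i <- w) sroot i.

(* I^al as a duplicate-free list. *)
Definition words_of al : seq (seq I) :=
  [seq w <- permutations (flatten [seq nseq (absz (coeff i al)) i | i <- dom al])
  | wt w == al].

Lemma coeff_wt i w : coeff i (wt w) = (count_mem i w)%:Z.
Proof.
rewrite raddf_sum /=; elim: w => [|j w IH]; first by rewrite big_nil.
by rewrite big_cons IH /sroot coeffU mul1r /= PoszD; case: eqP.
Qed.

Lemma words_of_uniq al : uniq (words_of al).
Proof. by rewrite filter_uniq ?permutations_uniq. Qed.

Lemma mem_words_of al w : (w \in words_of al) = (wt w == al).
Proof.
rewrite mem_filter; case: eqP => //= wal; rewrite mem_permutations.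
apply/allP => i _ /=; apply/eqP.
have ci : absz (coeff i al) = count_mem i w by rewrite -wal coeff_wt.
rewrite -ci count_flatten -map_comp.
have [idom|/coeff_outdom c0] := boolP (i \in dom al); last first.
  rewrite c0; have -> // : sumn [seq (count_mem i \o (fun j => nseq (absz (coeff j al)) j)) j | j <- dom al] = 0%N.
  apply/eqP; rewrite sumnE big_map; rewrite big1_seq //= => j _.
  rewrite count_nseq /=; case: eqP => [->|]; rewrite ?c0 //.
rewrite sumnE big_map (bigD1_seq i) ?uniq_dom //= count_nseq /= eqxx mul1n.
by rewrite big1 ?addn0 // => j /negbTE ji; rewrite count_nseq /= ji.
Qed.
End RootLattice.

(* Only the numbers of arrows matter below. *)
Record quiver (I : choiceType) := Quiver {
  arrows :> I -> I -> nat;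
  no_loop : forall i, arrows i i = 0%N
}.

Section KLR.
Variables (k : fieldType) (I : choiceType) (h : quiver I).
Implicit Types (i j : I) (w u v : seq I).

Definition Qij (A : nzRingType) i j (u v : A) : A :=
  if i == j then 0 else (v - u) ^+ h i j * (u - v) ^+ h j i.

(* k[Y][X][Z], Z being the outermost variable. *)
Definition poly3 : idomainType := {poly {poly {poly k}}}.
Definition varZ : poly3 := 'X.
Definition varX : poly3 := polyC ('X : {poly {poly k}}).
Definition varY : poly3 := polyC (polyC ('X : {poly k}) : {poly {poly k}}).

(* (Z - X)^-1 (Q_{i,j}(Z, Y) - Q_{i,j}(X, Y)) *)
Definition braid_num i j : poly3 := @Qij poly3 i j varZ varY - @Qij poly3 i j varX varY.
Definition braid_den : poly3 := varZ - varX.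
Definition braid_poly i j : {poly {poly {poly k}}} :=
  (braid_num i j : {poly {poly {poly k}}}) %/ (braid_den : {poly {poly {poly k}}}).

Definition eval_zxy (A : lalgType k) (P : {poly {poly {poly k}}}) (x y z : A) : A :=
  \sum_(a < size P) \sum_(b < size P`_a) \sum_(c < size P`_a`_b)
    P`_a`_b`_c *: (z ^+ a * x ^+ b * y ^+ c).

Section Relations.
Variable al : root_lattice I.

Definition klr_gen : choiceType :=
  ({w : seq I | wt w == al} + 'I_(height al) + 'I_(height al).-1)%type.
Local Notation free := (free_alg k klr_gen).

(* x_1, .., x_d and tau_1, .., tau_{d-1} are numbered from 0; the symbols are
   0 outside their range. *)
Definition fe w : free :=
  if insub w is Some s then free_gen k (inl (inl s) : klr_gen) else 0.
Definition fx (r : nat) : free :=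
  if insub r is Some s then free_gen k (inl (inr s) : klr_gen) else 0.
Definition ft (r : nat) : free :=
  if insub r is Some s then free_gen k (inr s : klr_gen) else 0.

(* A position r of a word is singled out by cutting the word there, at
   r = size u. *)
Inductive klr_rel : free -> free -> Prop :=
| klr_ee w w' : wt w = al -> wt w' = al ->
    klr_rel (fe w * fe w') (if w == w' then fe w else 0)
| klr_sum_e : klr_rel (\sum_(w <- words_of al) fe w) 1
| klr_xe r w : (r < height al)%N -> wt w = al ->
    klr_rel (fx r * fe w) (fe w * fx r)
| klr_te u i j v (r := size u) : wt (u ++ [:: i, j & v]) = al ->
    klr_rel (ft r * fe (u ++ [:: i, j & v])) (fe (u ++ [:: j, i & v]) * ft r)
| klr_xx r s : (r < height al)%N -> (s < height al)%N ->
    klr_rel (fx r * fx s) (fx s * fx r)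
| klr_tx u i j v (r := size u) (w := u ++ [:: i, j & v]) : wt w = al ->
    klr_rel (ft r * fx r.+1 * fe w) ((fx r * ft r + (i == j)%:R) * fe w)
| klr_xt u i j v (r := size u) (w := u ++ [:: i, j & v]) : wt w = al ->
    klr_rel (fx r.+1 * ft r * fe w) ((ft r * fx r + (i == j)%:R) * fe w)
| klr_tx_far r s : (r.+1 < height al)%N -> (s < height al)%N ->
    s != r -> s != r.+1 -> klr_rel (ft r * fx s) (fx s * ft r)
| klr_tt_far r s : (r.+1 < height al)%N -> (s.+1 < height al)%N ->
    (r.+1 < s)%N || (s.+1 < r)%N -> klr_rel (ft r * ft s) (ft s * ft r)
| klr_t2 u i j v (r := size u) (w := u ++ [:: i, j & v]) : wt w = al ->
    klr_rel (ft r ^+ 2 * fe w) (@Qij free i j (fx r) (fx r.+1) * fe w)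
| klr_braid u i j l v (r := size u) (w := u ++ [:: i, j, l & v]) : wt w = al ->
    klr_rel ((ft r.+1 * ft r * ft r.+1 - ft r * ft r.+1 * ft r) * fe w)
      (if i == l
       then eval_zxy (braid_poly i j) (fx r) (fx r.+1) (fx r.+2) * fe w else 0).

Definition klr := quot (fun a : free => exists x y, klr_rel x y /\ a = x - y).
HB.instance Definition _ := KAlgebra.on klr.

Definition kcl (a : free) : klr := qclass _ a.

Lemma kcl_rel x y : klr_rel x y -> kcl x = kcl y.
Proof.
move=> rxy; apply/eqP/quotP; rewrite -[x - y]addr0 -[x - y]kmulx1 -[x - y]kmul1x.
by constructor; [exists x, y | constructor].
Qed.

Lemma kcl_morphism : kalg_morphism kcl.
Proof. exact: qclass_morphism. Qed.

Lemma kcl0 : kcl 0 = 0.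
Proof.
have [lin _ _] := kcl_morphism.
by have := lin (-1) 0 0; rewrite scaler0 addr0 => ->; rewrite scaleN1r addNr.
Qed.

Lemma klr_eM w w' : wt w = al -> wt w' = al ->
  kcl (fe w) *k kcl (fe w') = if w == w' then kcl (fe w) else 0.
Proof.
move=> hw hw'; have [_ _ mul] := kcl_morphism.
by rewrite -mul (kcl_rel (klr_ee hw hw')); case: eqP; rewrite ?kcl0.
Qed.

Lemma klr_sum_idem (p : pred (seq I)) (e := \sum_(w <- words_of al | p w) kcl (fe w)) :
  e *k e = e.
Proof.
rewrite {1}/e kmul_suml big_seq_cond [RHS]big_seq_cond.
apply: eq_bigr => w /andP[win pw]; rewrite kmul_sumr.
have hw : wt w = al by apply/eqP; rewrite -mem_words_of.
rewrite big_mkcond (bigD1_seq w) ?words_of_uniq //= pw klr_eM // eqxx.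
rewrite big_seq_cond big1 ?addr0 // => w' /andP[win' /negbTE ww'].
by case: ifP => // _; rewrite klr_eM // 1?eq_sym ?ww' //; apply/eqP; rewrite -mem_words_of.
Qed.
End Relations.
End KLR.

Arguments fe {k I al} w.
Arguments fx {k I al} r.
Arguments ft {k I al} r.
Arguments kcl {k I} h {al} a.

Section Doubling.
Variables (I0 I1 : choiceType) (h : quiver (I0 + I1)%type).

(* The vertices i^0, i^1, i^2 *)
Definition dbl : choiceType := (I0 + (I1 + I1))%type.
Definition v0 (i : I0) : dbl := inl i.
Definition v1 (i : I1) : dbl := inr (inl i).
Definition v2 (i : I1) : dbl := inr (inr i).

Definition dbl_arrows (a b : dbl) : nat :=
  match a, b with
  | inl i, inl j => h (inl i) (inl j)
  | inl i, inr (inl j) => h (inl i) (inr j)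
  | inr (inr i), inl j => h (inr i) (inl j)
  | inr (inl i), inr (inr j) => (i == j) : nat
  | _, _ => 0%N
  end.

Fact dbl_no_loop a : dbl_arrows a a = 0%N.
Proof. by case: a => [i|[i|i]] //=; apply: no_loop. Qed.
Definition dbl_quiver : quiver dbl := Quiver dbl_no_loop.

Fixpoint phi_word (w : seq (I0 + I1)) : seq dbl :=
  match w with
  | [::] => [::]
  | inl i :: w' => v0 i :: phi_word w'
  | inr i :: w' => [:: v1 i, v2 i & phi_word w']
  end.

Definition phi_root (al : root_lattice (I0 + I1)%type) : root_lattice dbl :=
  fglift (fun a => match a with
                   | inl i => sroot (v0 i)
                   | inr i => sroot (v1 i) + sroot (v2 i)
                   end) al.

Definition in_I1 (a : dbl) : bool := if a is inr (inl _) then true else false.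
Definition in_I2 (a : dbl) : bool := if a is inr (inr _) then true else false.

Definition unordered (w : seq dbl) : bool :=
  has (fun r => count in_I1 (take r w) < count in_I2 (take r w))%N
      (iota 0 (size w).+1).

Definition well_ordered (w : seq dbl) : bool :=
  all (fun r => if onth w r is Some (inr (inl i)) then onth w r.+1 == Some (v2 i)
                else true)
      (iota 0 (size w)).

Section Balanced.
Variables (k : fieldType) (al : root_lattice (I0 + I1)%type).
Local Notation R := (klr k h al).
Local Notation alb := (phi_root al).
Local Notation Rb := (klr k dbl_quiver alb).

Definition e_ord : Rb := \sum_(w <- words_of alb | well_ordered w) kcl dbl_quiver (fe w).

Fact e_ord_idem : e_ord *k e_ord = e_ord.
Proof. exact: klr_sum_idem. Qed.

Definition eRe := corner e_ord_idem.
HB.instance Definition _ := KAlgebra.on eRe.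

Definition unordered_gen (c : eRe) : Prop :=
  exists a w b, [/\ wt w = alb, unordered w &
    val c = e_ord *k a *k kcl dbl_quiver (fe w) *k b *k e_ord].

Definition balanced_klr := quot unordered_gen.
HB.instance Definition _ := KAlgebra.on balanced_klr.

Definition bcl (c : eRe) : balanced_klr := qclass _ c.

Definition crossing (a b : I0 + I1) (r : nat) : free_alg k (klr_gen alb) :=
  let t := @ft k _ alb in
  match a, b with
  | inl _, inl _ => t r
  | inr _, inl _ => t r * t r.+1
  | inl _, inr _ => t r.+1 * t r
  | inr i, inr j =>
      let c := t r.+1 * t r.+2 * t r * t r.+1 in if i == j then - c else c
  end.

(* The class in S of an element of eRe given as a word in the generators; the
   elements below already lie in eRe. *)
Definition bcl_free (a : free_alg k (klr_gen alb)) : balanced_klr :=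
  bcl (corner_proj e_ord_idem (kcl dbl_quiver a)).

(* Phi is determined by these values, as the e(i), x_r e(i), tau_r e(i) generate
   R_al; that it is moreover bijective is not needed to form psi' o Phi. *)
Record is_Phi (f : R -> balanced_klr) : Prop := IsPhi {
  Phi_morphism : kalg_morphism f;
  Phi_e : forall w, wt w = al ->
    f (kcl h (fe w)) = bcl_free (fe (phi_word w));
  Phi_x : forall u a v, wt (u ++ a :: v) = al ->
    f (kcl h (fx (size u) * fe (u ++ a :: v)))
    = bcl_free (fx (size (phi_word u)) * fe (phi_word (u ++ a :: v)));
  Phi_t : forall u a b v, wt (u ++ [:: a, b & v]) = al ->
    f (kcl h (ft (size u) * fe (u ++ [:: a, b & v])))
    = bcl_free (crossing a b (size (phi_word u))
                * fe (phi_word (u ++ [:: a, b & v])))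
}.
End Balanced.
End Doubling.
Arguments v0 {I0 I1} i.
Arguments v1 {I0 I1} i.
Arguments v2 {I0 I1} i.
Arguments bcl {I0 I1 h k al} c.

Record lcat (k : fieldType) := LCat {
  ob :> Type;
  hom : ob -> ob -> lmodType k;
  idm : forall A, hom A A;
  ccomp : forall A B C, hom B C -> hom A B -> hom A C;
  ccompA : forall A B C D (f : hom C D) (g : hom B C) (e : hom A B),
    ccomp f (ccomp g e) = ccomp (ccomp f g) e;
  ccomp1m : forall A B (f : hom A B), ccomp (idm B) f = f;
  ccompm1 : forall A B (f : hom A B), ccomp f (idm A) = f;
  ccomp_linl : forall A B C (e : hom A B), linear (fun g : hom B C => ccomp g e);
  ccomp_linr : forall A B C (g : hom B C), linear (fun e : hom A B => ccomp g e)
}.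
Arguments hom {k l} _ _.
Arguments idm {k l} _.
Arguments ccomp {k l A B C} _ _.
Notation "g \oc f" := (ccomp g f) (at level 40, left associativity) : ring_scope.

Section Abelian.
Variables (k : fieldType) (C : lcat k).

Definition hom_finite : Prop := forall A B : C, exists (n : nat) (b : 'I_n -> hom A B),
  forall f, exists c : 'I_n -> k, f = \sum_i c i *: b i.

Definition zero_ob (A : C) : Prop := idm A = 0.

Definition monic (A B : C) (f : hom A B) : Prop :=
  forall X (u v : hom X A), f \oc u = f \oc v -> u = v.
Definition epic (A B : C) (f : hom A B) : Prop :=
  forall X (u v : hom B X), u \oc f = v \oc f -> u = v.

Definition is_kernel (K A B : C) (i : hom K A) (f : hom A B) : Prop :=
  f \oc i = 0 /\
  forall X (g : hom X A), f \oc g = 0 -> exists! u : hom X K, i \oc u = g.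
Definition is_cokernel (A B K : C) (p : hom B K) (f : hom A B) : Prop :=
  p \oc f = 0 /\
  forall X (g : hom B X), g \oc f = 0 -> exists! u : hom K X, u \oc p = g.

Definition is_biproduct (A B P : C) : Prop :=
  exists (i1 : hom A P) (i2 : hom B P) (p1 : hom P A) (p2 : hom P B),
    [/\ p1 \oc i1 = idm A, p2 \oc i2 = idm B, p2 \oc i1 = 0, p1 \oc i2 = 0
      & i1 \oc p1 + i2 \oc p2 = idm P].

Record abelian : Prop := Abelian {
  ab_zero : exists Z : C, zero_ob Z;
  ab_biproduct : forall A B : C, exists P, is_biproduct A B P;
  ab_kernel : forall (A B : C) (f : hom A B), exists K (i : hom K A), is_kernel i f;
  ab_cokernel : forall (A B : C) (f : hom A B), exists K (p : hom B K), is_cokernel p f;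
  ab_monic : forall (A B : C) (f : hom A B), monic f ->
    exists X (g : hom B X), is_kernel f g;
  ab_epic : forall (A B : C) (f : hom A B), epic f ->
    exists X (g : hom X A), is_cokernel f g
}.

(* C is the direct sum of the full subcategories D_t: every object is the
   direct sum of a family of objects N_t of D_t, almost all of them zero. *)
Definition cat_decomposition (T : eqType) (D : T -> C -> Prop) : Prop :=
  (forall s t A B (f : hom A B), s <> t -> D s A -> D t B -> f = 0) /\
  forall M : C, exists (N : T -> C) (i : forall t, hom (N t) M)
      (p : forall t, hom M (N t)) (supp : seq T),
    [/\ (forall t, D t (N t)),
        (forall t, p t \oc i t = idm (N t)),
        (forall s t, s <> t -> p t \oc i s = 0),
        uniq supp /\ (forall t, t \notin supp -> zero_ob (N t))
      & \sum_(t <- supp) i t \oc p t = idm M].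
End Abelian.

Record functor (k : fieldType) (C D : lcat k) := Functor {
  fob :> C -> D;
  fmap : forall A B, hom A B -> hom (fob A) (fob B);
  fmap_id : forall A, fmap (idm A) = idm (fob A);
  fmap_comp : forall A B E (g : hom B E) (f : hom A B),
    fmap (g \oc f) = fmap g \oc fmap f;
  fmap_lin : forall A B, linear (@fmap A B)
}.
Arguments fmap {k C D} _ {A B} _.

Definition fid (k : fieldType) (C : lcat k) : functor C C.
Proof. by exists (fun A => A) (fun A B f => f). Defined.

Definition fcomp (k : fieldType) (C D E : lcat k) (G : functor D E) (F : functor C D) :
  functor C E.
Proof.
exists (fun A => G (F A)) (fun A B f => fmap G (fmap F f)).
- by move=> A; rewrite !fmap_id.
- by move=> A B X g f; rewrite !fmap_comp.
- by move=> A B c f g; rewrite !fmap_lin.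
Defined.

Definition exact_functor (k : fieldType) (C D : lcat k) (F : functor C D) : Prop :=
  forall (X Y Z : C) (f : hom X Y) (g : hom Y Z),
    is_kernel f g -> is_cokernel g f ->
    is_kernel (fmap F f) (fmap F g) /\ is_cokernel (fmap F g) (fmap F f).

Record nt (k : fieldType) (C D : lcat k) (F G : functor C D) := NT {
  nt_app :> forall A, hom (F A) (G A);
  nt_nat : forall A B (f : hom A B), nt_app B \oc fmap F f = fmap G f \oc nt_app A
}.

Section NatTrans.
Variables (k : fieldType) (C D : lcat k) (F G : functor C D).
Implicit Types a b : nt F G.

Lemma nt_ext a b : (forall A, a A = b A) -> a = b.
Proof.
case: a b => [a na] [b nb] /= ab.
have eab : a = b by apply: functional_extensionality_dep.
by rewrite {a}eab in na ab *; rewrite (Prop_irrelevance na nb).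
Qed.

End NatTrans.

Section CompLinear.
Variables (k : fieldType) (C : lcat k) (A B E : C).
Implicit Types (f : hom A B) (g : hom B E).

Lemma ccompDl g g' f : (g + g') \oc f = g \oc f + g' \oc f.
Proof. by have := ccomp_linl f 1 g g'; rewrite !scale1r. Qed.
Lemma ccompDr g f f' : g \oc (f + f') = g \oc f + g \oc f'.
Proof. by have := ccomp_linr g 1 f f'; rewrite !scale1r. Qed.
Lemma ccomp0x f : (0 : hom B E) \oc f = 0.
Proof. by apply: (addIr (0 \oc f)); rewrite -ccompDl !add0r. Qed.
Lemma ccompx0 g : g \oc (0 : hom A B) = 0.
Proof. by apply: (addIr (g \oc 0)); rewrite -ccompDr !add0r. Qed.
Lemma ccompZl c g f : (c *: g) \oc f = c *: (g \oc f).
Proof. by have := ccomp_linl f c g 0; rewrite !addr0 ccomp0x addr0. Qed.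
Lemma ccompZr c g f : g \oc (c *: f) = c *: (g \oc f).
Proof. by have := ccomp_linr g c f 0; rewrite !addr0 ccompx0 addr0. Qed.
End CompLinear.

Section NatTransLmodule.
Variables (k : fieldType) (C D : lcat k) (F G : functor C D).
Implicit Types a b : nt F G.

HB.instance Definition _ := gen_eqMixin (nt F G).
HB.instance Definition _ := gen_choiceMixin (nt F G).

Program Definition nt_zero : nt F G := @NT _ _ _ F G (fun A => 0) _.
Next Obligation. by rewrite ccomp0x ccompx0. Qed.
Program Definition nt_add a b : nt F G := @NT _ _ _ F G (fun A => a A + b A) _.
Next Obligation. by rewrite ccompDl ccompDr !nt_nat. Qed.
Program Definition nt_scale (c : k) a : nt F G := @NT _ _ _ F G (fun A => c *: a A) _.
Next Obligation. by rewrite ccompZl ccompZr nt_nat. Qed.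
Definition nt_opp a : nt F G := nt_scale (-1) a.

Fact nt_addA : associative nt_add.
Proof. by move=> a b c; apply: nt_ext => A; rewrite /= addrA. Qed.
Fact nt_addC : commutative nt_add.
Proof. by move=> a b; apply: nt_ext => A; rewrite /= addrC. Qed.
Fact nt_add0 : left_id nt_zero nt_add.
Proof. by move=> a; apply: nt_ext => A; rewrite /= add0r. Qed.
Fact nt_addN : left_inverse nt_zero nt_opp nt_add.
Proof. by move=> a; apply: nt_ext => A; rewrite /= scaleN1r addNr. Qed.
HB.instance Definition _ := GRing.isZmodule.Build (nt F G)
  nt_addA nt_addC nt_add0 nt_addN.

Fact nt_scaleA c d a : nt_scale c (nt_scale d a) = nt_scale (c * d) a.
Proof. by apply: nt_ext => A; rewrite /= scalerA. Qed.
Fact nt_scale1 : left_id 1 nt_scale.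
Proof. by move=> a; apply: nt_ext => A; rewrite /= scale1r. Qed.
Fact nt_scaleDr : right_distributive nt_scale +%R.
Proof. by move=> c a b; apply: nt_ext => A; rewrite /= scalerDr. Qed.
Fact nt_scaleDl a : {morph nt_scale^~ a : c d / c + d}.
Proof. by move=> c d; apply: nt_ext => A; rewrite /= scalerDl. Qed.
HB.instance Definition _ := GRing.Zmodule_isLmodule.Build k (nt F G)
  nt_scaleA nt_scale1 nt_scaleDr nt_scaleDl.
End NatTransLmodule.

Section EndOp.
Variables (k : fieldType) (C D : lcat k) (F : functor C D).

Program Definition nt_id : nt F F := @NT _ _ _ F F (fun A => idm (F A)) _.
Next Obligation. by rewrite ccomp1m ccompm1. Qed.
Program Definition nt_comp (b a : nt F F) : nt F F :=
  @NT _ _ _ F F (fun A => b A \oc a A) _.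
Next Obligation. by rewrite -ccompA nt_nat ccompA nt_nat ccompA. Qed.

(* End(F)^op: the product of a and b is b after a. *)
Definition End_op := nt F F.
Definition end_mul (a b : End_op) : End_op := nt_comp b a.
HB.instance Definition _ := GRing.Lmodule.on End_op.

Fact end_mulA : associative end_mul.
Proof. by move=> a b c; apply: nt_ext => A; rewrite /= ccompA. Qed.
Fact end_mul1x : left_id (nt_id : End_op) end_mul.
Proof. by move=> a; apply: nt_ext => A; rewrite /= ccompm1. Qed.
Fact end_mulx1 : right_id (nt_id : End_op) end_mul.
Proof. by move=> a; apply: nt_ext => A; rewrite /= ccomp1m. Qed.
Fact end_mulDl : left_distributive end_mul +%R.
Proof. by move=> a b c; apply: nt_ext => A; rewrite /= ccompDr. Qed.
Fact end_mulDr : right_distributive end_mul +%R.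
Proof. by move=> a b c; apply: nt_ext => A; rewrite /= ccompDl. Qed.
Fact end_mulZl c a b : end_mul (c *: a) b = c *: end_mul a b.
Proof. by apply: nt_ext => A; rewrite /= ccompZr. Qed.
Fact end_mulZr c a b : end_mul a (c *: b) = c *: end_mul a b.
Proof. by apply: nt_ext => A; rewrite /= ccompZl. Qed.
HB.instance Definition _ := Lmodule_isKAlgebra.Build k End_op
  end_mulA end_mul1x end_mulx1 end_mulDl end_mulDr end_mulZl end_mulZr.
End EndOp.

Definition left_adjoint (k : fieldType) (C D : lcat k) (L : functor C D)
    (R : functor D C) : Prop :=
  exists (eta : nt (fid C) (fcomp R L)) (eps : nt (fcomp L R) (fid D)),
    (forall A, eps (L A) \oc fmap L (eta A) = idm (L A)) /\
    (forall B, fmap R (eps B) \oc eta (R B) = idm (R B)).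

Definition biadjoint (k : fieldType) (C D : lcat k) (L : functor C D)
    (R : functor D C) : Prop :=
  left_adjoint L R /\ left_adjoint R L.

(* F is the direct sum of the functors F_t, and for each object A all but
   finitely many F_t(A) vanish. *)
Record functor_sum (k : fieldType) (C D : lcat k) (T : eqType)
    (Ft : T -> functor C D) (F : functor C D) := FunctorSum {
  fs_inj : forall t, nt (Ft t) F;
  fs_prj : forall t, nt F (Ft t);
  fs_injK : forall t A, fs_prj t A \oc fs_inj t A = idm (Ft t A);
  fs_orth : forall s t A, s <> t -> fs_prj t A \oc fs_inj s A = 0;
  fs_finite : forall A, exists supp : seq T,
    [/\ uniq supp, (forall t, t \notin supp -> zero_ob (Ft t A))
      & \sum_(t <- supp) fs_inj t A \oc fs_prj t A = idm (F A)]
}.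

Section Words.
Variables (k : fieldType) (C : lcat k).

(* F_{i_d} .. F_{i_1} for the word i_1 .. i_d *)
Fixpoint fword (T : Type) (Ft : T -> functor C C) (w : seq T) : functor C C :=
  if w is i :: w' then fcomp (fword Ft w') (Ft i) else fid C.

Variable F : functor C C.

Fixpoint fpow (d : nat) : functor C C :=
  if d is d'.+1 then fcomp (fpow d') F else fid C.

(* F^(d-r-1) x F^r, for r < d *)
Fixpoint x_at (x : nt F F) (d r : nat) (M : C) : hom (fpow d M) (fpow d M) :=
  match d, r with
  | 0, _ => 0
  | d'.+1, 0 => fmap (fpow d') (x M)
  | d'.+1, r'.+1 => x_at x d' r' (F M)
  end.

(* F^(d-r-2) tau F^r, for r.+1 < d *)
Fixpoint tau_at (tau : nt (fcomp F F) (fcomp F F)) (d r : nat) (M : C) :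
    hom (fpow d M) (fpow d M) :=
  match d, r with
  | d'.+1, r'.+1 => tau_at tau d' r' (F M)
  | d''.+2, 0 => fmap (fpow d'') (tau M)
  | _, _ => 0
  end.

Variables (T : eqType) (Ft : T -> functor C C) (S : functor_sum Ft F).

(* The inclusion of the summand F_{i_d} .. F_{i_1} in F^d, and the projection;
   the word is to have length d. *)
Fixpoint word_inj (d : nat) (w : seq T) (M : C) : hom (fword Ft w M) (fpow d M) :=
  match d, w with
  | 0, [::] => idm M
  | d'.+1, i :: w' => word_inj d' w' (F M) \oc fmap (fword Ft w') (fs_inj S i M)
  | _, _ => 0
  end.
Fixpoint word_prj (d : nat) (w : seq T) (M : C) : hom (fpow d M) (fword Ft w M) :=
  match d, w with
  | 0, [::] => idm M
  | d'.+1, i :: w' => fmap (fword Ft w') (fs_prj S i M) \oc word_prj d' w' (F M)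
  | _, _ => 0
  end.
Definition word_proj (d : nat) (w : seq T) (M : C) : hom (fpow d M) (fpow d M) :=
  word_inj d w M \oc word_prj d w M.
End Words.

(* A homomorphism R_d -> End(F^d)^op out of R_d, the direct sum of the algebras
   R_al with |al| = d (without unit if I is infinite), is given by its
   restrictions qc_psi d al to the R_al, whose images annihilate each other.
   Its values are prescribed on x_r e(i) and tau_r e(i), since for infinite I
   the sums x_r and tau_r over all al are not elements of R_d. *)
Record quasi_categorical_rep (k : fieldType) (I : choiceType) (h : quiver I)
    (C : lcat k) (D : root_lattice I -> C -> Prop) (Ei Fi : I -> functor C C) :=
  QuasiCategoricalRep {
  qc_decomposition : cat_decomposition D;
  qc_E : functor C C;
  qc_F : functor C C;
  qc_biadjoint : biadjoint qc_E qc_F;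
  qc_exactE : exact_functor qc_E;
  qc_exactF : exact_functor qc_F;
  qc_x : nt qc_F qc_F;
  qc_tau : nt (fcomp qc_F qc_F) (fcomp qc_F qc_F);
  qc_sumE : functor_sum Ei qc_E;
  qc_sumF : functor_sum Fi qc_F;
  qc_weightE : forall i al M, D al M -> D (al - sroot i) (Ei i M);
  qc_weightF : forall i al M, D al M -> D (al + sroot i) (Fi i M);
  qc_psi : forall (d : nat) (al : root_lattice I), klr k h al -> End_op (fpow qc_F d);
  qc_psi_linear : forall d al, rpos al -> height al = d -> linear (@qc_psi d al);
  qc_psiM : forall d al, rpos al -> height al = d ->
    {morph (@qc_psi d al) : a b / a *k b};
  qc_psi_orth : forall d al be, rpos al -> height al = d -> rpos be -> height be = d ->
    al <> be -> forall a b, @qc_psi d al a *k @qc_psi d be b = 0;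
  qc_psi_e : forall d al w M, height al = d -> wt w = al ->
    @qc_psi d al (kcl h (fe w)) M = word_proj qc_sumF d w M;
  qc_psi_x : forall d al r w M, height al = d -> (r < d)%N -> wt w = al ->
    @qc_psi d al (kcl h (fx r * fe w)) M = word_proj qc_sumF d w M \oc x_at qc_x d r M;
  qc_psi_tau : forall d al r w M, height al = d -> (r.+1 < d)%N -> wt w = al ->
    @qc_psi d al (kcl h (ft r * fe w)) M = word_proj qc_sumF d w M \oc tau_at qc_tau d r M;
  qc_nilpotent : forall M, exists n, iter n (ccomp (qc_x M)) (idm (qc_F M)) = 0
}.

Section FullSubcategory.
Variables (k : fieldType) (C : lcat k) (P : C -> Prop).

Definition fullsub : lcat k :=
  @LCat k {A : C | P A} (fun A B => hom (sval A) (sval B))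
    (fun A => idm (sval A)) (fun A B E g f => g \oc f)
    (fun A B E X => @ccompA k C (sval A) (sval B) (sval E) (sval X))
    (fun A B => @ccomp1m k C (sval A) (sval B))
    (fun A B => @ccompm1 k C (sval A) (sval B))
    (fun A B E => @ccomp_linl k C (sval A) (sval B) (sval E))
    (fun A B E => @ccomp_linr k C (sval A) (sval B) (sval E)).

Definition inclusion : functor fullsub C :=
  @Functor k fullsub C (fun A => sval A) (fun A B f => f)
    (fun A => erefl) (fun A B E g f => erefl) (fun A B c f g => erefl).

Record abelian_subcategory : Prop := AbelianSubcategory {
  absub_abelian : abelian fullsub;
  absub_exact : exact_functor inclusion
}.

Definition frestrict (F : functor C C) (PF : forall M, P M -> P (F M)) :
    functor fullsub fullsub :=
  @Functor k fullsub fullsub (fun A => exist P (F (sval A)) (PF _ (svalP A)))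
    (fun A B f => fmap F f)
    (fun A => fmap_id F (sval A))
    (fun A B E => @fmap_comp k C C F (sval A) (sval B) (sval E))
    (fun A B => @fmap_lin k C C F (sval A) (sval B)).
End FullSubcategory.

Section Restriction.
Variables (k : fieldType) (I0 I1 : choiceType) (C : lcat k) (P : C -> Prop).

Definition E_restr (Eb : dbl I0 I1 -> functor C C)
    (PE0 : forall i M, P M -> P (Eb (v0 i) M))
    (PE1 : forall i M, P M -> P (fcomp (Eb (v1 i)) (Eb (v2 i)) M))
    (i : I0 + I1) : functor (fullsub P) (fullsub P) :=
  match i with
  | inl i => frestrict (PE0 i)
  | inr i => frestrict (PE1 i)
  end.

Variable Fb : dbl I0 I1 -> functor C C.
Hypothesis PF0 : forall i M, P M -> P (Fb (v0 i) M).
Hypothesis PF1 : forall i M, P M -> P (fcomp (Fb (v2 i)) (Fb (v1 i)) M).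

Definition F_restr (i : I0 + I1) : functor (fullsub P) (fullsub P) :=
  match i with
  | inl i => frestrict (PF0 i)
  | inr i => frestrict (PF1 i)
  end.

(* On the subcategory, F_{i_d} .. F_{i_1} and the composite of the functors Fb
   along phi(i) coincide; the next two maps are the identity. *)
Fixpoint phi_to (w : seq (I0 + I1)) (M : fullsub P) {struct w} :
    hom (sval (fword F_restr w M)) (fword Fb (phi_word w) (sval M)) :=
  match w with
  | [::] => idm (sval M)
  | i :: w' =>
      match i with
      | inl i => phi_to w' (frestrict (PF0 i) M)
      | inr i => phi_to w' (frestrict (PF1 i) M)
      end
  end.
Fixpoint phi_from (w : seq (I0 + I1)) (M : fullsub P) {struct w} :
    hom (fword Fb (phi_word w) (sval M)) (sval (fword F_restr w M)) :=
  match w with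
  | [::] => idm (sval M)
  | i :: w' =>
      match i with
      | inl i => phi_from w' (frestrict (PF0 i) M)
      | inr i => phi_from w' (frestrict (PF1 i) M)
      end
  end.

(* The subcategories C_al, the intersections of C with the Db_phi(al) *)
Definition sub_weights (Db : root_lattice (dbl I0 I1) -> C -> Prop)
    (al : root_lattice (I0 + I1)%type) (M : fullsub P) : Prop :=
  Db (phi_root al) (sval M).

Variable al : root_lattice (I0 + I1)%type.

(* The data exhibiting Fa as F_al, the direct sum of the F_{i_d} .. F_{i_1}
   over I^al *)
Definition Falpha_sum (Fa : functor (fullsub P) (fullsub P)) : Type :=
  functor_sum (fun w : {w | wt w == al} => fword F_restr (val w)) Fa.

Variables (h : quiver (I0 + I1)%type) (Db : root_lattice (dbl I0 I1) -> C -> Prop).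
Variables (Eb : dbl I0 I1 -> functor C C).
Variable rep : quasi_categorical_rep (dbl_quiver h) Db Eb Fb.
Variables (Fa : functor (fullsub P) (fullsub P)) (S : Falpha_sum Fa).

(* psi' is induced by the compression to F_al, that is to the summands of
   Fb^d indexed by the words phi(w), of the values of psi_d on e R e. The
   words phi(w), w in I^al, are the well-ordered words of weight phi(al). *)
Record is_psi_bar' (psi' : balanced_klr h k al -> End_op Fa) : Prop := IsPsiBar' {
  psi_bar'_morphism : kalg_morphism psi';
  psi_bar'_component : forall (c : eRe h k al) (w w' : {w | wt w == al}) (M : fullsub P),
    fs_prj S w' M \oc psi' (bcl c) M \oc fs_inj S w M
    = (let d := height (phi_root al) in
       phi_from (val w') M
       \oc word_prj (qc_sumF rep) d (phi_word (val w')) (sval M)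
       \oc qc_psi rep d (val c) (sval M)
       \oc word_inj (qc_sumF rep) d (phi_word (val w)) (sval M)
       \oc phi_to (val w) M)
}.
End Restriction.
Arguments sub_weights {k I0 I1 C} P Db al M.

(* Main.v *)
Require Import Defs.
From mathcomp Require Import all_boot all_order all_algebra.
From mathcomp Require Import generic_quotient boolp.
From mathcomp.multinomials Require Import monalg freeg.
From mathcomp Require Import zify.
Import Defs.
Local Open Scope ring_scope.

(** The functors E_i and F_i of the given representation are biadjoint, since the
    off-diagonal components of the units and counits vanish for reasons of
    weight. Hence so are the composites along i^1, i^2, their restrictions to the
    subcategory, and the locally finite sums E and F of these restrictions; E and
    F are exact because they have adjoints on both sides.

    psi' is the compression c |-> P psi(c) Q to F_alpha, a summand of Fb^d. The
    point is that it kills e R e(w) R e for w unordered, although the functor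
    F_w need not vanish on the subcategory. An element of e(w) R e(phi(u)) is a
    combination of products of tau's and x's; as w is unordered, in such a
    product the two strands of some pair i^1, i^2 of phi(u) cross. By the exchange
    property the product is, up to shorter ones, divisible on the right by the
    crossing of that pair, so it factors through a word phi(u_1) i^2 .., on which
    the functor vanishes by (c).

    Finally x and tau on F are defined by their components, which are the
    compressions of the elements Phi(x_r e(i)) and Phi(tau_r e(i)) on one and
    two letters; that they give the same thing in the middle of a longer word
    follows from the naturality of x and tau of the ambient representation. *)

Set Implicit Arguments.
Unset Strict Implicit.
Unset Printing Implicit Defensive.
Import GRing.Theory Num.Theory.

(** * Direct sums and adjunctions in linear categories *)

(** Condition (c) directly kills only the words phi(u) i^2 v: after an unpaired i^1 one has left the
    subcategory, so about the unordered word (i^1, j^2, i^2, j^1) with i and j distinct it says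
    nothing. The vanishing must therefore be found in the algebra, on morphisms that factor through
    words phi(u) i^2 v. The induction runs over arbitrary products of tau, reduced or not. It closes
    up because the left factor e(w) discards every lower monomial that does not end at w itself;
    each remaining one still leads from phi(u) to the same unordered w, so it again crosses a pair.

    The endofunctors E and F of the subcategory are not restrictions of the ambient ones; only their
    components are. This is why the adjunctions are first split into components and then
    reassembled. For the same reason there are two powers to relate: psi' is compressed from the
    ambient F^d with d = |phi(alpha)| to F_alpha, and then extended by zero from F_alpha to the new
    F^d with d = |alpha|. *)

Lemma big_only (V : nmodType) (T : eqType) (s : seq T) (t : T) (F : T -> V) :
  uniq s -> t \in s -> (forall u, u <> t -> F u = 0) -> \sum_(u <- s) F u = F t.
Proof.
by move=> us ts F0; rewrite (bigD1_seq t) //= big1 ?addr0 // => u /eqP; apply: F0.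
Qed.

Section LinearCategories.
Variables (k : fieldType) (C : lcat k).

Lemma ccomp_suml (T : Type) (s : seq T) (P : pred T) (A B E : C)
    (g : T -> hom B E) (f : hom A B) :
  (\sum_(t <- s | P t) g t) \oc f = \sum_(t <- s | P t) g t \oc f.
Proof.
by apply: (big_morph (fun x => x \oc f)) => [a b|]; [exact: ccompDl | exact: ccomp0x].
Qed.

Lemma ccomp_sumr (T : Type) (s : seq T) (P : pred T) (A B E : C)
    (g : hom B E) (f : T -> hom A B) :
  g \oc (\sum_(t <- s | P t) f t) = \sum_(t <- s | P t) g \oc f t.
Proof. by apply: (big_morph (ccomp g)) => [a b|]; [exact: ccompDr | exact: ccompx0]. Qed.

Lemma zero_ob_from (A B : C) (f g : hom A B) : zero_ob A -> f = g.
Proof. by move=> zA; rewrite -(ccompm1 f) -(ccompm1 g) zA !ccompx0. Qed.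

Lemma zero_ob_to (A B : C) (f g : hom A B) : zero_ob B -> f = g.
Proof. by move=> zB; rewrite -(ccomp1m f) -(ccomp1m g) zB !ccomp0x. Qed.

Variables (D : lcat k) (F : functor C D).

Lemma fmap0 (A B : C) : fmap F (0 : hom A B) = 0.
Proof. by have := fmap_lin F (-1) (0 : hom A B) 0; rewrite scaler0 addr0 scaleN1r addNr. Qed.

Lemma fmapD (A B : C) (f g : hom A B) : fmap F (f + g) = fmap F f + fmap F g.
Proof. by have := fmap_lin F 1 f g; rewrite !scale1r. Qed.

Lemma fmapZ (A B : C) c (f : hom A B) : fmap F (c *: f) = c *: fmap F f.
Proof. by have := fmap_lin F c f 0; rewrite !addr0 fmap0 addr0. Qed.

Lemma fmap_sum (T : Type) (s : seq T) (P : pred T) (A B : C) (f : T -> hom A B) :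
  fmap F (\sum_(t <- s | P t) f t) = \sum_(t <- s | P t) fmap F (f t).
Proof. by apply: (big_morph (fmap F)) => [a b|]; [exact: fmapD | exact: fmap0]. Qed.

Lemma zero_ob_functor (A : C) : zero_ob A -> zero_ob (F A).
Proof. by rewrite /zero_ob => zA; rewrite -fmap_id zA fmap0. Qed.
End LinearCategories.

(** * Locally finite direct sums of objects and of functors *)

Section DirectSums.
Variables (k : fieldType).

(** The pointwise counterpart of [functor_sum]. The index type may be infinite; the sums are finite
    because every summand off [dsupp] is a zero object. *)
Record dsum (C : lcat k) (T : eqType) (Y : T -> C) (X : C) := DSum {
  dinj : forall t, hom (Y t) X;
  dprj : forall t, hom X (Y t);
  dinjK : forall t, dprj t \oc dinj t = idm (Y t);
  dorth : forall s t, s <> t -> dprj t \oc dinj s = 0;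
  dsupp : seq T;
  dsupp_uniq : uniq dsupp;
  dsupp_zero : forall t, t \notin dsupp -> zero_ob (Y t);
  dsum_id : \sum_(t <- dsupp) dinj t \oc dprj t = idm X
}.

Section Maps.
Variables (C : lcat k) (T : eqType) (Y : T -> C) (X : C) (d : dsum Y X).

Lemma dsum_monoP (Z : C) (f g : hom Z X) :
  (forall t, dprj d t \oc f = dprj d t \oc g) -> f = g.
Proof.
move=> fg; rewrite -(ccomp1m f) -(ccomp1m g) -(dsum_id d) !ccomp_suml.
by apply: eq_bigr => t _; rewrite -!ccompA fg.
Qed.

Lemma dsum_epiP (Z : C) (f g : hom X Z) :
  (forall t, f \oc dinj d t = g \oc dinj d t) -> f = g.
Proof.
move=> fg; rewrite -(ccompm1 f) -(ccompm1 g) -(dsum_id d) !ccomp_sumr.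
by apply: eq_bigr => t _; rewrite !ccompA fg.
Qed.

Lemma dsum_single t (Z : C) (f : hom X Z) : (forall u, u <> t -> f \oc dinj d u = 0) ->
  f \oc dinj d t \oc dprj d t = f.
Proof.
move=> f0; apply: dsum_epiP => u; rewrite -ccompA.
have [<-|/eqP ut] := eqVneq u t; first by rewrite dinjK ccompm1.
by rewrite dorth // ccompx0 f0.
Qed.

Definition dpair (Z : C) (g : forall t, hom Z (Y t)) : hom Z X :=
  \sum_(t <- dsupp d) dinj d t \oc g t.

(** Off the support the target [Y t] is a zero object, so the formula holds for every [t], although
    [dpair] sums over [dsupp] only. *)
Lemma dprj_pair (Z : C) (g : forall t, hom Z (Y t)) t : dprj d t \oc dpair g = g t.
Proof.
rewrite /dpair ccomp_sumr.
have [tin|tout] := boolP (t \in dsupp d); last exact: zero_ob_to (dsupp_zero tout).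
rewrite (bigD1_seq t) ?dsupp_uniq //= ccompA dinjK ccomp1m big1 ?addr0 // => s /eqP st.
by rewrite ccompA dorth // ccomp0x.
Qed.

Definition dcopair (Z : C) (g : forall t, hom (Y t) Z) : hom X Z :=
  \sum_(t <- dsupp d) g t \oc dprj d t.

Lemma dcopair_inj (Z : C) (g : forall t, hom (Y t) Z) t : dcopair g \oc dinj d t = g t.
Proof.
rewrite /dcopair ccomp_suml.
have [tin|tout] := boolP (t \in dsupp d); last exact: zero_ob_from (dsupp_zero tout).
rewrite (bigD1_seq t) ?dsupp_uniq //= -ccompA dinjK ccompm1 big1 ?addr0 // => s /eqP st.
by rewrite -ccompA dorth ?ccompx0 // => ts; apply: st.
Qed.
End Maps.

Definition dsum_fmap (C D : lcat k) (F : functor C D) (T : eqType) (Y : T -> C) (X : C)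
  (d : dsum Y X) : dsum (fun t => F (Y t)) (F X).
Proof.
exists (fun t => fmap F (dinj d t)) (fun t => fmap F (dprj d t)) (dsupp d).
- by move=> t; rewrite -fmap_comp dinjK fmap_id.
- by move=> s t st; rewrite -fmap_comp dorth // fmap0.
- exact: dsupp_uniq.
- by move=> t /dsupp_zero; apply: zero_ob_functor.
- by rewrite -fmap_id -(dsum_id d) fmap_sum; apply: eq_bigr => t _; rewrite fmap_comp.
Defined.

Definition dsum_trans (C : lcat k) (T U : eqType) (Y : T -> C) (Z : T -> U -> C) (X : C)
  (d : dsum Y X) (e : forall t, dsum (Z t) (Y t)) :
  dsum (fun tu : T * U => Z tu.1 tu.2) X.
Proof.
exists (fun tu => dinj d tu.1 \oc dinj (e tu.1) tu.2)
       (fun tu => dprj (e tu.1) tu.2 \oc dprj d tu.1)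
       [seq (t, u) | t <- dsupp d, u <- dsupp (e t)].
- by case=> t u /=; rewrite ccompA -(ccompA _ (dprj d t)) dinjK ccompm1 dinjK.
- case=> t u [t' u'] /= ne; rewrite ccompA -(ccompA _ (dprj d t')).
  have [tt'|/eqP tt'] := eqVneq t t'; last by rewrite dorth // ccompx0 ccomp0x.
  case: t' / tt' ne => ne; rewrite dinjK ccompm1 dorth // => uu'.
  by rewrite uu' in ne.
- apply: allpairs_uniq_dep; first exact: dsupp_uniq.
  + by move=> t _; apply: dsupp_uniq.
  + by case=> t u [t' u'] _ _ /= [-> ->].
- case=> t u /= notin; have [tin|/(dsupp_zero (d := d)) zt] := boolP (t \in dsupp d).
    apply: (dsupp_zero (d := e t)); apply: contra notin => uin.
    by apply/allpairsPdep; exists t, u.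
  by rewrite /zero_ob -(dinjK (e t)) (zero_ob_to (dinj (e t) u) 0 zt) ccompx0.
- rewrite big_allpairs_dep -(dsum_id d); apply: eq_bigr => t _ /=.
  transitivity (dinj d t \oc (\sum_(u <- dsupp (e t)) dinj (e t) u \oc dprj (e t) u)
     \oc dprj d t); last by rewrite dsum_id ccompm1.
  by rewrite ccomp_sumr ccomp_suml; apply: eq_bigr => u _; rewrite !ccompA.
Defined.

Definition fs_dsum (C D : lcat k) (T : eqType) (Ft : T -> functor C D) (F : functor C D)
    (S : functor_sum Ft F) (M : C) : dsum (fun t => Ft t M) (F M) :=
  let s := cid (fs_finite S M) in
  @DSum D T (fun t => Ft t M) (F M) (fun t => fs_inj S t M) (fun t => fs_prj S t M)
    (fun t => fs_injK S t M) (fun s t ne => @fs_orth _ _ _ _ _ _ S s t M ne) (sval s)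
    (let: And3 u _ _ := svalP s in u) (let: And3 _ z _ := svalP s in z)
    (let: And3 _ _ e := svalP s in e).

Section Existence.
Variables (C : lcat k) (Cab : abelian C) (T : eqType) (Y : T -> C).

(** A Kronecker delta. Source and target depend on the index, so the identity is cast along [t = u];
    uniqueness of identity proofs on an [eqType] removes the cast again. *)
Definition kron (t u : T) : hom (Y t) (Y u) :=
  match t =P u with
  | ReflectT e => ecast x (hom (Y t) (Y x)) e (idm (Y t))
  | ReflectF _ => 0
  end.

Lemma kron_refl t : kron t t = idm (Y t).
Proof. by rewrite /kron; case: eqP => // e; rewrite eq_axiomK. Qed.

Lemma kron_neq t u : t <> u -> kron t u = 0.
Proof. by rewrite /kron; case: eqP. Qed.

Lemma partial_dsum_exists (s : seq T) : uniq s ->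
  exists (X : C) (i : forall t, hom (Y t) X) (p : forall t, hom X (Y t)),
    [/\ forall t u, p u \oc i t = if t \in s then kron t u else 0
      & \sum_(t <- s) i t \oc p t = idm X].
Proof.
elim: s => [_|t0 s IH /= /andP[t0s su]].
  have [Z zZ] := ab_zero Cab.
  by exists Z, (fun => 0), (fun => 0); split=> [t u|]; rewrite ?big_nil ?ccompx0.
have [X [i [p [pi ip]]]] := IH su.
have [B [i1 [i2 [p1 [p2 [K1 K2 K12 K21 Kid]]]]]] := ab_biproduct Cab (Y t0) X.
have compE t u : (kron t0 u \oc p1 + p u \oc p2) \oc (i1 \oc kron t t0 + i2 \oc i t)
    = kron t0 u \oc kron t t0 + p u \oc i t.
  rewrite ccompDl !ccompDr !ccompA -(ccompA _ p1 i1) -(ccompA _ p1 i2) -(ccompA _ p2 i1).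
  by rewrite -(ccompA _ p2 i2) K1 K2 K12 K21 !ccompm1 !ccompx0 !ccomp0x addr0 add0r.
exists B, (fun t => i1 \oc kron t t0 + i2 \oc i t),
  (fun t => kron t0 t \oc p1 + p t \oc p2); split=> [t u|].
  rewrite compE pi inE; case: eqVneq => [->|/eqP ne] /=.
    by rewrite kron_refl ccompm1 (negbTE t0s) addr0.
  by rewrite (kron_neq ne) ccompx0 add0r.
(* The families are indexed by all of [T]. Since the identity of [X] is a sum over [s], the maps
   with index outside [s] vanish, which leaves the new block [i1 \oc p1] alone at [t0]. *)
have i0 : i t0 = 0.
  rewrite -(ccomp1m (i t0)) -ip ccomp_suml big1 // => t _.
  by rewrite -ccompA pi (negbTE t0s) ccompx0.
have p0 : p t0 = 0.
  rewrite -(ccompm1 (p t0)) -ip ccomp_sumr big1_seq // => t /= ts.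
  rewrite ccompA pi ts kron_neq ?ccomp0x // => tt0.
  by rewrite -tt0 ts in t0s.
rewrite big_cons kron_refl i0 p0 ccomp0x ccompx0 !addr0 ccompm1 ccomp1m -Kid.
congr (_ + _).
rewrite -[X in X \oc p2](ccompm1 i2) -ip ccomp_sumr ccomp_suml; apply: eq_big_seq => t ts.
have ne : t <> t0 by move=> tt0; rewrite -tt0 ts in t0s.
rewrite (kron_neq ne) kron_neq; last by move=> e; apply: ne.
by rewrite ccompx0 ccomp0x !add0r !ccompA.
Qed.

Lemma dsum_exists (s : seq T) : (forall t, t \notin s -> zero_ob (Y t)) ->
  exists X, inhabited (dsum Y X).
Proof.
move=> zs; have [X [i [p [pi ip]]]] := partial_dsum_exists (undup_uniq s).
have zs' t : t \notin undup s -> zero_ob (Y t) by rewrite mem_undup; apply: zs.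
exists X; constructor; exists i p (undup s) => //; last exact: undup_uniq.
- move=> t; rewrite pi; case: ifP => [_|/negbT/zs' zt]; first exact: kron_refl.
  exact: zero_ob_from.
- by move=> t u ne; rewrite pi (kron_neq ne) if_same.
Qed.
End Existence.

(** One direct sum is chosen for each object; the action on morphisms is then forced by the
    projections, and functoriality and linearity are read off from them. *)
Lemma functor_sum_exists (C D : lcat k) (Dab : abelian D) (T : eqType)
    (Ft : T -> functor C D) :
  (forall M, exists s : seq T, forall t, t \notin s -> zero_ob (Ft t M)) ->
  exists F : functor C D, inhabited (functor_sum Ft F).
Proof.
move=> fin.
have ex M : exists X, inhabited (dsum (fun t => Ft t M) X).
  by have [s zs] := fin M; apply: dsum_exists zs.
pose X M := sval (cid (ex M)).
pose d M : dsum (fun t => Ft t M) (X M) := inhabited_witness (svalP (cid (ex M))).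
pose act M N (f : hom M N) := dpair (d N) (fun t => fmap (Ft t) f \oc dprj (d M) t).
have actE M N (f : hom M N) t : dprj (d N) t \oc act M N f = fmap (Ft t) f \oc dprj (d M) t.
  exact: dprj_pair.
have act_id M : act M M (idm M) = idm (X M).
  by apply: (dsum_monoP (d := d M)) => t; rewrite actE fmap_id ccomp1m ccompm1.
have act_comp A B E (g : hom B E) (f : hom A B) :
    act A E (g \oc f) = act B E g \oc act A B f.
  apply: (dsum_monoP (d := d E)) => t.
  by rewrite actE ccompA actE -ccompA actE fmap_comp ccompA.
have act_lin A B : linear (act A B).
  move=> c f g; apply: (dsum_monoP (d := d B)) => t.
  by rewrite ccompDr ccompZr !actE fmapD fmapZ ccompDl ccompZl.
exists (Functor act_id act_comp act_lin); constructor.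
have prj_nat t A B (f : hom A B) : dprj (d B) t \oc act A B f = fmap (Ft t) f \oc dprj (d A) t.
  exact: actE.
have inj_nat t A B (f : hom A B) : dinj (d B) t \oc fmap (Ft t) f = act A B f \oc dinj (d A) t.
  apply: (dsum_monoP (d := d B)) => s.
  rewrite !ccompA actE -(ccompA (fmap (Ft s) f)).
  have [st|/eqP ne] := eqVneq t s.
    by case: s / st; rewrite !dinjK ccomp1m ccompm1.
  by rewrite !(dorth _ ne) ccomp0x ccompx0.
exists (fun t => @NT _ _ _ (Ft t) (Functor act_id act_comp act_lin) _ (inj_nat t))
       (fun t => @NT _ _ _ (Functor act_id act_comp act_lin) (Ft t) _ (prj_nat t)).
- by move=> t A; apply: dinjK.
- by move=> s t A; apply: dorth.
- by move=> A; exists (dsupp (d A)); split;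
    [exact: dsupp_uniq | exact: dsupp_zero | exact: dsum_id].
Qed.
End DirectSums.

(** * Adjunctions: exactness, composition, sums and summands *)

Section Adjunctions.
Variable k : fieldType.

(** As a right adjoint [L] preserves kernels, and as a left adjoint it preserves cokernels. The
    factorization is obtained by transposing, factoring on the other side, and transposing back. *)
Lemma biadjoint_exact (C D : lcat k) (L : functor C D) (R : functor D C) :
  biadjoint L R -> exact_functor L.
Proof.
case=> -[eta [eps [tL tR]]] [eta' [eps' [tR' tL']]] X Y Z f g [gf kf] [_ cg].
have LgLf : fmap L g \oc fmap L f = 0 by rewrite -fmap_comp gf fmap0.
split; split=> // W.
- move=> h gh; have zero : g \oc (eps' Y \oc fmap R h) = 0.
    by rewrite ccompA -[g \oc _](nt_nat eps') -ccompA -fmap_comp gh fmap0 ccompx0.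
  have [u [fu uu]] := kf _ _ zero.
  exists (fmap L u \oc eta' W); split.
    rewrite ccompA -fmap_comp fu fmap_comp -ccompA.
    have := nt_nat eta' h; rewrite /= => <-.
    by rewrite ccompA tL' ccomp1m.
  move=> v fv; rewrite (uu (eps' X \oc fmap R v)).
    rewrite fmap_comp -ccompA; have := nt_nat eta' v; rewrite /= => <-.
    by rewrite ccompA tL' ccomp1m.
  by rewrite ccompA -[f \oc _](nt_nat eps') /= -ccompA -fmap_comp fv.
- move=> h hf; have zero : (fmap R h \oc eta Y) \oc f = 0.
    have := nt_nat eta f; rewrite /= -ccompA => ->.
    by rewrite ccompA -fmap_comp hf fmap0 ccomp0x.
  have [u [ug uu]] := cg _ _ zero.
  exists (eps W \oc fmap L u); split.
    rewrite -ccompA -fmap_comp ug fmap_comp ccompA; have := nt_nat eps h; rewrite /= => ->.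
    by rewrite -ccompA tL ccompm1.
  move=> v vg; rewrite (uu (fmap R v \oc eta Z)).
    rewrite fmap_comp ccompA; have := nt_nat eps v; rewrite /= => ->.
    by rewrite -ccompA tL ccompm1.
  by rewrite -ccompA; have := nt_nat eta g; rewrite /= => ->; rewrite ccompA -fmap_comp vg.
Qed.
End Adjunctions.

Section SumsOfAdjunctions.
Variable k : fieldType.

Lemma left_adjoint_comp (C D E : lcat k) (L : functor C D) (R : functor D C)
    (L' : functor D E) (R' : functor E D) :
  left_adjoint L R -> left_adjoint L' R' ->
  left_adjoint (fcomp L' L) (fcomp R R').
Proof.
move=> [eta [eps [tL tR]]] [eta' [eps' [tL' tR']]].
have Neta A B (f : hom A B) : eta B \oc f = fmap R (fmap L f) \oc eta A.
  exact: (nt_nat eta f).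
have Neta' A B (f : hom A B) : eta' B \oc f = fmap R' (fmap L' f) \oc eta' A.
  exact: (nt_nat eta' f).
have Neps A B (f : hom A B) : eps B \oc fmap L (fmap R f) = f \oc eps A.
  exact: (nt_nat eps f).
have Neps' A B (f : hom A B) : eps' B \oc fmap L' (fmap R' f) = f \oc eps' A.
  exact: (nt_nat eps' f).
unshelve eexists.
  exists (fun A => fmap R (eta' (L A)) \oc eta A) => A B f /=.
  by rewrite -ccompA Neta !ccompA -!fmap_comp Neta'.
unshelve eexists.
  exists (fun A => eps' A \oc fmap L' (eps (R' A))) => A B f /=.
  by rewrite -ccompA -fmap_comp Neps fmap_comp !ccompA Neps'.
split=> A /=.
- rewrite -ccompA -(fmap_comp L') (fmap_comp L) (ccompA (eps _)) Neps -ccompA tL ccompm1.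
  exact: tL'.
- rewrite ccompA -(fmap_comp R) (fmap_comp R') -ccompA -Neta' ccompA tR' ccomp1m.
  exact: tR.
Qed.

(** The unit places [eta t] on the summand R_t L_t of R L and has no mixed component; dually for the
    counit. All identities are tested on components, which also covers infinitely many [t]. *)
Lemma left_adjoint_sum (C D : lcat k) (T : eqType) (Lt : T -> functor C D)
    (Rt : T -> functor D C) (L : functor C D) (R : functor D C)
    (SL : functor_sum Lt L) (SR : functor_sum Rt R) :
  (forall t, left_adjoint (Lt t) (Rt t)) -> left_adjoint L R.
Proof.
move=> adj.
pose eta t := sval (cid (adj t)).
pose eps t := sval (cid (svalP (cid (adj t)))).
have tri t := svalP (cid (svalP (cid (adj t)))).
have tL t A : eps t (Lt t A) \oc fmap (Lt t) (eta t A) = idm (Lt t A) by exact: (tri t).1.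
have tR t B : fmap (Rt t) (eps t B) \oc eta t (Rt t B) = idm (Rt t B) by exact: (tri t).2.
have Neta t A B (f : hom A B) : eta t B \oc f = fmap (Rt t) (fmap (Lt t) f) \oc eta t A.
  exact: (nt_nat (eta t) f).
have Neps t A B (f : hom A B) : eps t B \oc fmap (Lt t) (fmap (Rt t) f) = f \oc eps t A.
  exact: (nt_nat (eps t) f).
have NiL t A B (f : hom A B) := nt_nat (fs_inj SL t) f.
have NpL t A B (f : hom A B) := nt_nat (fs_prj SL t) f.
have NiR t A B (f : hom A B) := nt_nat (fs_inj SR t) f.
have NpR t A B (f : hom A B) := nt_nat (fs_prj SR t) f.
pose dL A := fs_dsum SL A; pose dR A := fs_dsum SR A.
pose h A := dpair (dR (L A)) (fun t => fmap (Rt t) (fs_inj SL t A) \oc eta t A).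
pose e A := dcopair (dL (R A)) (fun t => eps t A \oc fmap (Lt t) (fs_prj SR t A)).
have hE t A : fs_prj SR t (L A) \oc h A = fmap (Rt t) (fs_inj SL t A) \oc eta t A.
  exact: (dprj_pair (dR (L A))).
have eE t A : e A \oc fs_inj SL t (R A) = eps t A \oc fmap (Lt t) (fs_prj SR t A).
  exact: (dcopair_inj (dL (R A))).
have monoR A Z (f g : hom Z (R A)) :
    (forall t, fs_prj SR t A \oc f = fs_prj SR t A \oc g) -> f = g.
  exact: (dsum_monoP (d := dR A)).
have epiL A Z (f g : hom (L A) Z) :
    (forall t, f \oc fs_inj SL t A = g \oc fs_inj SL t A) -> f = g.
  exact: (dsum_epiP (d := dL A)).
unshelve eexists.
  exists h => A B f; apply: monoR => t /=.
  rewrite ccompA hE ccompA NpR -!ccompA hE !ccompA -!fmap_comp.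
  by rewrite -NiL fmap_comp -!ccompA Neta.
unshelve eexists.
  exists e => A B f; apply: epiL => t /=.
  rewrite -ccompA -NiL ccompA eE -!ccompA eE -fmap_comp NpR fmap_comp !ccompA.
  by rewrite Neps.
split=> A /=.
- apply: epiL => t; rewrite -ccompA -NiL ccompA eE -ccompA -fmap_comp hE fmap_comp.
  by rewrite ccompA Neps -ccompA tL ccompm1 ccomp1m.
- apply: monoR => t; rewrite ccompA NpR -ccompA hE ccompA -fmap_comp eE fmap_comp.
  by rewrite -ccompA -Neta ccompA tR ccomp1m ccompm1.
Qed.

(** The diagonal components of the unit and counit are the new unit and counit. In each triangle
    identity an intermediate object splits over all indices; the vanishing of the mixed counits
    leaves only the index [t], by [dsum_single]. *)
Lemma left_adjoint_summand (C D : lcat k) (T : eqType) (Lt : T -> functor C D)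
    (Rt : T -> functor D C) (L : functor C D) (R : functor D C)
    (SL : functor_sum Lt L) (SR : functor_sum Rt R) :
  left_adjoint L R ->
  (forall s t, s <> t -> forall (d : nt (fcomp (Lt s) (Rt t)) (fid D)) X, d X = 0) ->
  forall t, left_adjoint (Lt t) (Rt t).
Proof.
move=> [eta [eps [tL tR]]] off t.
have Neta A B (f : hom A B) : eta B \oc f = fmap R (fmap L f) \oc eta A.
  exact: (nt_nat eta f).
have Neps A B (f : hom A B) : eps B \oc fmap L (fmap R f) = f \oc eps A.
  exact: (nt_nat eps f).
have NiL s A B (f : hom A B) := nt_nat (fs_inj SL s) f.
have NpL s A B (f : hom A B) := nt_nat (fs_prj SL s) f.
have NiR s A B (f : hom A B) := nt_nat (fs_inj SR s) f.
have NpR s A B (f : hom A B) := nt_nat (fs_prj SR s) f.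
have cross s u X : s <> u ->
    eps X \oc fs_inj SL s (R X) \oc fmap (Lt s) (fs_inj SR u X) = 0.
  move=> su; unshelve epose (d := @NT _ _ _ (fcomp (Lt s) (Rt u)) (fid D)
    (fun X => eps X \oc fs_inj SL s (R X) \oc fmap (Lt s) (fs_inj SR u X)) _).
    move=> A B f /=; rewrite -!ccompA -fmap_comp NiR fmap_comp.
    by rewrite (ccompA (fs_inj SL s (R B))) NiL !ccompA Neps.
  exact: (off s u su d X).
unshelve eexists.
  exists (fun A => fs_prj SR t (Lt t A) \oc fmap R (fs_prj SL t A) \oc eta A).
  move=> A B f /=.
  rewrite -ccompA Neta !ccompA -(ccompA _ (fmap R _) (fmap R _)) -fmap_comp NpL fmap_comp.
  by rewrite ccompA NpR.
unshelve eexists.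
  exists (fun A => eps A \oc fs_inj SL t (R A) \oc fmap (Lt t) (fs_inj SR t A)).
  move=> A B f /=; rewrite -!ccompA -fmap_comp NiR fmap_comp.
  by rewrite (ccompA (fs_inj SL t (R B))) NiL !ccompA Neps.
split=> A /=.
- have cr := dsum_single (d := dsum_fmap (Lt t) (fs_dsum SR (Lt t A))) (t := t)
    (f := eps (Lt t A) \oc fs_inj SL t (R (Lt t A))).
  rewrite -ccompA -(fmap_comp (Lt t)) !ccompA (fmap_comp (Lt t)) ccompA.
  rewrite (fmap_comp (Lt t)) (fmap_comp (Lt t)) !ccompA /= in cr *.
  rewrite cr => [|u ut]; last by apply: cross => tu; apply: ut.
  rewrite -(ccompA (eps _)) NiL !ccompA Neps -!ccompA NiL (ccompA (eps _)) tL ccomp1m.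
  exact: fs_injK.
- have := dsum_single (d := fs_dsum SL (Rt t A)) (t := t)
    (f := eps A \oc fmap L (fs_inj SR t A)).
  move=> /= cr; rewrite !ccompA -NpR -!ccompA (ccompA (fmap R _) (fmap R _)) -fmap_comp.
  rewrite -(ccompA (eps A)) NiL (ccompA (eps A)) (ccompA (eps A)) cr; last first.
    move=> u ut; rewrite -ccompA -NiL ccompA; apply: cross => // ->.
  rewrite fmap_comp -ccompA -Neta (ccompA (fmap R (eps A))) tR ccomp1m.
  exact: fs_injK.
Qed.
End SumsOfAdjunctions.

(** * The filtration of the KLR algebra by the number of crossings *)

(** Innermost tests are split first: the arguments of an outer test may themselves be
    conditionals. *)
Ltac case_ifs := repeat match goal with |- context [if ?a == ?b then _ else _] =>
  lazymatch constr:((a, b)) with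
  | context [if _ then _ else _] => fail
  | _ => case: (@eqP nat a b) => ?
  end end.

Section Words.
Variable I : choiceType.
Implicit Types (i j : I) (u v w : seq I).

Lemma wt_nil : wt [::] = 0 :> root_lattice I.
Proof. by rewrite /wt big_nil. Qed.

Lemma wt_cons i w : wt (i :: w) = sroot i + wt w.
Proof. by rewrite /wt big_cons. Qed.

Lemma wt_cat u v : wt (u ++ v) = wt u + wt v.
Proof. by rewrite /wt big_cat. Qed.

Lemma deg_wt w : deg (wt w) = (size w)%:Z.
Proof.
elim: w => [|i w IH]; first by rewrite wt_nil raddf0.
by rewrite wt_cons raddfD /= IH /sroot degU -PoszD.
Qed.

Lemma height_wt w : height (wt w) = size w.
Proof. by rewrite /height deg_wt absz_nat. Qed.

Lemma rpos_wt w : rpos (wt w).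
Proof. by apply/fgposP => i; rewrite coeff_wt. Qed.

(* Positions count from 0; nothing is exchanged when r + 1 is out of range. *)
Fixpoint swp (T : Type) (r : nat) (w : seq T) : seq T :=
  match r, w with
  | 0, i :: j :: w' => j :: i :: w'
  | r'.+1, i :: w' => i :: swp r' w'
  | _, _ => w
  end.

Lemma size_swp r w : size (swp r w) = size w.
Proof. by elim: r w => [|r IH] [|i [|j w]] //=; rewrite IH. Qed.

Lemma wt_swp r w : wt (swp r w) = wt w.
Proof.
elim: r w => [|r IH] [|i [|j w]] //=; last by rewrite !wt_cons IH wt_cons.
  by rewrite !wt_cons addrCA.
by rewrite wt_cons IH wt_cons.
Qed.

Lemma swp_cat u v : swp (size u) (u ++ v) = u ++ swp 0 v.
Proof. by elim: u => //= i u ->. Qed.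

Lemma cut2 r w : (r.+1 < size w)%N ->
  exists u i j v, w = u ++ [:: i, j & v] /\ size u = r.
Proof.
elim: r w => [|r IH] [|i [|j w]] //= rw; first by exists [::], i, j, w.
have [u [i' [j' [v [-> <-]]]]] := IH (j :: w) rw.
by exists (i :: u), i', j', v.
Qed.

Definition sw (r q : nat) : nat := if q == r then r.+1 else if q == r.+1 then r else q.

Lemma sw_out r q : q <> r -> q <> r.+1 -> sw r q = q.
Proof. by rewrite /sw => /eqP/negbTE-> /eqP/negbTE->. Qed.

Lemma swK r : involutive (sw r).
Proof. by move=> q; rewrite /sw; case_ifs; lia. Qed.

Lemma sw_far r s q : (r.+1 < s)%N || (s.+1 < r)%N -> sw r (sw s q) = sw s (sw r q).
Proof. by rewrite /sw => rs; case_ifs; lia. Qed.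

Lemma sw_braid r q : sw r (sw r.+1 (sw r q)) = sw r.+1 (sw r (sw r.+1 q)).
Proof. by rewrite /sw; case_ifs; lia. Qed.
End Words.

Section Filtration.
Variables (k : fieldType) (I : choiceType) (h : quiver I) (al : root_lattice I).
Local Notation R := (klr k h al).
Local Notation E w := (kcl h (fe w) : R).
Local Notation X r := (kcl h (fx r) : R).
Local Notation T r := (kcl h (ft r) : R).
Local Notation free := (free_alg k (klr_gen al)).
Implicit Types (w v : seq I) (a b : R).

Lemma kclM (a b : free) : kcl h (a * b) = kcl h a *k kcl h b.
Proof. by have [_ _ m] := @kcl_morphism k I h al; exact: m. Qed.

Lemma kclD (a b : free) : kcl h (a + b) = kcl h a + kcl h b.
Proof. by have [m _ _] := @kcl_morphism k I h al; have := m 1 a b; rewrite !scale1r. Qed.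

Lemma kclZ c (a : free) : kcl h (c *: a) = c *: kcl h a.
Proof.
have [m _ _] := @kcl_morphism k I h al.
have := m c a 0; rewrite addr0 => ->; rewrite -[RHS]addr0; congr (_ + _); exact: kcl0.
Qed.

Lemma kclN (a : free) : kcl h (- a) = - kcl h a.
Proof. by rewrite -scaleN1r kclZ scaleN1r. Qed.

Lemma kcl1 : kcl h (1 : free) = kone.
Proof. by have [_ m _] := @kcl_morphism k I h al. Qed.

Lemma kcl_nat (b : bool) : kcl h (b%:R : free) = b%:R *: kone.
Proof. by case: b; rewrite ?scale1r ?scale0r /= ?kcl1 ?kcl0. Qed.

Lemma kclM3 (a b c : free) : kcl h (a * b * c) = kcl h a *k kcl h b *k kcl h c.
Proof. by rewrite kclM; congr (_ *k _); apply: kclM. Qed.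

Lemma kclMDM (a b c : free) (d : bool) :
  kcl h ((a * b + d%:R) * c) = kcl h a *k kcl h b *k kcl h c + d%:R *: kcl h c.
Proof. by rewrite kclM kclD kcl_nat kmulDl kmulZl kmul1x; congr (_ *k _ + _); apply: kclM. Qed.

Lemma fe_out w : wt w <> al -> fe w = 0 :> free.
Proof. by move=> /eqP wal; rewrite /fe insubN. Qed.

Lemma fx_out r : (height al <= r)%N -> fx r = 0 :> free.
Proof. by move=> rd; rewrite /fx insubN // -leqNgt. Qed.

Lemma ft_out r : (height al <= r.+1)%N -> ft r = 0 :> free.
Proof. by move=> rd; rewrite /ft insubN // -leqNgt; lia. Qed.

Lemma free_gen_cases (g : klr_gen al) :
  [\/ exists w, free_gen k g = fe w, exists r, free_gen k g = fx r
    | exists r, free_gen k g = ft r].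
Proof.
case: g => [[s|s]|s].
- by constructor 1; exists (val s); rewrite /fe valK.
- by constructor 2; exists (val s); rewrite /fx valK.
- by constructor 3; exists (val s); rewrite /ft valK.
Qed.

Lemma free_alg_ind (N : free -> Prop) :
  N 0 -> N 1 -> (forall a b : free, N a -> N b -> N (a + b)) ->
  (forall a b : free, N a -> N b -> N (a * b)) ->
  (forall c (a : free), N a -> N (c *: a)) ->
  (forall g, N (free_gen k g)) -> forall a : free, N a.
Proof.
move=> N0 N1 ND NM NZ Ng a; rewrite (monalgE a); apply: (big_ind N) => // m _.
have -> : << a@_m *g m >> = a@_m *: mkmalgU m 1 :> free.
  by apply/malgP => n; rewrite mcoeffZ !mcoeffU mulr_natr.
apply: NZ; case: m => s; elim: s => [|g s IH].
  have -> // : mkmalgU (FMonom [::] : {fmonom klr_gen al}) 1 = 1 :> free.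
  by congr mkmalgU; apply: val_inj; rewrite /= fm1.
have -> : mkmalgU (FMonom (g :: s)) 1 = free_gen k g * mkmalgU (FMonom s) 1 :> free.
  rewrite /free_gen [RHS]fgmulUU mulr1; congr mkmalgU.
  by apply: val_inj; rewrite /= fmM fmU.
exact: NM.
Qed.

Local Opaque fe fx ft.

Lemma size_wt w : wt w = al -> size w = height al.
Proof. by move=> <-; rewrite height_wt. Qed.

Lemma EE w v : wt w = al -> wt v = al -> E w *k E v = if w == v then E w else 0.
Proof. exact: klr_eM. Qed.

Lemma EEid w : wt w = al -> E w *k E w = E w.
Proof. by move=> hw; rewrite EE // eqxx. Qed.

Lemma XE r w : wt w = al -> X r *k E w = E w *k X r.
Proof.
move=> hw; have [rd|rd] := ltnP r (height al).
  by rewrite -!kclM; apply: kcl_rel; apply: klr_xe.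
by rewrite fx_out // kcl0 kmul0x kmulx0.
Qed.

Lemma TE r w : wt w = al -> T r *k E w = E (swp r w) *k T r.
Proof.
move=> hw; have [rd|rd] := ltnP r.+1 (height al); last first.
  by rewrite ft_out // kcl0 kmul0x kmulx0.
rewrite -(size_wt hw) in rd; have [u [i [j [v [Ew <-]]]]] := cut2 rd.
rewrite -!kclM; apply: kcl_rel; rewrite Ew swp_cat /=.
by apply: klr_te; rewrite -Ew.
Qed.

Lemma TX1 u i j v (w := u ++ [:: i, j & v]) : wt w = al ->
  T (size u) *k X (size u).+1 *k E w
  = X (size u) *k T (size u) *k E w + (i == j)%:R *: E w.
Proof.
move=> hw; apply: etrans (esym (kclM3 _ _ _)) _.
exact: etrans (kcl_rel (@klr_tx k I h al u i j v hw)) (kclMDM _ _ _ _).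
Qed.

Lemma XT1 u i j v (w := u ++ [:: i, j & v]) : wt w = al ->
  X (size u).+1 *k T (size u) *k E w
  = T (size u) *k X (size u) *k E w + (i == j)%:R *: E w.
Proof.
move=> hw; apply: etrans (esym (kclM3 _ _ _)) _.
exact: etrans (kcl_rel (@klr_xt k I h al u i j v hw)) (kclMDM _ _ _ _).
Qed.

(** Moving an x past a tau costs only a scalar term without that tau. This is what makes the number
    of factors tau a filtration. *)
Lemma XT r s w : wt w = al ->
  exists s' (c : k), X s *k T r *k E w = T r *k X s' *k E w + c *: E w.
Proof.
move=> hw.
have [rd|rd] := ltnP r.+1 (height al); last first.
  by exists s, 0; rewrite ft_out // kcl0 kmulx0 !kmul0x scale0r addr0.
have [sd|sd] := ltnP s (height al); last first.
  by exists s, 0; rewrite fx_out // kcl0 kmulx0 !kmul0x scale0r addr0.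
have rd' := rd; rewrite -(size_wt hw) in rd'.
have [u [i [j [v [Ew ru]]]]] := cut2 rd'; rewrite {}Ew in hw *.
have [sr|sr] := eqVneq s r.
  exists r.+1, (- (i == j)%:R); rewrite sr -ru TX1 //.
  by rewrite scaleNr addrK.
have [sr1|sr1] := eqVneq s r.+1.
  by exists r, ((i == j)%:R); rewrite sr1 -ru XT1.
exists s, 0; rewrite scale0r addr0; congr (_ *k _).
apply: etrans (esym (kclM _ _)) (etrans (esym _) (kclM _ _)).
exact: (kcl_rel (@klr_tx_far k I h al r s rd sd sr sr1)).
Qed.

Lemma TTfar r s : (r.+1 < s)%N || (s.+1 < r)%N -> T r *k T s = T s *k T r.
Proof.
move=> rs; have [rd|rd] := ltnP r.+1 (height al); last first.
  by rewrite ft_out // kcl0 kmulx0 kmul0x.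
have [sd|sd] := ltnP s.+1 (height al); last first.
  by rewrite (ft_out sd) // kcl0 kmulx0 kmul0x.
apply: etrans (esym (kclM _ _)) (etrans _ (kclM _ _)).
exact: (kcl_rel (@klr_tt_far k I h al r s rd sd rs)).
Qed.

Definition tact (ts : seq nat) (a : R) : R := foldr (fun r b => T r *k b) a ts.
Definition xact (xs : seq nat) (a : R) : R := foldr (fun r b => X r *k b) a xs.
Definition term ts xs v : R := tact ts (xact xs (E v)).

Lemma tactM ts a b : tact ts (a *k b) = tact ts a *k b.
Proof. by elim: ts => //= r ts ->; rewrite kmulA. Qed.

Lemma tactD ts a b : tact ts (a + b) = tact ts a + tact ts b.
Proof. by elim: ts => //= r ts ->; rewrite kmulDr. Qed.

Lemma tact_rcons ts s a : tact (rcons ts s) a = tact ts (T s *k a).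
Proof. by rewrite /tact foldr_rcons. Qed.

Lemma xactM xs a b : xact xs (a *k b) = xact xs a *k b.
Proof. by elim: xs => //= r xs ->; rewrite kmulA. Qed.

(* The span of the x- and tau-monomials times e(v) with fewer than n factors
   tau. *)
Inductive low (v : seq I) (n : nat) : R -> Prop :=
| low_zero : low v n 0
| low_step c ts xs a : (size ts < n)%N -> low v n a -> low v n (c *: term ts xs v + a).

Lemma low_term v n ts xs : (size ts < n)%N -> low v n (term ts xs v).
Proof.
by move=> hn; rewrite -[term _ _ _]addr0 -[term _ _ _]scale1r; constructor => //; constructor.
Qed.

Lemma lowD v n a b : low v n a -> low v n b -> low v n (a + b).
Proof. by elim=> [|c ts xs a' hn _ IH] hb; rewrite ?add0r // -addrA; constructor; auto. Qed.

Lemma lowZ v n c a : low v n a -> low v n (c *: a).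
Proof.
elim=> [|c' ts xs a' hn _ IH]; first by rewrite scaler0; constructor.
by rewrite scalerDr scalerA; constructor.
Qed.

Lemma lowW v m n a : (m <= n)%N -> low v m a -> low v n a.
Proof.
move=> mn; elim=> [|c ts xs a' hm _ IH]; first by constructor.
by constructor=> //; apply: leq_trans mn.
Qed.

Lemma low_linear v n (f : R -> R) (N : R -> Prop) a :
  linear f -> N 0 -> (forall a b, N a -> N b -> N (a + b)) ->
  (forall c a, N a -> N (c *: a)) ->
  (forall ts xs, (size ts < n)%N -> N (f (term ts xs v))) ->
  low v n a -> N (f a).
Proof.
move=> flin N0 ND NZ Nt; elim=> [|c ts xs a' hn _ IH].
  have -> // : f 0 = 0.
  by have := flin (-1) 0 0; rewrite scaler0 addr0 scaleN1r addNr.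
by rewrite flin; apply: ND => //; apply: NZ; apply: Nt.
Qed.

Lemma low_map v n v' n' (f : R -> R) a : linear f ->
  (forall ts xs, (size ts < n)%N -> low v' n' (f (term ts xs v))) ->
  low v n a -> low v' n' (f a).
Proof.
move=> flin ft; apply: (@low_linear v n f (low v' n')) => //;
  [by constructor|exact: lowD|exact: lowZ].
Qed.

Lemma kmul_linr a : linear (kmul a).
Proof. by move=> c x y; rewrite kmulDr kmulZr. Qed.

Lemma kmul_linl b : linear (fun a : R => a *k b).
Proof. by move=> c x y; rewrite kmulDl kmulZl. Qed.

Lemma lowT v n r a : low v n a -> low v n.+1 (T r *k a).
Proof.
apply: (low_map (kmul_linr _)) => ts xs hn.
exact: (@low_term v n.+1 (r :: ts)).
Qed.

Lemma low_tact v n ts a : low v n a -> low v (size ts + n) (tact ts a).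
Proof. by move=> la; elim: ts => //= r ts; apply: lowT. Qed.

Definition acts (ts : seq nat) (v : seq I) : seq I := foldr (@swp I) v ts.

Lemma wt_acts ts v : wt (acts ts v) = wt v.
Proof. by elim: ts => //= r ts IH; rewrite wt_swp. Qed.

Section FixedWord.
Variables (v : seq I) (hv : wt v = al).

Lemma Exact xs : E v *k xact xs (E v) = xact xs (E v).
Proof.
elim: xs => [|r xs IH] /=; first exact: EEid.
by rewrite kmulA -XE // -kmulA IH.
Qed.

(** Each tau exchanges two letters of the idempotent, so a monomial ends at the single word
    [acts ts v]. A left factor e(w) therefore keeps a monomial or kills it. *)
Lemma Eterm ts xs : E (acts ts v) *k term ts xs v = term ts xs v.
Proof.
rewrite /term; elim: ts => [|r ts IH] /=; first exact: Exact.
by rewrite kmulA -TE ?wt_acts // -kmulA IH.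
Qed.

(** The x travels rightwards through the tau by [XT]; each correction term has lost one tau, so the
    bound [n] is unchanged. *)
Lemma lowX n r a : low v n a -> low v n (X r *k a).
Proof.
apply: (low_map (kmul_linr _)) => ts xs.
elim: ts n r => [|s ts IH] n r hn; first exact: (@low_term v n [::] (r :: xs)).
rewrite /term /= -/(term ts xs v) -[term ts xs v]Eterm !kmulA.
have [r' [c ->]] := XT s r (etrans (wt_acts ts v) hv).
rewrite kmulDl kmulZl -!kmulA Eterm; case: n hn => // n hn.
apply: lowD; first by apply: lowT; apply: IH.
by apply: lowZ; apply: low_term; apply: ltnW.
Qed.

Lemma low_xact n xs a : low v n a -> low v n (xact xs a).
Proof. by move=> la; elim: xs => //= r xs; apply: lowX. Qed.

Lemma lowE n w a : low v n a -> low v n (E w *k a).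
Proof.
apply: (low_map (kmul_linr _)) => ts xs hn.
have [hw|/eqP hw] := eqVneq (wt w) al; last first.
  by rewrite fe_out // kcl0 kmul0x; constructor.
rewrite -Eterm kmulA EE ?wt_acts //; case: eqP => [->|_]; last first.
  by rewrite kmul0x; constructor.
by rewrite Eterm; apply: low_term.
Qed.

Lemma low_mulX n r a : low v n a -> low v n (a *k X r).
Proof.
apply: (low_map (kmul_linl _)) => ts xs hn.
rewrite /term -tactM -xactM -XE //.
have -> : xact xs (X r *k E v) = xact (rcons xs r) (E v) by rewrite /xact foldr_rcons.
exact: low_term.
Qed.

(** The idempotent passes tau_p and becomes e(v); the x to the left of tau_p are then absorbed by
    [lowX]. As the bound in [low] is strict, tau_p e(v) lies in [low v 2], and
    [size ts + 2 <= n + 1]. *)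
Lemma low_mulT n p a : low (swp p v) n a -> low v n.+1 (a *k T p).
Proof.
apply: (low_map (kmul_linl _)) => ts xs hn.
rewrite /term -tactM -xactM -TE //.
apply: lowW (low_tact _ (low_xact _ (@low_term v 2 [:: p] [::] _))) => //; lia.
Qed.

(** The span of all monomials is stable under left multiplication by the generators and contains
    e(v). The number of tau may grow with [a], hence the existential bound. *)
Lemma low_span (a : free) : exists n, low v n (kcl h a *k E v).
Proof.
pose stable (b : free) := forall n c, low v n c -> exists m, low v m (kcl h b *k c).
suff st : stable a by apply: (st 1%N); exact: (@low_term v 1 [::] [::]).
have st0 : stable 0 by move=> n c _; exists 0%N; rewrite kcl0 kmul0x; constructor.
have stD (b c : free) : stable b -> stable c -> stable (b + c).
  move=> hb hc n x lx; have [m1 l1] := hb n x lx; have [m2 l2] := hc n x lx.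
  exists (m1 + m2)%N; rewrite kclD kmulDl.
  by apply: lowD; [apply: lowW l1 | apply: lowW l2]; lia.
have stM (b c : free) : stable b -> stable c -> stable (b * c).
  move=> hb hc n x lx; have [m1 l1] := hc n x lx; have [m2 l2] := hb _ _ l1.
  by exists m2; rewrite kclM -kmulA.
have stZ z (b : free) : stable b -> stable (z *: b).
  by move=> hb n x lx; have [m l] := hb n x lx; exists m; rewrite kclZ kmulZl; apply: lowZ.
have st1 : stable 1 by move=> n x lx; exists n; rewrite kcl1 kmul1x.
apply: free_alg_ind => // g n x lx.
case: (free_gen_cases g) => -[r ->].
- by exists n; apply: lowE.
- by exists n; apply: lowX.
- by exists n.+1; apply: lowT.
Qed.
End FixedWord.
End Filtration.

(** * The exchange property modulo fewer factors tau *)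

Section Exchange.
Variables (k : fieldType) (I : choiceType) (h : quiver I) (al : root_lattice I).
Local Notation R := (klr k h al).
Local Notation E w := (kcl h (fe w) : R).
Local Notation X r := (kcl h (fx r) : R).
Local Notation T r := (kcl h (ft r) : R).
Local Notation free := (free_alg k (klr_gen al)).
Implicit Types (w v : seq I) (a b : R).
Local Opaque fe fx ft.
Local Notation low := (@low k I h al).
Local Notation tact := (@tact k I h al).
Local Notation term := (@term k I h al).

Lemma cut3 (r : nat) w : (r.+2 < size w)%N ->
  exists u i j l v, w = u ++ [:: i, j, l & v] /\ size u = r.
Proof.
elim: r w => [|r IH] [|i [|j [|l w]]] //= rw; first by exists [::], i, j, l, w.
have [u [i' [j' [l' [v [-> <-]]]]]] := IH [:: j, l & w] rw.
by exists (i :: u), i', j', l', v.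
Qed.

(** The property of polynomials in the x that the filtration uses: left multiplication does not
    raise the number of tau. It applies to the right-hand sides of the relations for tau_r^2 and for
    the braid. *)
Definition xstable (p : free) : Prop :=
  forall v n a, wt v = al -> low v n a -> low v n (kcl h p *k a).

Lemma xstable0 : xstable 0.
Proof. by move=> v n a _ _; rewrite kcl0 kmul0x; constructor. Qed.

Lemma xstable1 : xstable 1.
Proof. by move=> v n a _; rewrite kcl1 kmul1x. Qed.

Lemma xstableD p q : xstable p -> xstable q -> xstable (p + q).
Proof. by move=> hp hq v n a hv la; rewrite kclD kmulDl; apply: lowD; auto. Qed.

Lemma xstableM p q : xstable p -> xstable q -> xstable (p * q).
Proof. by move=> hp hq v n a hv la; rewrite kclM -kmulA; auto. Qed.

Lemma xstableZ c p : xstable p -> xstable (c *: p).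
Proof. by move=> hp v n a hv la; rewrite kclZ kmulZl; apply: lowZ; auto. Qed.

Lemma xstableB p q : xstable p -> xstable q -> xstable (p - q).
Proof. by move=> hp hq; apply: xstableD => //; rewrite -scaleN1r; apply: xstableZ. Qed.

Lemma xstable_exp n p : xstable p -> xstable (p ^+ n).
Proof.
move=> hp; elim: n => [|n IH]; first by rewrite expr0; apply: xstable1.
by rewrite exprS; apply: xstableM.
Qed.

Lemma xstable_x r : xstable (fx r).
Proof. by move=> v n a hv; apply: lowX. Qed.

Lemma kclX2M (a c : free) : kcl h (a ^+ 2 * c) = kcl h a *k kcl h a *k kcl h c.
Proof. exact: kclM3. Qed.

Lemma TT r w : wt w = al ->
  exists2 p, xstable p & T r *k T r *k E w = kcl h p *k E w.
Proof.
move=> hw; have [rd|rd] := ltnP r.+1 (height al); last first.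
  by exists 0; [exact: xstable0 | rewrite ft_out // kcl0 !kmul0x].
rewrite -(size_wt hw) in rd; have [u [i [j [v [Ew ru]]]]] := cut2 rd.
rewrite {rd}Ew in hw *; rewrite -ru.
exists (@Qij I h free i j (fx (size u)) (fx (size u).+1)).
  rewrite /Qij; case: eqP => _; first exact: xstable0.
  by apply: xstableM; apply: xstable_exp; apply: xstableB; apply: xstable_x.
apply: etrans (esym (kclX2M _ _)) _.
rewrite -kclM.
exact: (kcl_rel (@klr_t2 k I h al u i j v hw)).
Qed.

Lemma kclBM3 (a b c a' b' c' e : free) :
  kcl h ((a * b * c - a' * b' * c') * e)
  = kcl h a *k kcl h b *k kcl h c *k kcl h e - kcl h a' *k kcl h b' *k kcl h c' *k kcl h e.
Proof.
by rewrite kclM kclD kclN kmulDl kmulNx; congr (_ *k _ - _ *k _); apply: kclM3.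
Qed.

Lemma TTT r w : wt w = al -> exists2 p, xstable p &
  T r.+1 *k T r *k T r.+1 *k E w = T r *k T r.+1 *k T r *k E w + kcl h p *k E w.
Proof.
move=> hw; have [rd|rd] := ltnP r.+2 (height al); last first.
  exists 0; first exact: xstable0.
  by rewrite (ft_out k rd) kcl0 !kmulx0 !kmul0x addr0.
rewrite -(size_wt hw) in rd; have [u [i [j [l [v [Ew ru]]]]]] := cut3 rd.
rewrite {rd}Ew in hw *; rewrite -ru.
have B := kcl_rel (@klr_braid k I h al u i j l v hw).
have {}B := etrans (esym (kclBM3 _ _ _ _ _ _ _)) B.
have [p hp kp] : exists2 p, xstable p & kcl h (if i == l then
    eval_zxy (braid_poly k h i j) (fx (size u)) (fx (size u).+1) (fx (size u).+2)
      * fe (u ++ [:: i, j, l & v]) else 0)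
    = kcl h p *k kcl h (@fe k I al (u ++ [:: i, j, l & v])); last first.
  by exists p => //; rewrite -kp -B addrC subrK.
case: eqP => _; last first.
  by exists 0; [exact: xstable0 | rewrite !kcl0 kmul0x].
exists (eval_zxy (braid_poly k h i j) (fx (size u)) (fx (size u).+1) (fx (size u).+2)).
  rewrite /eval_zxy; do 3 (apply: (big_ind xstable);
    [exact: xstable0 | exact: xstableD | move=> ? _]).
  by apply: xstableZ; apply: xstableM; [apply: xstableM|]; apply: xstable_exp; apply: xstable_x.
exact: kclM.
Qed.

Lemma low_xstable p v : xstable p -> wt v = al -> low v 1 (kcl h p *k E v).
Proof. by move=> hp hv; apply: hp => //; apply: (@low_term _ _ _ _ v 1 [::] [::]). Qed.

Lemma TTT_adj p s w : (p == s.+1) || (s == p.+1) -> wt w = al -> exists2 q, xstable q &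
  T s *k T p *k T s *k E w = T p *k T s *k T p *k E w + kcl h q *k E w.
Proof.
case/orP=> /eqP -> hw.
  have [q hq eq] := TTT s hw; exists (- q); last by rewrite eq kclN kmulNx addrK.
  by rewrite -scaleN1r; apply: xstableZ.
exact: TTT.
Qed.

(* The position to which the strand starting at q is taken. *)
Definition act (ts : seq nat) (q : nat) : nat := foldr sw q ts.

Lemma act_rcons ts s q : act (rcons ts s) q = act ts (sw s q).
Proof. by rewrite /act foldr_rcons. Qed.

Lemma sw_adj p s q : (p == s.+1) || (s == p.+1) ->
  sw s (sw p (sw s q)) = sw p (sw s (sw p q)).
Proof. by case/orP=> /eqP ->; rewrite sw_braid. Qed.

(* The exchange property of the symmetric group, for the generators tau_r and
   modulo terms with fewer factors tau. *)
Lemma exchange ts v p : wt v = al -> (act ts p.+1 < act ts p)%N ->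
  low v (size ts) (tact ts (E v)) \/
  exists ts', [/\ size ts = (size ts').+1, forall q, act ts q = act ts' (sw p q)
    & low v (size ts) (tact ts (E v) - tact ts' (T p *k E v))].
Proof.
have [n] := ubnP (size ts); elim: n ts v p => // n IH ts v p.
case/lastP: ts => [|ts s] sn hv; first by rewrite /= ltnNge leqnSn.
rewrite size_rcons ltnS in sn *; rewrite !act_rcons tact_rcons => D.
have hs q : wt (swp q v) = al by rewrite wt_swp.
have stepE : tact ts (T s *k E v) = tact ts (E (swp s v)) *k T s.
  by rewrite TE // tactM.
have [sp|/eqP sp] := eqVneq s p.
  right; exists ts; split=> // [q|]; first by rewrite act_rcons sp.
  by rewrite sp subrr; constructor.
have [far|near] := boolP ((s.+1 < p)%N || (p.+1 < s)%N).
  rewrite !(sw_out (r := s)) in D; [|lia..].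
  have [lo|[ts' [st' at' lo]]] := IH ts (swp s v) p sn (hs s) D.
    by left; rewrite stepE; apply: low_mulT.
  right; exists (rcons ts' s); split=> [|q|]; first by rewrite size_rcons st'.
    by rewrite !act_rcons at' sw_far // orbC.
  have := low_mulT hv lo; rewrite kmulDl kmulNx -stepE tact_rcons -tactM.
  by rewrite -(kmulA (T p)) -(TE k h _ hv) !kmulA TTfar // orbC.
have adj : (p == s.+1) || (s == p.+1) by lia.
(* If [ts] already crosses the strands s and s+1, it ends in tau_s up to lower terms, and the
   product with the last tau_s contains tau_s^2, a polynomial in the x. The product thus loses two
   factors tau. *)
have [Ds|Ds] := ltnP (act ts s.+1) (act ts s).
  left; have [lo|[ts' [st' at' lo]]] := IH ts (swp s v) s sn (hs s) Ds.
    by rewrite stepE; apply: low_mulT.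
  have := low_mulT hv lo; rewrite kmulDl kmulNx -stepE -tactM -kmulA -(TE k h _ hv) kmulA.
  have [q hq ->] := TT s hv => l1; rewrite -[Z in low _ _ Z](subrK (tact ts' (kcl h q *k E v))).
  apply: lowD => //; apply: lowW (low_tact _ (low_xstable hq hv)); lia.
(* Otherwise the order of the three images shows that [ts] crosses p and p+1 and, once tau_p is
   split off, still crosses s and s+1. Hence the product is [ts3] followed by tau_s tau_p tau_s, and
   the braid relation makes it end in tau_p. *)
have [D1 D2] : (act ts p.+1 < act ts p /\ act ts (sw p s.+1) < act ts (sw p s))%N.
  move: D Ds; rewrite /sw; case/orP: adj => /eqP ->; case_ifs => *; split; lia.
have [lo|[ts2 [st2 at2 lo]]] := IH ts (swp s v) p sn (hs s) D1.
  by left; rewrite stepE; apply: low_mulT.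
rewrite !at2 !swK in D2.
set w := swp p (swp s v); have hw : wt w = al by rewrite !wt_swp.
have lo2 : low v (size ts).+1 (tact ts (T s *k E v) - tact ts2 (E w) *k T p *k T s).
  have := low_mulT hv lo; rewrite kmulDl kmulNx -stepE; congr (low _ _ (_ - _ *k _)).
  by rewrite TE // tactM.
have sn2 : (size ts2 < n)%N by lia.
have [l3|[ts3 [st3 at3 l3]]] := IH ts2 w s sn2 hw D2.
  left; rewrite -[Z in low _ _ Z](subrK (tact ts2 (E w) *k T p *k T s)).
  apply: lowD => //; rewrite st2.
  by apply: low_mulT => //; apply: low_mulT.
right; exists (rcons (rcons ts3 p) s); split=> [|q|].
- by rewrite !size_rcons; lia.
- by rewrite !act_rcons at2 at3 sw_adj.
rewrite !tact_rcons.
have l4 : low v (size ts).+1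
   (tact ts2 (E w) *k T p *k T s - tact ts3 (T s *k T p *k T s *k E v)).
  have := low_mulT hv (low_mulT (hs s) l3); rewrite !kmulDl !kmulNx st2.
  congr (low _ _ (_ - _)); rewrite -!tactM; congr tact.
  by rewrite -!kmulA TE // [in RHS](kmulA (T p)) TE // !kmulA.
have [q hq eq] := TTT_adj adj hv; rewrite {}eq tactD in l4.
have l5 : low v (size ts).+1 (tact ts3 (kcl h q *k E v)).
  by apply: lowW (low_tact _ (low_xstable hq hv)); lia.
have := lowD (lowD lo2 l4) l5; rewrite !kmulA; congr low.
by rewrite addrA subrK opprD addrA subrK.
Qed.
End Exchange.

(** * Unordered words *)

Section WordSums.
Variable I : choiceType.
Implicit Types (w : seq I) (g : I -> nat -> nat).

(** The summand depends on the letter and on its position, so that permuting the word amounts to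
    precomposing [g] with the permutation of positions. *)
Fixpoint wsum g w : nat :=
  if w is i :: w' then (g i 0 + wsum (fun j q => g j q.+1) w')%N else 0%N.

Lemma eq_wsum g g' w : (forall j q, g j q = g' j q) -> wsum g w = wsum g' w.
Proof. by elim: w g g' => //= i w IH g g' gg; rewrite gg; congr addn; apply: IH. Qed.

Lemma wsum_swp r g w : (r.+1 < size w)%N ->
  wsum g (swp r w) = wsum (fun j q => g j (sw r q)) w.
Proof.
elim: r g w => [|r IH] g [|i w] // rw.
  case: w rw => //= j w _.
  by rewrite addnCA; congr (_ + (_ + _))%N; apply: eq_wsum.
rewrite /= IH //; congr (_ + _)%N; apply: eq_wsum => l q.
by congr (g l _); rewrite /sw; case_ifs; lia.
Qed.

Lemma size_acts ts w : size (acts ts w) = size w.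
Proof. by elim: ts => //= r ts <-; rewrite size_swp. Qed.

Lemma wsum_acts ts g w : all (fun s => s.+1 < size w)%N ts ->
  wsum g (acts ts w) = wsum (fun j q => g j (act ts q)) w.
Proof.
elim: ts g => [|r ts IH] g //= /andP[rw /IH {}IH].
by rewrite wsum_swp ?size_acts // IH.
Qed.

Lemma count_take (a : pred I) m w :
  count a (take m w) = wsum (fun j q => a j && (q < m)%N) w.
Proof.
elim: w m => [|i w IH] [|m] //=; last first.
  by rewrite IH andbT; congr addn; apply: eq_wsum.
rewrite andbF add0n; elim: w {IH} => //= j w IH.
by rewrite andbF add0n; apply: IH.
Qed.
End WordSums.

Section Unordered.
Variables (I0 I1 : choiceType).
Implicit Types (u : seq (I0 + I1)) (w : seq (dbl I0 I1)).

(* If f keeps the order of each pair i^1, i^2 of phi(u), then at least as many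
   letters i^1 as letters i^2 are sent below m. *)
Lemma pairs_kept (f : nat -> nat) m u :
  (exists u1 i u2, u = u1 ++ inr i :: u2 /\
     (f (size (phi_word u1)).+1 < f (size (phi_word u1)))%N) \/
  (wsum (fun j q => @in_I2 I0 I1 j && (f q < m)%N) (phi_word u)
   <= wsum (fun j q => @in_I1 I0 I1 j && (f q < m)%N) (phi_word u))%N.
Proof.
elim: u f => [|[i|i] u IH] f /=; first by right.
  have [[u1 [j [u2 [-> lt]]]]|le] := IH (fun q => f q.+1); last by right.
  by left; exists (inl i :: u1), j, u2.
have [lt|ge] := ltnP (f 1%N) (f 0%N); first by left; exists [::], i, u.
have [[u1 [j [u2 [-> lt]]]]|le] := IH (fun q => f q.+2); last first.
  by right; rewrite !add0n; apply: leq_add => //; case: ltnP => //; case: ltnP => //; lia.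
by left; exists (inr i :: u1), j, u2.
Qed.

(** The prefix that makes the permuted word unordered is pulled back to phi(u) as a condition on the
    images of positions. If each adjacent pair i^1, i^2 kept its order, every i^2 sent below the cut
    would bring its own i^1 along. *)
Lemma unordered_crossing ts u :
  all (fun s => s.+1 < size (phi_word u))%N ts -> unordered (acts ts (phi_word u)) ->
  exists u1 i u2, u = u1 ++ inr i :: u2 /\
    (act ts (size (phi_word u1)).+1 < act ts (size (phi_word u1)))%N.
Proof.
move=> rng /hasP[m _]; rewrite !count_take !wsum_acts // => lt.
by case: (pairs_kept (act ts) m u) => // le; lia.
Qed.

Lemma phi_word_cat u v : phi_word (u ++ v) = phi_word u ++ phi_word v.
Proof. by elim: u => [|[i|i] u /= ->]. Qed.

Variables (k : fieldType) (h : quiver (I0 + I1)%type) (al : root_lattice (I0 + I1)%type).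
Local Notation alb := (phi_root al).
Local Notation R := (klr k (dbl_quiver h) alb).
Local Notation E w := (kcl (dbl_quiver h) (fe w) : R).
Local Notation T r := (kcl (dbl_quiver h) (ft r) : R).
Local Opaque fe fx ft.

Variable N : R -> Prop.
Hypotheses (N0 : N 0) (ND : forall a b, N a -> N b -> N (a + b)).
Hypotheses (NZ : forall c a, N a -> N (c *: a)).
Hypotheses (Nl : forall a b, N b -> N (a *k b)) (Nr : forall a b, N a -> N (a *k b)).
Hypothesis NE : forall u i v, wt (phi_word u ++ v2 i :: v) = alb ->
  N (E (phi_word u ++ v2 i :: v)).

(* Some pair i^1, i^2 of phi(u) is crossed; moved to the far right, its crossing
   produces a word phi(u1) i^2 .. *)
Lemma unordered_term u ts xs : wt (phi_word u) = alb -> unordered (acts ts (phi_word u)) ->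
  N (term k (dbl_quiver h) alb ts xs (phi_word u)).
Proof.
set v := phi_word u => hv; have [n] := ubnP (size ts); elim: n ts xs => // n IH ts xs sn un.
(* An index out of range makes the product 0. It has to be excluded separately, because there [swp]
   leaves the word alone while [sw] still moves positions. *)
have [rng|] := boolP (all (fun s => s.+1 < size v)%N ts); last first.
  move=> /allPn[s sts]; rewrite -leqNgt (size_wt hv) => ds.
  rewrite /term; set b := xact _ _; clearbody b.
  suff -> : tact ts b = 0 by [].
  elim: ts sts {sn un} => //= r ts IHt; rewrite inE => /orP[/eqP <-|/IHt ->].
    by rewrite ft_out // kcl0 kmul0x.
  by rewrite kmulx0.
have [u1 [i [u2 [Eu lt]]]] := unordered_crossing rng un.
set p := size (phi_word u1) in lt.
(* The left idempotent retains only the lower monomials that end at the same unordered word, and to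
   these the induction hypothesis applies. *)
have Nlow a : low (k := k) (h := dbl_quiver h) (al := alb) v (size ts) a ->
    N (E (acts ts v) *k a).
  apply: (low_linear (f := fun a => E (acts ts v) *k a)) => //.
    by move=> c x y; rewrite kmulDr kmulZr.
  move=> ts' xs' lt'; rewrite -(Eterm k (dbl_quiver h) hv) kmulA EE ?wt_acts //.
  case: eqP => [e|_]; last by rewrite kmul0x.
  by rewrite e Eterm //; apply: IH; rewrite -?e //; apply: leq_trans lt' _; rewrite -ltnS.
have lowx a : low (k := k) (h := dbl_quiver h) (al := alb) v (size ts) a ->
    low (k := k) (h := dbl_quiver h) (al := alb) v (size ts) (a *k xact xs kone).
  elim: xs a => [|r xs' IHx] a la; first by rewrite /= kmulx1.
  by rewrite /= kmulA; apply: IHx; apply: low_mulX.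
(* The x commute with e(v) and are moved to the far right, so that the exchange property applies to
   the factors tau alone. *)
have split_term : term k (dbl_quiver h) alb ts xs v
    = tact ts (E v) *k xact xs kone.
  rewrite -tactM; congr tact; elim: xs {lowx} => [|r xs' IHx] /=; first by rewrite kmulx1.
  by rewrite IHx !kmulA XE.
have fixl : E (acts ts v) *k tact ts (E v) = tact ts (E v).
  exact: (Eterm k (dbl_quiver h) hv ts [::]).
have [lo|[ts' [st' at' lo]]] := exchange k (dbl_quiver h) hv lt.
  by rewrite split_term -fixl -kmulA; apply: Nlow; apply: lowx.
(* Here [p] is the position of the letter i^1 of the crossed pair; exchanging it with its neighbour
   gives phi(u1) i^2 i^1 phi(u2). *)
have Np : N (E (swp p v)).
  rewrite /v Eu phi_word_cat /= swp_cat /= /p.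
  apply: (NE (u := u1) (v := v1 i :: phi_word u2)).
  by move: hv; rewrite -(wt_swp p) /v Eu phi_word_cat /= swp_cat.
have Nt : N (tact ts' (T p *k E v)).
  elim: ts' {st' at' lo} => [|r ts' IHt] /=; last exact: Nl.
  by rewrite TE //; apply: Nr.
rewrite split_term -fixl -[Z in _ *k Z *k _](subrK (tact ts' (T p *k E v))).
rewrite kmulDr kmulDl; apply: ND; first by rewrite -kmulA; apply: Nlow; apply: lowx.
by apply: Nr; apply: Nl.
Qed.

(** [N] behaves like a two-sided ideal containing the idempotents of the words phi(u) i^2 v. It will
    be the set of elements whose image vanishes on a fixed object of the subcategory. *)
Lemma unordered_factor u w a : wt (phi_word u) = alb -> wt w = alb -> unordered w ->
  N (E w *k a *k E (phi_word u)).
Proof.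
move=> hu hw un; have -> : a = kcl (dbl_quiver h) (repr a) by rewrite /kcl /qclass reprK.
rewrite -kmulA; have [n] := low_span (dbl_quiver h) hu (repr a).
apply: (low_linear (f := fun a => E w *k a)) => //.
  by move=> c x y; rewrite kmulDr kmulZr.
move=> ts xs _; rewrite -(Eterm k (dbl_quiver h) hu) kmulA EE ?wt_acts //.
case: eqP => [e|_]; last by rewrite kmul0x.
by rewrite e Eterm //; apply: unordered_term; rewrite -?e.
Qed.
End Unordered.

(** * Words of functors *)

Lemma tau_atS (k : fieldType) (C : lcat k) (F : functor C C)
    (tau : nt (fcomp F F) (fcomp F F)) d r (M : C) :
  tau_at tau d.+1 r.+1 M = tau_at tau d r (F M).
Proof. by case: d. Qed.

Section FunctorWords.
Variables (k : fieldType) (C : lcat k) (I : choiceType).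
Variables (Ft : I -> functor C C) (F : functor C C) (S : functor_sum Ft F).
Implicit Types (w : seq I) (M N : C).

Lemma word_inj_nat d w M N (f : hom M N) :
  word_inj S d w N \oc fmap (fword Ft w) f = fmap (fpow F d) f \oc word_inj S d w M.
Proof.
elim: d w M N f => [|d IH] [|i w] M N f /=; rewrite ?ccomp0x ?ccompx0 ?ccomp1m ?ccompm1 //.
by rewrite -ccompA -fmap_comp (nt_nat (fs_inj S i)) fmap_comp !ccompA IH.
Qed.

Lemma word_prj_nat d w M N (f : hom M N) :
  word_prj S d w N \oc fmap (fpow F d) f = fmap (fword Ft w) f \oc word_prj S d w M.
Proof.
elim: d w M N f => [|d IH] [|i w] M N f /=; rewrite ?ccomp0x ?ccompx0 ?ccomp1m ?ccompm1 //.
by rewrite -ccompA IH !ccompA -!fmap_comp (nt_nat (fs_prj S i)).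
Qed.

Lemma word_injK w M : word_prj S (size w) w M \oc word_inj S (size w) w M = idm (fword Ft w M).
Proof.
elim: w M => [|i w IH] M /=; first by rewrite ccomp1m.
by rewrite ccompA -(ccompA _ (word_prj _ _ _ _)) IH ccompm1 -fmap_comp fs_injK fmap_id.
Qed.

Lemma word_orth d w w' M : w <> w' -> word_prj S d w' M \oc word_inj S d w M = 0.
Proof.
elim: d w w' M => [|d IH] [|i w] [|i' w'] M ne //=; rewrite ?ccomp0x ?ccompx0 //.
rewrite ccompA -(ccompA _ (word_prj _ _ _ _)).
have [ww'|/eqP ww'] := eqVneq w w'; last by rewrite IH // ccompx0 ccomp0x.
case: w' / ww' ne => ne; have {}ne : i <> i' by move=> ii'; rewrite ii' in ne.
have [<-|/eqP sd] := eqVneq (size w) d.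
  by rewrite word_injK ccompm1 -fmap_comp fs_orth // fmap0.
(* The default value: [word_inj] is zero on words whose length is not [d]. *)
suff -> : word_inj S d w (F M) = 0 by rewrite !ccompx0 ccomp0x.
elim: d w sd M {IH} => [|d IH] [|j w] //= sd M.
by rewrite IH ?ccomp0x // => sw; apply: sd; rewrite sw.
Qed.

Section Crossings.
Variables (x : nt F F) (xi : forall i, nt (Ft i) (Ft i)).
Hypothesis x_diag : forall i M, fs_prj S i M \oc x M = xi i M \oc fs_prj S i M.

Fixpoint x_comp w (r : nat) M : hom (fword Ft w M) (fword Ft w M) :=
  match w, r with
  | [::], _ => 0
  | i :: w', 0 => fmap (fword Ft w') (xi i M)
  | i :: w', r'.+1 => x_comp w' r' (Ft i M)
  end.

Lemma x_comp_nat w r M N (f : hom M N) :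
  x_comp w r N \oc fmap (fword Ft w) f = fmap (fword Ft w) f \oc x_comp w r M.
Proof.
elim: w r M N f => [|i w IH] [|r] M N f /=; rewrite ?ccomp0x ?ccompx0 //.
by rewrite -!fmap_comp (nt_nat (xi i)).
Qed.

Lemma word_prj_x w r M : (r < size w)%N ->
  word_prj S (size w) w M \oc x_at x (size w) r M = x_comp w r M \oc word_prj S (size w) w M.
Proof.
elim: w r M => [|i w IH] [|r] M //= rw.
  by rewrite -ccompA word_prj_nat !ccompA -!fmap_comp x_diag.
by rewrite -ccompA IH // !ccompA x_comp_nat.
Qed.

Variables (tau : nt (fcomp F F) (fcomp F F)).
Variable ti : forall i j, nt (fcomp (Ft i) (Ft j)) (fcomp (Ft j) (Ft i)).

Definition pair_prj i j M : hom (F (F M)) (Ft j (Ft i M)) :=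
  fmap (Ft j) (fs_prj S i M) \oc fs_prj S j (F M).

Hypothesis tau_cross : forall i j M,
  pair_prj i j M \oc tau M = ti i j M \oc pair_prj j i M.

(** The source is the exchanged word because the algebra is opposite: tau_r e(w) = e(s_r w) tau_r
    e(w) acts from F_{s_r w} to F_w. *)
Fixpoint tau_comp w (r : nat) M {struct w} : hom (fword Ft (swp r w) M) (fword Ft w M) :=
  match r, w with
  | 0, [:: i, j & w'] => fmap (fword Ft w') (ti i j M)
  | r'.+1, i :: w' => tau_comp w' r' (Ft i M)
  | _, _ => 0
  end.

Lemma tau_comp_nat w r M N (f : hom M N) :
  tau_comp w r N \oc fmap (fword Ft (swp r w)) f = fmap (fword Ft w) f \oc tau_comp w r M.
Proof.
elim: w r M N f => [|i w IH] [|r] M N f /=; rewrite ?ccomp0x ?ccompx0 //.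
case: w {IH} => [|j w] /=; rewrite ?ccomp0x ?ccompx0 //.
by have := nt_nat (ti i j) f; rewrite -!fmap_comp /= => ->.
Qed.

Lemma word_prj_tau w r M : (r.+1 < size w)%N ->
  word_prj S (size w) w M \oc tau_at tau (size w) r M
  = tau_comp w r M \oc word_prj S (size w) (swp r w) M.
Proof.
elim: w r M => [|i w IH] [|r] M // rw; last first.
  by rewrite [size _]/= tau_atS /= -ccompA IH // !ccompA tau_comp_nat.
case: w rw {IH} => //= j w _.
rewrite !ccompA -!fmap_comp -(ccompA _ (word_prj _ _ _ _)) word_prj_nat ccompA -fmap_comp.
by have := tau_cross i j M; rewrite /pair_prj => ->; rewrite ccompA.
Qed.
End Crossings.

Lemma x_exists (xi : forall i, nt (Ft i) (Ft i)) :
  {x : nt F F | forall i M, fs_prj S i M \oc x M = xi i M \oc fs_prj S i M}.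
Proof.
pose x0 M := dpair (fs_dsum S M) (fun i => xi i M \oc fs_prj S i M).
have x0E i M : fs_prj S i M \oc x0 M = xi i M \oc fs_prj S i M.
  exact: (dprj_pair (fs_dsum S M)).
unshelve eexists; first exists x0 => // M N f; last exact: x0E.
apply: (dsum_monoP (d := fs_dsum S N)) => i /=.
rewrite ccompA x0E -!ccompA (nt_nat (fs_prj S i)) !ccompA (nt_nat (xi i)).
by rewrite (nt_nat (fs_prj S i)) -!ccompA x0E.
Qed.

(** The matrix of tau over the decomposition of F F has one entry in each row, from the word (j, i)
    to the word (i, j). In [dd] the outer functor comes first, so the word (i, j) carries the index
    [(j, i)]. *)
Lemma tau_exists (ti : forall i j, nt (fcomp (Ft i) (Ft j)) (fcomp (Ft j) (Ft i))) :
  {tau : nt (fcomp F F) (fcomp F F) | forall i j M,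
    pair_prj i j M \oc tau M = ti i j M \oc pair_prj j i M}.
Proof.
pose dd M := dsum_trans (fs_dsum S (F M)) (fun j => dsum_fmap (Ft j) (fs_dsum S M)).
have pair_nat i j M N (f : hom M N) :
    pair_prj i j N \oc fmap F (fmap F f) = fmap (Ft j) (fmap (Ft i) f) \oc pair_prj i j M.
  rewrite /pair_prj -ccompA (nt_nat (fs_prj S j)) !ccompA -!fmap_comp.
  by rewrite (nt_nat (fs_prj S i)).
pose t0 M := dpair (dd M) (fun ji => ti ji.2 ji.1 M \oc pair_prj ji.1 ji.2 M).
have t0E i j M : pair_prj i j M \oc t0 M = ti i j M \oc pair_prj j i M.
  exact: (dprj_pair (dd M) _ (j, i)).
unshelve eexists; first exists t0 => // M N f; last exact: t0E.
apply: (dsum_monoP (d := dd N)) => -[j i].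
change (pair_prj i j N \oc (t0 N \oc fmap F (fmap F f))
  = pair_prj i j N \oc (fmap F (fmap F f) \oc t0 M)).
rewrite ccompA t0E -ccompA pair_nat [RHS]ccompA pair_nat ccompA -[RHS]ccompA t0E [RHS]ccompA.
by congr (_ \oc _); apply: (nt_nat (ti i j) f).
Qed.
End FunctorWords.

(** * Matrix entries of x and tau, and their locality along a word *)

Section Strands.
Variables (k : fieldType) (C : lcat k) (F : functor C C).
Variables (x : nt F F) (tau : nt (fcomp F F) (fcomp F F)).

Lemma x_at_nat d r M N (f : hom M N) :
  x_at x d r N \oc fmap (fpow F d) f = fmap (fpow F d) f \oc x_at x d r M.
Proof.
elim: d r M N f => [|d IH] [|r] M N f /=; rewrite ?ccomp0x ?ccompx0 //.
by rewrite -!fmap_comp (nt_nat x).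
Qed.

Lemma tau_at_nat d r M N (f : hom M N) :
  tau_at tau d r N \oc fmap (fpow F d) f = fmap (fpow F d) f \oc tau_at tau d r M.
Proof.
elim: d r M N f => [|d IH] [|r] M N f; rewrite ?tau_atS /= ?ccomp0x ?ccompx0 //.
case: d {IH} => [|d] /=; rewrite ?ccomp0x ?ccompx0 //.
by rewrite -!fmap_comp; congr fmap; apply: (nt_nat tau f).
Qed.

(* The image of the product of the tau_r, r in rs; the algebra is End(F^d)^op,
   so the head of rs is applied first. *)
Fixpoint taus_at d (rs : seq nat) M : hom (fpow F d M) (fpow F d M) :=
  if rs is r :: rs' then taus_at d rs' M \oc tau_at tau d r M else idm (fpow F d M).

Lemma taus_at_nat d rs M N (f : hom M N) :
  taus_at d rs N \oc fmap (fpow F d) f = fmap (fpow F d) f \oc taus_at d rs M.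
Proof.
elim: rs => [|r rs IH] /=; first by rewrite ccomp1m ccompm1.
by rewrite -ccompA tau_at_nat !ccompA IH.
Qed.

Lemma taus_atS d rs M : taus_at d.+1 (map succn rs) M = taus_at d rs (F M).
Proof. by elim: rs => //= r rs ->; congr (_ \oc _); apply: tau_atS. Qed.

Variables (I : choiceType) (Ft : I -> functor C C) (S : functor_sum Ft F).
Implicit Types w : seq I.

Definition x_entry r w M : hom (fword Ft w M) (fword Ft w M) :=
  word_prj S (size w) w M \oc x_at x (size w) r M \oc word_inj S (size w) w M.

Lemma x_entry_nat r w M N (f : hom M N) :
  x_entry r w N \oc fmap (fword Ft w) f = fmap (fword Ft w) f \oc x_entry r w M.
Proof.
rewrite /x_entry -(ccompA _ (word_inj _ _ _ _)) word_inj_nat [LHS]ccompA.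
by rewrite -(ccompA _ (x_at x _ _ _) (fmap _ _)) x_at_nat !ccompA word_prj_nat.
Qed.

(** An entry that does not touch the innermost functor is natural in its argument, so it passes from
    F M to the summand F_c M. *)
Lemma x_entryS r c w M : x_entry r.+1 (c :: w) M = x_entry r w (Ft c M).
Proof.
transitivity (fmap (fword Ft w) (fs_prj S c M) \oc x_entry r w (F M)
    \oc fmap (fword Ft w) (fs_inj S c M)); first by rewrite /x_entry /= !ccompA.
by rewrite -ccompA x_entry_nat ccompA -fmap_comp fs_injK fmap_id ccomp1m.
Qed.

(** Locality at the other end: the outer functors only transport the map, by naturality of the
    projection to their word. *)
Lemma x_entry0 c w M : x_entry 0 (c :: w) M
  = fmap (fword Ft w) (fs_prj S c M \oc x M \oc fs_inj S c M).
Proof.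
rewrite /x_entry /= -(ccompA _ (word_prj S _ w _)) word_prj_nat !fmap_comp.
by rewrite !ccompA -(ccompA _ (word_prj _ _ _ _) (word_inj _ _ _ _)) word_injK ccompm1.
Qed.

Definition tau_entry rs d w w' M : hom (fword Ft w' M) (fword Ft w M) :=
  word_prj S d w M \oc taus_at d rs M \oc word_inj S d w' M.

Lemma tau_entry_nat rs d w w' M N (f : hom M N) :
  tau_entry rs d w w' N \oc fmap (fword Ft w') f
  = fmap (fword Ft w) f \oc tau_entry rs d w w' M.
Proof.
rewrite /tau_entry -(ccompA _ (word_inj _ _ _ _)) word_inj_nat [LHS]ccompA.
by rewrite -(ccompA _ (taus_at _ _ _) (fmap _ _)) taus_at_nat !ccompA word_prj_nat.
Qed.

Lemma tau_entryS rs d c w w' M :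
  tau_entry (map succn rs) d.+1 (c :: w) (c :: w') M = tau_entry rs d w w' (Ft c M).
Proof.
transitivity (fmap (fword Ft w) (fs_prj S c M) \oc tau_entry rs d w w' (F M)
    \oc fmap (fword Ft w') (fs_inj S c M)).
  by rewrite /tau_entry taus_atS /= !ccompA.
by rewrite -ccompA tau_entry_nat ccompA -fmap_comp fs_injK fmap_id ccomp1m.
Qed.

(* In the next three lemmas the hypothesis holds when rs only involves the first
   two, three or four strands. *)
Lemma tau_entry2 rs a b a' b' v M :
  taus_at (size v).+2 rs M = fmap (fpow F (size v)) (taus_at 2 rs M) ->
  tau_entry rs (size v).+2 [:: a, b & v] [:: a', b' & v] M
  = fmap (fword Ft v) (tau_entry rs 2 [:: a; b] [:: a'; b'] M).
Proof.
rewrite /tau_entry => -> /=; rewrite !ccomp1m !ccompm1 !fmap_comp !ccompA.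
rewrite -(ccompA _ (word_prj S _ v _) (fmap _ _)) word_prj_nat.
by rewrite !ccompA -(ccompA _ (word_prj S _ v _) (word_inj _ _ _ _)) word_injK ccompm1.
Qed.

Lemma tau_entry3 rs a b c a' b' c' v M :
  taus_at (size v).+3 rs M = fmap (fpow F (size v)) (taus_at 3 rs M) ->
  tau_entry rs (size v).+3 [:: a, b, c & v] [:: a', b', c' & v] M
  = fmap (fword Ft v) (tau_entry rs 3 [:: a; b; c] [:: a'; b'; c'] M).
Proof.
rewrite /tau_entry => -> /=; rewrite !ccomp1m !ccompm1 !fmap_comp !ccompA.
rewrite -(ccompA _ (word_prj S _ v _) (fmap _ _)) word_prj_nat.
by rewrite !ccompA -(ccompA _ (word_prj S _ v _) (word_inj _ _ _ _)) word_injK ccompm1.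
Qed.

Lemma tau_entry4 rs a b c d a' b' c' d' v M :
  taus_at (size v).+4 rs M = fmap (fpow F (size v)) (taus_at 4 rs M) ->
  tau_entry rs (size v).+4 [:: a, b, c, d & v] [:: a', b', c', d' & v] M
  = fmap (fword Ft v) (tau_entry rs 4 [:: a; b; c; d] [:: a'; b'; c'; d'] M).
Proof.
rewrite /tau_entry => -> /=; rewrite !ccomp1m !ccompm1 !fmap_comp !ccompA.
rewrite -(ccompA _ (word_prj S _ v _) (fmap _ _)) word_prj_nat.
by rewrite !ccompA -(ccompA _ (word_prj S _ v _) (word_inj _ _ _ _)) word_injK ccompm1.
Qed.
End Strands.

(** * Consequences of the axioms for the values of psi *)

Section Representation.
Variables (k : fieldType) (I : choiceType) (h : quiver I) (C : lcat k).
Variables (D : root_lattice I -> C -> Prop) (Ei Fi : I -> functor C C).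
Variable rep : quasi_categorical_rep h D Ei Fi.
Local Notation S := (qc_sumF rep).
Local Notation x := (qc_x rep).
Local Notation tau := (qc_tau rep).
Implicit Types (w v : seq I) (M : C).

Section Weight.
Variables (al : root_lattice I) (hal : rpos al).
Local Notation R := (klr k h al).
Local Notation psi a M := (qc_psi rep (height al) (a : R) M).
Local Notation E w := (kcl h (fe w) : R).
Local Notation T r := (kcl h (ft r) : R).
Local Notation X r := (kcl h (fx r) : R).

Lemma psiM a b M : psi (a *k b) M = psi b M \oc psi a M.
Proof. by have -> := qc_psiM rep hal erefl a b. Qed.

Lemma psi_lin c a b M : psi (c *: a + b) M = c *: psi a M + psi b M.
Proof. by have -> := qc_psi_linear rep hal erefl c a b. Qed.

Lemma psi0 M : psi 0 M = 0.
Proof. by have := psi_lin (-1) 0 0 M; rewrite scaler0 addr0 scaleN1r addNr. Qed.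

Lemma psiD a b M : psi (a + b) M = psi a M + psi b M.
Proof. by have := psi_lin 1 a b M; rewrite !scale1r. Qed.

Lemma psiZ c a M : psi (c *: a) M = c *: psi a M.
Proof. by have := psi_lin c a 0 M; rewrite psi0 !addr0. Qed.

Lemma psi_sum (U : Type) (s : seq U) (P : pred U) (a : U -> R) M :
  psi (\sum_(t <- s | P t) a t) M = \sum_(t <- s | P t) psi (a t) M.
Proof.
by apply: (big_morph (fun a => psi a M)) => [a1 a2|]; [exact: psiD | exact: psi0].
Qed.

Lemma psiE w M : wt w = al -> psi (E w) M = word_proj S (height al) w M.
Proof. exact: qc_psi_e. Qed.

(** The axioms prescribe psi on tau_r e(w) only. The idempotent of the word reached so far,
    [acts rs w], is therefore inserted before each further tau. *)
Lemma psi_tact rs w M : wt w = al -> all (fun r => r.+1 < height al)%N rs ->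
  psi (tact rs (E w)) M = word_proj S (height al) w M \oc taus_at tau (height al) rs M.
Proof.
move=> hw; elim: rs => [|r rs IH] /=; first by rewrite psiE // ccompm1.
move=> /andP[rd /IH {}IH].
have fix_l : E (acts rs w) *k tact rs (E w) = tact rs (E w) := Eterm k h hw rs [::].
have ha : wt (acts rs w) = al by rewrite wt_acts.
have psiT : psi (T r *k E (acts rs w)) M
    = word_proj S (height al) (acts rs w) M \oc tau_at tau (height al) r M.
  by rewrite -kclM; apply: qc_psi_tau.
rewrite -[tact rs (E w)]fix_l kmulA psiM psiT ccompA -(psiE _ ha) -psiM fix_l IH.
by rewrite -ccompA.
Qed.
End Weight.

(** In weight alpha_i the relation x e(i) = e(i) x e(i) excludes components from the other summands
    of F into F_i. *)
Lemma x_diagonal i M :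
  fs_prj S i M \oc x M = fs_prj S i M \oc x M \oc fs_inj S i M \oc fs_prj S i M.
Proof.
have hw : wt [:: i] = sroot i :> root_lattice I by rewrite wt_cons wt_nil addr0.
have h1 : height (sroot i) = 1%N by rewrite -hw height_wt.
have hp : rpos (sroot i) by rewrite -hw rpos_wt.
pose E := kcl h (fe [:: i]) : klr k h (sroot i).
pose X := kcl h (fx 0) : klr k h (sroot i).
have e : E *k (X *k E) = X *k E by rewrite XE // kmulA EEid.
have := congr1 (fun a => qc_psi rep (height (sroot i)) a M) e.
rewrite psiM // psiE // -kclM h1 (qc_psi_x rep M h1 _ hw) //.
rewrite /word_proj /= !ccomp1m !ccompm1 => /(congr1 (ccomp (fs_prj S i M))).
by rewrite !ccompA fs_injK !ccomp1m.
Qed.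
End Representation.

(** * Restriction to the subcategory *)

Section Subcategory.
Variables (k : fieldType) (I0 I1 : choiceType) (h : quiver (I0 + I1)%type) (C : lcat k).
Variables (Db : root_lattice (dbl I0 I1) -> C -> Prop) (Eb Fb : dbl I0 I1 -> functor C C).
Variable rep : quasi_categorical_rep (dbl_quiver h) Db Eb Fb.
Variable P : C -> Prop.
Hypothesis PF0 : forall i M, P M -> P (Fb (v0 i) M).
Hypothesis PF1 : forall i M, P M -> P (fcomp (Fb (v2 i)) (Fb (v1 i)) M).
Local Notation A := (fullsub P).
Local Notation inc := (inclusion P).
Local Notation Fr := (F_restr PF0 PF1).
Local Notation phi_to := (phi_to PF0 PF1).
Local Notation phi_from := (phi_from PF0 PF1).
Local Notation Sb := (qc_sumF rep).
Local Notation xb := (qc_x rep).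
Local Notation taub := (qc_tau rep).
Implicit Types (w u v : seq (I0 + I1)) (M N : A).

Lemma phi_fromK w M : phi_to w M \oc phi_from w M = idm (fword Fb (phi_word w) (sval M)).
Proof.
elim: w M => [|[i|i] w IH] M; first exact: ccomp1m.
- exact: (IH (frestrict (PF0 i) M)).
- exact: (IH (frestrict (PF1 i) M)).
Qed.

Lemma phi_toK w M : phi_from w M \oc phi_to w M = idm (sval (fword Fr w M)).
Proof.
elim: w M => [|[i|i] w IH] M; first exact: ccomp1m.
- exact: (IH (frestrict (PF0 i) M)).
- exact: (IH (frestrict (PF1 i) M)).
Qed.

Lemma phi_to_nat w M N (f : hom M N) :
  phi_to w N \oc fmap inc (fmap (fword Fr w) f)
  = fmap (fword Fb (phi_word w)) (fmap inc f) \oc phi_to w M.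
Proof.
elim: w M N f => [|[i|i] w IH] M N f; first by rewrite /= ccomp1m ccompm1.
- exact: (IH _ _ (fmap (frestrict (PF0 i)) f)).
- exact: (IH _ _ (fmap (frestrict (PF1 i)) f)).
Qed.

Lemma phi_from_nat w M N (f : hom M N) :
  phi_from w N \oc fmap (fword Fb (phi_word w)) (fmap inc f)
  = fmap inc (fmap (fword Fr w) f) \oc phi_from w M.
Proof.
elim: w M N f => [|[i|i] w IH] M N f; first by rewrite /= ccomp1m ccompm1.
- exact: (IH _ _ (fmap (frestrict (PF0 i)) f)).
- exact: (IH _ _ (fmap (frestrict (PF1 i)) f)).
Qed.

Definition transport w w'
    (g : forall M : C, hom (fword Fb (phi_word w) M) (fword Fb (phi_word w') M))
    (g_nat : forall (M N : C) (f : hom M N),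
       g N \oc fmap (fword Fb (phi_word w)) f = fmap (fword Fb (phi_word w')) f \oc g M) :
  nt (fword Fr w) (fword Fr w').
Proof.
apply: (@NT k A A (fword Fr w) (fword Fr w')
  (fun M => phi_from w' M \oc g (sval M) \oc phi_to w M)) => M N f.
change (phi_from w' N \oc g (sval N) \oc phi_to w N \oc fmap inc (fmap (fword Fr w) f)
  = fmap inc (fmap (fword Fr w') f) \oc (phi_from w' M \oc g (sval M) \oc phi_to w M)).
rewrite -(ccompA _ (phi_to w N)) phi_to_nat ccompA -(ccompA _ (g (sval N))) g_nat.
by rewrite !ccompA phi_from_nat.
Defined.

(** For a in I_1 the x sits on the strand i^1, the first letter of phi(a), as Phi prescribes. The
    rewrapping is needed because [fword Fr [:: a]] is [fid] composed with [Fr a]. *)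
Definition sub_xi (a : I0 + I1) : nt (Fr a) (Fr a) :=
  let t := transport (w := [:: a]) (w' := [:: a]) (x_entry_nat xb Sb 0 (phi_word [:: a])) in
  @NT k A A (Fr a) (Fr a) (fun M => t M) (fun M N f => nt_nat t f).

(** The prefix u is removed by passing to its image of M, which stays in the subcategory; the suffix
    v is an outer functor and is handled by naturality of the comparison maps. *)
Lemma x_entry_phi u a v M :
  x_entry xb Sb (size (phi_word u)) (phi_word (u ++ a :: v)) (sval M)
  = phi_to (u ++ a :: v) M \oc fmap inc (x_comp sub_xi (u ++ a :: v) (size u) M)
    \oc phi_from (u ++ a :: v) M.
Proof.
elim: u M => [|[i|i] u IH] M; last 2 first.
- by rewrite x_entryS; apply: (IH (frestrict (PF0 i) M)).
- by rewrite !x_entryS; apply: (IH (frestrict (PF1 i) M)).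
have nat b := phi_to_nat v (sub_xi b M); have K b := phi_fromK v (Fr b M).
case: a => i.
- transitivity (fmap (fword Fb (phi_word v)) (fmap inc (sub_xi (inl i) M)) \oc
    (phi_to v (Fr (inl i) M) \oc phi_from v (Fr (inl i) M))); last first.
    by rewrite ccompA -nat.
  by rewrite K ccompm1 x_entry0 /= x_entry0 /= ccomp1m ccompm1.
- transitivity (fmap (fword Fb (phi_word v)) (fmap inc (sub_xi (inr i) M)) \oc
    (phi_to v (Fr (inr i) M) \oc phi_from v (Fr (inr i) M))); last first.
    by rewrite ccompA -nat.
  by rewrite K ccompm1 x_entry0 /= x_entry0 /= ccomp1m ccompm1.
Qed.

(* The indices of the factors tau in the value of Phi on tau_r e(..a b..),
   relative to the position of the letters of phi(a), phi(b). *)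
Definition cross_list (a b : I0 + I1) : seq nat :=
  match a, b with
  | inl _, inl _ => [:: 0]
  | inr _, inl _ => [:: 0; 1]
  | inl _, inr _ => [:: 1; 0]
  | inr _, inr _ => [:: 1; 2; 0; 1]
  end.

Definition cross_sign (a b : I0 + I1) : k :=
  match a, b with inr i, inr j => if i == j then -1 else 1 | _, _ => 1 end.

Definition cross_entry a b (M : C) :
    hom (fword Fb (phi_word [:: b; a]) M) (fword Fb (phi_word [:: a; b]) M) :=
  cross_sign a b *: tau_entry taub Sb (cross_list a b) (size (phi_word [:: a; b]))
    (phi_word [:: a; b]) (phi_word [:: b; a]) M.

Lemma cross_entry_nat a b (M N : C) (f : hom M N) :
  cross_entry a b N \oc fmap (fword Fb (phi_word [:: b; a])) f
  = fmap (fword Fb (phi_word [:: a; b])) f \oc cross_entry a b M.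
Proof. by rewrite /cross_entry ccompZl ccompZr tau_entry_nat. Qed.

Definition sub_ti (a b : I0 + I1) : nt (fcomp (Fr a) (Fr b)) (fcomp (Fr b) (Fr a)) :=
  let t := transport (w := [:: b; a]) (w' := [:: a; b]) (cross_entry_nat a b) in
  @NT k A A (fcomp (Fr a) (Fr b)) (fcomp (Fr b) (Fr a)) (fun M => t M)
    (fun M N f => nt_nat t f).

(** As for x. Once the prefix is removed, only the strands of phi(a) and phi(b) move; the kinds of a
    and b decide whether these are two, three or four. *)
Lemma tau_entry_phi u a b v M (w := u ++ [:: a, b & v]) :
  cross_sign a b *: tau_entry taub Sb (map (addn (size (phi_word u))) (cross_list a b))
    (size (phi_word w)) (phi_word w) (phi_word (swp (size u) w)) (sval M)
  = phi_to w M \oc fmap inc (tau_comp sub_ti w (size u) M)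
    \oc phi_from (swp (size u) w) M.
Proof.
have mapS n l : map (addn n.+1) l = map succn (map (addn n) l) by rewrite -map_comp.
rewrite {}/w; elim: u M => [|[i|i] u IH] M; last 2 first.
- by rewrite [size _]/= mapS tau_entryS; apply: (IH (frestrict (PF0 i) M)).
- by rewrite [size _]/= !mapS !tau_entryS; apply: (IH (frestrict (PF1 i) M)).
have nat c d := phi_to_nat v (sub_ti c d M).
have K c d := phi_fromK v (Fr d (Fr c M)).
case: a b => [i|i] [j|j].
- transitivity (fmap (fword Fb (phi_word v)) (fmap inc (sub_ti (inl i) (inl j) M)) \oc
    (phi_to v (Fr (inl i) (Fr (inl j) M)) \oc phi_from v (Fr (inl i) (Fr (inl j) M)))).
    rewrite K ccompm1 /= tau_entry2; last by rewrite /= !fmap_comp fmap_id.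
    by rewrite -fmapZ ccomp1m ccompm1.
  by rewrite ccompA; apply: (congr1 (fun z => z \oc phi_from v _) (esym (nat (inl i) (inl j)))).
- transitivity (fmap (fword Fb (phi_word v)) (fmap inc (sub_ti (inl i) (inr j) M)) \oc
    (phi_to v (Fr (inl i) (Fr (inr j) M)) \oc phi_from v (Fr (inl i) (Fr (inr j) M)))).
    rewrite K ccompm1 /= tau_entry3; last by rewrite /= !fmap_comp fmap_id.
    by rewrite -fmapZ ccomp1m ccompm1.
  by rewrite ccompA; apply: (congr1 (fun z => z \oc phi_from v _) (esym (nat (inl i) (inr j)))).
- transitivity (fmap (fword Fb (phi_word v)) (fmap inc (sub_ti (inr i) (inl j) M)) \oc
    (phi_to v (Fr (inr i) (Fr (inl j) M)) \oc phi_from v (Fr (inr i) (Fr (inl j) M)))).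
    rewrite K ccompm1 /= tau_entry3; last by rewrite /= !fmap_comp fmap_id.
    by rewrite -fmapZ ccomp1m ccompm1.
  by rewrite ccompA; apply: (congr1 (fun z => z \oc phi_from v _) (esym (nat (inr i) (inl j)))).
- transitivity (fmap (fword Fb (phi_word v)) (fmap inc (sub_ti (inr i) (inr j) M)) \oc
    (phi_to v (Fr (inr i) (Fr (inr j) M)) \oc phi_from v (Fr (inr i) (Fr (inr j) M)))).
    rewrite K ccompm1 /= tau_entry4; last by rewrite /= !fmap_comp fmap_id.
    by rewrite -fmapZ ccomp1m ccompm1.
  by rewrite ccompA; apply: (congr1 (fun z => z \oc phi_from v _) (esym (nat (inr i) (inr j)))).
Qed.
End Subcategory.

(** * Positive weights and the combinatorics of well-ordered words *)

Section Weights.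
Variable I : choiceType.
Implicit Types (w : seq I) (al : root_lattice I).

Lemma wt_perm w w' : wt w = wt w' <-> perm_eq w w'.
Proof.
split=> [e|ww']; last by rewrite /wt (perm_big _ ww').
by apply/allP => i _ /=; have := coeff_wt i w; rewrite e coeff_wt => -[->].
Qed.

Lemma rpos_word al : rpos al -> exists w, wt w = al.
Proof.
move/fgposP => al0; exists (flatten [seq nseq (absz (coeff i al)) i | i <- dom al]).
rewrite /wt big_flatten big_map -[RHS]freeg_sumE; apply: eq_bigr => i _.
have -> (n : nat) : \sum_(j <- nseq n i) sroot j = [freeg [:: (n%:Z, i)]].
  elim: n => [|n IH]; first by rewrite big_nil freegU0.
  by rewrite /= big_cons IH /sroot freegUD.
by rewrite gez0_abs.
Qed.
Definition words_sub al : seq {w | wt w == al} :=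
  pmap insub (words_of al).

Lemma mem_words_sub al (w : {w | wt w == al}) : w \in words_sub al.
Proof. by rewrite mem_pmap_sub mem_words_of (valP w). Qed.

Lemma words_sub_uniq al : uniq (words_sub al).
Proof. by rewrite pmap_sub_uniq ?words_of_uniq. Qed.

End Weights.

Section PhiWords.
Variables (I0 I1 : choiceType).
Implicit Types (w u : seq (I0 + I1)) (v : seq (dbl I0 I1)).

Lemma phi_rootB al be : phi_root (al - be) = phi_root al - phi_root be :> root_lattice (dbl I0 I1).
Proof. exact: lift_is_additive. Qed.

Lemma phi_root0 : phi_root 0 = 0 :> root_lattice (dbl I0 I1).
Proof. by have := phi_rootB 0 0; rewrite !subrr. Qed.

Lemma phi_rootD al be : phi_root (al + be) = phi_root al + phi_root be :> root_lattice (dbl I0 I1).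
Proof. by rewrite -[be in LHS]opprK phi_rootB -[- be]sub0r phi_rootB phi_root0 sub0r opprK. Qed.

Lemma phi_root_sroot (a : I0 + I1) : phi_root (sroot a) = wt (phi_word [:: a]).
Proof.
rewrite /phi_root /sroot liftU scale1r.
by case: a => i /=; rewrite ?wt_cons wt_nil addr0 ?wt_cons ?wt_nil ?addr0.
Qed.

Lemma phi_root_wt w : phi_root (wt w) = wt (phi_word w).
Proof.
elim: w => [|a w IH]; first by rewrite !wt_nil phi_root0.
by rewrite wt_cons phi_rootD IH phi_root_sroot -wt_cat -phi_word_cat.
Qed.

Lemma phi_word_inj : injective (@phi_word I0 I1).
Proof.
elim=> [|[i|i] w IH] [|[j|j] w'] //= [].
- by move=> -> /IH ->.
- by move=> -> _ /IH ->.
Qed.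

Lemma perm_phi_word w w' : perm_eq (phi_word w) (phi_word w') -> perm_eq w w'.
Proof.
have c0 i u : count_mem (inl i) u = count_mem (v0 i) (phi_word u).
  by elim: u => [|[j|j] u /= ->].
have c1 i u : count_mem (inr i) u = count_mem (v1 i) (phi_word u).
  by elim: u => [|[j|j] u /= ->].
move=> /permP e; apply/allP => -[i|i] _ /=; first by rewrite !c0 e.
by rewrite !c1 e.
Qed.

Lemma well_ordered_cons (a : dbl I0 I1) v : well_ordered (a :: v)
  = (if a is inr (inl i) then onth v 0 == Some (v2 i) else true) && well_ordered v.
Proof.
rewrite /well_ordered /=; congr (_ && _).
by rewrite -[1%N]addn0 iotaDl all_map.
Qed.

Lemma well_ordered_phi w : well_ordered (phi_word w).
Proof. by elim: w => [|[i|i] w IH] //=; rewrite !well_ordered_cons //= eqxx. Qed.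

(** Each i^1 is immediately followed by an i^2, which no other i^1 can claim. *)
Lemma well_ordered_count v : well_ordered v -> (count (@in_I1 I0 I1) v <= count (@in_I2 I0 I1) v)%N.
Proof.
have [n] := ubnP (size v); elim: n v => // n IH [|a v] //= sv.
rewrite well_ordered_cons; case: a => [i|[i|i]] /=.
- exact: IH.
- case: v sv => //= b v sv; rewrite well_ordered_cons => /andP[/eqP[->]] /= wv.
  exact: (IH v (ltnW sv) wv).
- by move=> wv; apply: leqW (IH v sv wv).
Qed.

(** Reading from the left, the only obstruction is an i^2 not preceded by its i^1. Since the rest of
    the word has at least as many letters of the second kind as of the first, such an i^2 would
    contradict the count. *)
Lemma phi_word_onto v : well_ordered v -> (count (@in_I2 I0 I1) v <= count (@in_I1 I0 I1) v)%N ->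
  exists w, v = phi_word w.
Proof.
have [n] := ubnP (size v); elim: n v => // n IH [|a v] sv; first by exists [::].
rewrite well_ordered_cons; case: a sv => [i|[i|i]] /= sv.
- by move=> wv le; have [w ->] := IH v sv wv le; exists (inl i :: w).
- case: v sv => //= b v sv; rewrite well_ordered_cons => /andP[/eqP[->]] /= wv le.
  by have [w ->] := IH v (ltnW sv) wv le; exists (inr i :: w).
- move=> /well_ordered_count le1 le2.
  have : ((count (@in_I2 I0 I1) v).+1 <= count (@in_I1 I0 I1) v)%N := le2.
  by move=> /leq_trans/(_ le1); rewrite ltnn.
Qed.

Lemma count_phi w : count (@in_I1 I0 I1) (phi_word w) = count (@in_I2 I0 I1) (phi_word w).
Proof. by elim: w => [|[i|i] w /= ->]. Qed.

Lemma well_orderedP w0 v : wt v = wt (phi_word w0) -> well_ordered v ->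
  exists2 w, v = phi_word w & wt w = wt w0.
Proof.
move=> /wt_perm pv wv; have cv a : count a v = count a (phi_word w0) by apply/permP.
have [w vE] : exists w, v = phi_word w by apply: phi_word_onto; rewrite // !cv count_phi.
by exists w => //; apply/wt_perm/perm_phi_word; rewrite -vE.
Qed.

Lemma words_sub_phi al w0 : wt w0 = al ->
  perm_eq [seq phi_word (val t) | t <- words_sub al]
          [seq v <- words_of (phi_root al) | well_ordered v].
Proof.
move=> hw0; apply: uniq_perm.
- rewrite map_inj_uniq ?words_sub_uniq // => t t' /phi_word_inj; apply: val_inj.
- by rewrite filter_uniq ?words_of_uniq.
- move=> v; rewrite mem_filter mem_words_of; apply/mapP/andP => [[t _ ->]|[wv /eqP hv]].
    by rewrite well_ordered_phi -phi_root_wt (eqP (valP t)).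
  have [w -> hw] : exists2 w, v = phi_word w & wt w = wt w0.
    by apply: well_orderedP => //; rewrite hv -hw0 phi_root_wt.
  by exists (Sub w (introT eqP (etrans hw hw0))) => //; apply: mem_words_sub.
Qed.
End PhiWords.

(** * The homomorphism psi' *)

Section Compression.
Variables (k : fieldType) (I0 I1 : choiceType) (h : quiver (I0 + I1)%type) (C : lcat k).
Variables (Db : root_lattice (dbl I0 I1) -> C -> Prop) (Eb Fb : dbl I0 I1 -> functor C C).
Variable rep : quasi_categorical_rep (dbl_quiver h) Db Eb Fb.
Variable P : C -> Prop.
Hypothesis PF0 : forall i M, P M -> P (Fb (v0 i) M).
Hypothesis PF1 : forall i M, P M -> P (fcomp (Fb (v2 i)) (Fb (v1 i)) M).
Local Notation A := (fullsub P).
Local Notation inc := (inclusion P).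
Local Notation Fr := (F_restr PF0 PF1).
Local Notation phi_to := (phi_to PF0 PF1).
Local Notation phi_from := (phi_from PF0 PF1).
Local Notation Sb := (qc_sumF rep).
Variables (al : root_lattice (I0 + I1)%type) (Fa : functor A A).
Variable S : Falpha_sum PF0 PF1 al Fa.
Local Notation alb := (phi_root al).
Local Notation d := (height alb).
Local Notation R := (klr k (dbl_quiver h) alb).
Local Notation psi a M := (qc_psi rep d (a : R) M).
Local Notation E w := (kcl (dbl_quiver h) (fe w) : R).
Local Notation e_ord := (e_ord h k al).
Local Notation word := {w : seq (I0 + I1) | wt w == al}.
Implicit Types (w : word) (M N : A).

Definition to_pow M : hom (inc (Fa M)) (fpow (qc_F rep) d (sval M)) :=
  \sum_(w <- words_sub al) word_inj Sb d (phi_word (val w)) (sval M)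
    \oc phi_to (val w) M \oc fmap inc (fs_prj S w M).

Definition from_pow M : hom (fpow (qc_F rep) d (sval M)) (inc (Fa M)) :=
  \sum_(w <- words_sub al) fmap inc (fs_inj S w M) \oc phi_from (val w) M
    \oc word_prj Sb d (phi_word (val w)) (sval M).

Lemma to_pow_nat M N (f : hom M N) :
  to_pow N \oc fmap inc (fmap Fa f) = fmap (fpow (qc_F rep) d) (fmap inc f) \oc to_pow M.
Proof.
rewrite /to_pow ccomp_suml ccomp_sumr; apply: eq_bigr => w _.
rewrite -(ccompA _ (fmap inc _) (fmap inc _)) -fmap_comp (nt_nat (fs_prj S w)) fmap_comp.
by rewrite !ccompA -(ccompA _ (phi_to _ _) (fmap inc _)) phi_to_nat !ccompA word_inj_nat.
Qed.

Lemma from_pow_nat M N (f : hom M N) :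
  from_pow N \oc fmap (fpow (qc_F rep) d) (fmap inc f) = fmap inc (fmap Fa f) \oc from_pow M.
Proof.
rewrite /from_pow ccomp_suml ccomp_sumr; apply: eq_bigr => w _.
rewrite -(ccompA _ (word_prj _ _ _ _) (fmap _ _)) word_prj_nat !ccompA.
rewrite -(ccompA _ (phi_from _ _) (fmap _ _)) phi_from_nat !ccompA.
by rewrite -(fmap_comp inc (fs_inj S w N)) (nt_nat (fs_inj S w)) fmap_comp.
Qed.

Lemma inc_injK w M : fmap inc (fs_prj S w M) \oc fmap inc (fs_inj S w M)
  = idm (inc (fword Fr (val w) M)).
Proof. exact: (fs_injK S w M). Qed.

Lemma inc_orth w t M : w <> t -> fmap inc (fs_prj S t M) \oc fmap inc (fs_inj S w M) = 0.
Proof. by move=> wt; apply: (fs_orth S M wt). Qed.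

Lemma to_pow_inj w M : to_pow M \oc fmap inc (fs_inj S w M)
  = word_inj Sb d (phi_word (val w)) (sval M) \oc phi_to (val w) M.
Proof.
rewrite /to_pow ccomp_suml (@big_only _ _ _ w) ?mem_words_sub ?words_sub_uniq //.
  by rewrite -ccompA inc_injK ccompm1.
by move=> t tw; rewrite -ccompA inc_orth ?ccompx0 // => wt; apply: tw.
Qed.

Lemma prj_from_pow w M : fmap inc (fs_prj S w M) \oc from_pow M
  = phi_from (val w) M \oc word_prj Sb d (phi_word (val w)) (sval M).
Proof.
rewrite /from_pow ccomp_sumr (@big_only _ _ _ w) ?mem_words_sub ?words_sub_uniq //.
  by rewrite !ccompA inc_injK ccomp1m.
by move=> t tw; rewrite !ccompA inc_orth // !ccomp0x.
Qed.

Definition compress (a : R) : End_op Fa.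
Proof.
apply: (@NT k A A Fa Fa (fun M => from_pow M \oc psi a (sval M) \oc to_pow M)) => M N f.
change (from_pow N \oc psi a (sval N) \oc to_pow N \oc fmap inc (fmap Fa f)
  = fmap inc (fmap Fa f) \oc (from_pow M \oc psi a (sval M) \oc to_pow M)).
rewrite -(ccompA _ (to_pow N)) to_pow_nat [LHS]ccompA -(ccompA _ (psi a (sval N)) (fmap _ _)).
by rewrite (nt_nat (qc_psi rep d a)) !ccompA from_pow_nat.
Defined.

Hypothesis hal : rpos al.

Lemma word_exists : exists z0, wt z0 = al.
Proof. exact: rpos_word. Qed.

Lemma rpos_phi : rpos alb.
Proof. by have [z0 <-] := word_exists; rewrite phi_root_wt rpos_wt. Qed.

Lemma wt_phi w : wt (phi_word (val w)) = alb.
Proof. by rewrite -phi_root_wt (eqP (valP w)). Qed.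

Lemma e_ordE : e_ord = \sum_(w <- words_sub al) E (phi_word (val w)).
Proof.
have [z0 hz0] := word_exists.
by rewrite /e_ord -big_filter -(perm_big _ (words_sub_phi hz0)) big_map.
Qed.

Lemma to_from_pow M : to_pow M \oc from_pow M = psi e_ord (sval M).
Proof.
rewrite e_ordE (psi_sum rep rpos_phi) {1}/to_pow ccomp_suml; apply: eq_bigr => w _.
rewrite (psiE rep _ (wt_phi w)) -ccompA prj_from_pow ccompA -(ccompA _ (phi_to _ _)).
by rewrite phi_fromK ccompm1.
Qed.

Lemma from_to_pow M : from_pow M \oc to_pow M = idm (inc (Fa M)).
Proof.
apply: (dsum_epiP (d := dsum_fmap inc (fs_dsum S M))) => w.
apply: (dsum_monoP (d := dsum_fmap inc (fs_dsum S M))) => w'.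
change (fmap inc (fs_prj S w' M) \oc (from_pow M \oc to_pow M \oc fmap inc (fs_inj S w M))
  = fmap inc (fs_prj S w' M) \oc (idm (inc (Fa M)) \oc fmap inc (fs_inj S w M))).
rewrite ccomp1m -ccompA to_pow_inj ccompA prj_from_pow.
rewrite [LHS]ccompA -(ccompA _ (word_prj _ _ _ _) (word_inj _ _ _ _)).
have [ww'|/eqP ww'] := eqVneq w w'.
  case: w' / ww'; rewrite -(size_wt (wt_phi w)) word_injK ccompm1 phi_toK.
  by rewrite inc_injK.
rewrite word_orth => [|e]; last by apply: ww'; apply: val_inj; apply: phi_word_inj.
by rewrite ccompx0 ccomp0x inc_orth.
Qed.

Lemma compress_lin : linear compress.
Proof.
move=> c a b; apply: nt_ext => M.
change (from_pow M \oc psi (c *: a + b) (sval M) \oc to_pow M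
  = c *: (from_pow M \oc psi a (sval M) \oc to_pow M)
    + from_pow M \oc psi b (sval M) \oc to_pow M).
by rewrite (psi_lin rep rpos_phi) ccompDr ccompDl ccompZr ccompZl.
Qed.

(** The factor e_ord in the middle is the composite [to_pow \oc from_pow]. On the corner it is
    absorbed, so compression becomes multiplicative there. *)
Lemma compressM a b : compress (a *k e_ord *k b) = compress a *k compress b.
Proof.
apply: nt_ext => M.
change (from_pow M \oc psi (a *k e_ord *k b) (sval M) \oc to_pow M
 = from_pow M \oc psi b (sval M) \oc to_pow M \oc (from_pow M \oc psi a (sval M) \oc to_pow M)).
rewrite !(psiM rep rpos_phi) -to_from_pow; move: (psi a _) (psi b _) => f g.
by rewrite !ccompA.
Qed.

Lemma compress_e : compress e_ord = kone.
Proof.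
apply: nt_ext => M.
change (from_pow M \oc psi e_ord (sval M) \oc to_pow M = idm (inc (Fa M))).
by rewrite -to_from_pow !ccompA from_to_pow ccomp1m from_to_pow.
Qed.

Hypothesis F_zero : forall i (X : C), P X -> zero_ob (Fb (v2 i) X).

Lemma zero_fword v (X : C) : zero_ob X -> zero_ob (fword Fb v X).
Proof. by elim: v X => //= i v IH X zX; apply: IH; apply: zero_ob_functor. Qed.

(** Along phi(u) the object stays in the subcategory, where condition (c) applies; the remaining
    functors preserve zero objects. *)
Lemma zero_unordered u i v M : zero_ob (fword Fb (phi_word u ++ v2 i :: v) (sval M)).
Proof.
elim: u M => [|[j|j] u IH] M.
- exact: (zero_fword v (F_zero i (svalP M))).
- exact: (IH (frestrict (PF0 j) M)).
- exact: (IH (frestrict (PF1 j) M)).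
Qed.

(** It suffices to treat the right-hand part e(v) b e_ord. There e_ord splits into the idempotents
    of the words phi(w), which is the situation of [unordered_factor]. *)
Lemma compress_unordered a v b : wt v = alb -> unordered v ->
  compress (e_ord *k a *k E v *k b *k e_ord) = 0.
Proof.
move=> hv uv; apply: nt_ext => M.
change (from_pow M \oc psi (e_ord *k a *k E v *k b *k e_ord) (sval M) \oc to_pow M = 0).
suff z : psi (E v *k b *k e_ord) (sval M) = 0.
  have -> : e_ord *k a *k E v *k b *k e_ord = e_ord *k a *k (E v *k b *k e_ord).
    by rewrite !kmulA.
  by rewrite (psiM rep rpos_phi) z ccomp0x ccompx0 ccomp0x.
rewrite e_ordE kmul_sumr (psi_sum rep rpos_phi) big1 // => w _.
apply: (unordered_factor (N := fun c : R => psi c (sval M) = 0)) (wt_phi w) hv uv.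
- exact: (psi0 rep rpos_phi).
- by move=> c c' zc zc'; rewrite (psiD rep rpos_phi) zc zc' addr0.
- by move=> z c zc; rewrite (psiZ rep rpos_phi) zc scaler0.
- by move=> c c' zc; rewrite (psiM rep rpos_phi) zc ccomp0x.
- by move=> c c' zc; rewrite (psiM rep rpos_phi) zc ccompx0.
- move=> u i v' hu; rewrite (psiE rep _ hu) /word_proj.
  by rewrite (zero_ob_to (word_prj _ _ _ _) 0 (zero_unordered u i v' M)) ccompx0.
Qed.

Local Notation S_al := (balanced_klr h k al).

Definition psi_bar (q : S_al) : End_op Fa := compress (val (repr q : eRe h k al)).

Lemma compress_corner (a b : eRe h k al) :
  compress (val (a *k b)) = compress (val a) *k compress (val b).
Proof.
rewrite -compressM; congr compress.
by rewrite [RHS](congr1 (fun z => z *k val b) (@corner_e _ _ _ _ a).2).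
Qed.

(** Well-definedness: [psi_bar] evaluates a chosen representative, and compression, being
    multiplicative on the corner and zero on the generators, kills their ideal. *)
Lemma psi_bar_cl (c : eRe h k al) : psi_bar (bcl c) = compress (val c).
Proof.
rewrite /psi_bar; set c' := repr (bcl c).
have : two_sided_ideal (@unordered_gen I0 I1 h k al) (c' - c).
  by apply/quotP; rewrite /c' reprK.
have lin (a b : eRe h k al) z :
    compress (val (z *: a + b)) = z *: compress (val a) + compress (val b).
  by rewrite -compress_lin.
move=> J; suff z : compress (val (c' - c)) = 0.
  have := lin c c' (-1); rewrite addrC scaleN1r z => /esym/eqP.
  by rewrite scaleN1r addrC subr_eq0 => /eqP.
elim: J => [|a g b x Gg _ IH].
  by have := lin 0 0 (-1); rewrite scaler0 addr0 scaleN1r addNr.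
have := lin (a *k g *k b) x 1; rewrite scale1r => ->.
rewrite IH addr0 scale1r !compress_corner.
have [a' [v [b' [hv uv ->]]]] := Gg.
by rewrite compress_unordered // kmulx0 kmul0x.
Qed.

Lemma psi_bar_spec : is_psi_bar' rep S psi_bar.
Proof.
have onto (q : S_al) : exists c, q = bcl c by exists (repr q); rewrite /bcl /qclass reprK.
have [qlin qone qmul] := @qclass_morphism k (eRe h k al) (@unordered_gen I0 I1 h k al).
split; first split.
- move=> z p q; have [a ->] := onto p; have [b ->] := onto q.
  rewrite -[z *: bcl a + bcl b]qlin; rewrite -/(bcl _) !psi_bar_cl.
  exact: compress_lin.
- by rewrite -[kone]qone -/(bcl _) psi_bar_cl; apply: compress_e.
- move=> p q; have [a ->] := onto p; have [b ->] := onto q.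
  by rewrite -[bcl a *k bcl b]qmul -/(bcl _) !psi_bar_cl compress_corner.
move=> c w w' M; rewrite psi_bar_cl.
change (fmap inc (fs_prj S w' M) \oc (from_pow M \oc psi (val c) (sval M) \oc to_pow M)
  \oc fmap inc (fs_inj S w M) = phi_from (val w') M
       \oc word_prj Sb d (phi_word (val w')) (sval M) \oc psi (val c) (sval M)
       \oc word_inj Sb d (phi_word (val w)) (sval M) \oc phi_to (val w) M).
by rewrite -!ccompA to_pow_inj !ccompA prj_from_pow.
Qed.

Lemma from_pow_word w M : from_pow M \oc word_inj Sb d (phi_word (val w)) (sval M)
  = fmap inc (fs_inj S w M) \oc phi_from (val w) M.
Proof.
rewrite /from_pow ccomp_suml (@big_only _ _ _ w) ?mem_words_sub ?words_sub_uniq //.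
  by rewrite -ccompA -(size_wt (wt_phi w)) word_injK ccompm1.
move=> t tw; rewrite -ccompA word_orth ?ccompx0 // => e; apply: tw.
by apply: val_inj; apply: phi_word_inj.
Qed.

Lemma word_to_pow w M : word_prj Sb d (phi_word (val w)) (sval M) \oc to_pow M
  = phi_to (val w) M \oc fmap inc (fs_prj S w M).
Proof.
rewrite /to_pow ccomp_sumr (@big_only _ _ _ w) ?mem_words_sub ?words_sub_uniq //.
  by rewrite !ccompA -(size_wt (wt_phi w)) word_injK ccomp1m.
move=> t tw; rewrite !ccompA word_orth ?ccomp0x // => e; apply: tw.
by apply: val_inj; apply: phi_word_inj.
Qed.

(** Serves to evaluate psi' on the values of Phi, whose matrices are concentrated in one entry. The
    factors e_ord added by [corner_proj] cancel against [from_pow] and [to_pow]. *)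
Lemma psi_bar_free (b : free_alg k (klr_gen alb)) w w' M
    (g : hom (fword Fr (val w') M) (fword Fr (val w) M))
    (G : hom (fword Fb (phi_word (val w')) (sval M)) (fword Fb (phi_word (val w)) (sval M))) :
  psi (kcl (dbl_quiver h) b) (sval M) = word_inj Sb d (phi_word (val w)) (sval M) \oc G
     \oc word_prj Sb d (phi_word (val w')) (sval M) ->
  G = phi_to (val w) M \oc fmap inc g \oc phi_from (val w') M ->
  psi_bar (bcl_free h b) M = fs_inj S w M \oc g \oc fs_prj S w' M.
Proof.
move=> hb hG; rewrite /bcl_free psi_bar_cl.
change (from_pow M \oc psi (e_ord *k kcl (dbl_quiver h) b *k e_ord) (sval M) \oc to_pow M
  = fmap inc (fs_inj S w M) \oc fmap inc g \oc fmap inc (fs_prj S w' M)).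
rewrite !(psiM rep rpos_phi) -to_from_pow !ccompA from_to_pow ccomp1m.
rewrite -(ccompA _ (from_pow M) (to_pow M)) from_to_pow ccompm1 hb hG !ccompA.
rewrite -(ccompA _ (word_prj _ _ _ _) (to_pow M)) word_to_pow !ccompA from_pow_word.
rewrite -(ccompA _ (phi_from _ M) (phi_to _ M)) phi_toK ccompm1.
by rewrite -(ccompA _ (phi_from _ M) (phi_to _ M)) phi_toK ccompm1.
Qed.
End Compression.

(** * The representation on the subcategory *)

Section Extension.
Variables (k : fieldType) (I : choiceType) (C : lcat k).
Variables (Ft : I -> functor C C) (F : functor C C) (SF : functor_sum Ft F).

Section OneWeight.
Variables (al : root_lattice I) (Fa : functor C C).
Variable S : functor_sum (fun w : {w | wt w == al} => fword Ft (val w)) Fa.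
Variable d : nat.
Implicit Types (w : {w | wt w == al}) (M : C).

Definition sum_to_pow M : hom (Fa M) (fpow F d M) :=
  \sum_(w <- words_sub al) word_inj SF d (val w) M \oc fs_prj S w M.

Definition pow_to_sum M : hom (fpow F d M) (Fa M) :=
  \sum_(w <- words_sub al) fs_inj S w M \oc word_prj SF d (val w) M.

Lemma sum_to_pow_inj w M : sum_to_pow M \oc fs_inj S w M = word_inj SF d (val w) M.
Proof.
rewrite /sum_to_pow ccomp_suml (@big_only _ _ _ w) ?mem_words_sub ?words_sub_uniq //.
  by rewrite -ccompA (fs_injK S) ccompm1.
by move=> t tw; rewrite -ccompA (fs_orth S) ?ccompx0 // => wt; apply: tw.
Qed.

Lemma prj_pow_to_sum w M : fs_prj S w M \oc pow_to_sum M = word_prj SF d (val w) M.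
Proof.
rewrite /pow_to_sum ccomp_sumr (@big_only _ _ _ w) ?mem_words_sub ?words_sub_uniq //.
  by rewrite ccompA (fs_injK S) ccomp1m.
by move=> t tw; rewrite ccompA (fs_orth S) ?ccomp0x.
Qed.

Lemma word_sum_to_pow w M : height al = d ->
  word_prj SF d (val w) M \oc sum_to_pow M = fs_prj S w M.
Proof.
move=> hd; rewrite /sum_to_pow ccomp_sumr (@big_only _ _ _ w) ?mem_words_sub ?words_sub_uniq //.
  by rewrite -hd -(size_wt (eqP (valP w))) ccompA word_injK ccomp1m.
move=> t tw; rewrite ccompA word_orth ?ccomp0x // => /val_inj e; exact: tw.
Qed.

Lemma pow_to_sum_word w M : height al = d ->
  pow_to_sum M \oc word_inj SF d (val w) M = fs_inj S w M.
Proof.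
move=> hd; rewrite /pow_to_sum ccomp_suml (@big_only _ _ _ w) ?mem_words_sub ?words_sub_uniq //.
  by rewrite -hd -(size_wt (eqP (valP w))) -ccompA word_injK ccompm1.
move=> t tw; rewrite -ccompA word_orth ?ccompx0 // => /val_inj e; apply: tw; exact: esym.
Qed.

Lemma pow_sumK M : height al = d -> pow_to_sum M \oc sum_to_pow M = idm (Fa M).
Proof.
move=> hd; apply: (dsum_monoP (d := fs_dsum S M)) => w.
change (fs_prj S w M \oc (pow_to_sum M \oc sum_to_pow M) = fs_prj S w M \oc idm (Fa M)).
by rewrite ccompA prj_pow_to_sum word_sum_to_pow // ccompm1.
Qed.

Lemma sum_to_pow_nat M N (f : hom M N) :
  sum_to_pow N \oc fmap Fa f = fmap (fpow F d) f \oc sum_to_pow M.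
Proof.
rewrite /sum_to_pow ccomp_suml ccomp_sumr; apply: eq_bigr => w _.
by rewrite -ccompA (nt_nat (fs_prj S w)) !ccompA word_inj_nat.
Qed.

Lemma pow_to_sum_nat M N (f : hom M N) :
  pow_to_sum N \oc fmap (fpow F d) f = fmap Fa f \oc pow_to_sum M.
Proof.
rewrite /pow_to_sum ccomp_suml ccomp_sumr; apply: eq_bigr => w _.
by rewrite -ccompA word_prj_nat !ccompA (nt_nat (fs_inj S w)).
Qed.

(** Extension by zero to the other summands of F^d. For [height al = d] the identity goes to the
    projector onto the words of weight [al], as fits the unit of one block of R_d. *)
Definition extend (f : End_op Fa) : End_op (fpow F d).
Proof.
exists (fun M => sum_to_pow M \oc f M \oc pow_to_sum M) => M N g.
rewrite -(ccompA _ (pow_to_sum N)) pow_to_sum_nat [LHS]ccompA.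
by rewrite -(ccompA _ (f N) (fmap _ _)) (nt_nat f) !ccompA sum_to_pow_nat.
Defined.

Lemma extend_lin : linear extend.
Proof.
move=> c f g; apply: nt_ext => M.
change (sum_to_pow M \oc (c *: f M + g M) \oc pow_to_sum M
  = c *: (sum_to_pow M \oc f M \oc pow_to_sum M) + sum_to_pow M \oc g M \oc pow_to_sum M).
by rewrite ccompDr ccompDl ccompZr ccompZl.
Qed.

Lemma extendM f g : height al = d -> extend (f *k g) = extend f *k extend g.
Proof.
move=> hd; apply: nt_ext => M.
change (sum_to_pow M \oc (g M \oc f M) \oc pow_to_sum M
  = sum_to_pow M \oc g M \oc pow_to_sum M \oc (sum_to_pow M \oc f M \oc pow_to_sum M)).
by rewrite !ccompA -(ccompA _ (pow_to_sum M) (sum_to_pow M)) pow_sumK // ccompm1.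
Qed.

Lemma extend_entry (f : End_op Fa) w w' M (g : hom (fword Ft (val w') M) (fword Ft (val w) M)) :
  f M = fs_inj S w M \oc g \oc fs_prj S w' M ->
  extend f M = word_inj SF d (val w) M \oc g \oc word_prj SF d (val w') M.
Proof.
move=> hf; change (sum_to_pow M \oc f M \oc pow_to_sum M
  = word_inj SF d (val w) M \oc g \oc word_prj SF d (val w') M).
rewrite hf !ccompA sum_to_pow_inj -(ccompA _ (fs_prj S w' M) (pow_to_sum M)).
by rewrite prj_pow_to_sum.
Qed.

Lemma extend_component (f : End_op Fa) w w' M : height al = d ->
  word_prj SF d (val w') M \oc extend f M \oc word_inj SF d (val w) M
  = fs_prj S w' M \oc f M \oc fs_inj S w M.
Proof.
move=> hd; change (word_prj SF d (val w') M \oc (sum_to_pow M \oc f M \oc pow_to_sum M)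
   \oc word_inj SF d (val w) M = fs_prj S w' M \oc f M \oc fs_inj S w M).
by rewrite -!ccompA pow_to_sum_word // !ccompA word_sum_to_pow.
Qed.
End OneWeight.

Lemma extend_orth (al be : root_lattice I) (Fa Fb : functor C C)
    (S : functor_sum (fun w : {w | wt w == al} => fword Ft (val w)) Fa)
    (S' : functor_sum (fun w : {w | wt w == be} => fword Ft (val w)) Fb) d f g :
  al <> be -> extend S d f *k extend S' d g = 0.
Proof.
move=> ab; apply: nt_ext => M.
change (sum_to_pow S' d M \oc g M \oc pow_to_sum S' d M
   \oc (sum_to_pow S d M \oc f M \oc pow_to_sum S d M) = 0).
suff z : pow_to_sum S' d M \oc sum_to_pow S d M = 0.
  by rewrite !ccompA -(ccompA _ (pow_to_sum S' d M) (sum_to_pow _ _ _)) z ccompx0 !ccomp0x.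
rewrite /pow_to_sum ccomp_suml big1 // => w _; rewrite -ccompA.
rewrite /sum_to_pow ccomp_sumr big1 ?ccompx0 // => w' _.
rewrite ccompA word_orth ?ccomp0x // => e; apply: ab.
by rewrite -(eqP (valP w)) -(eqP (valP w')) e.
Qed.

Lemma x_nilpotent (x : nt F F) (xi : forall i, nt (Ft i) (Ft i)) :
  (forall i M, fs_prj SF i M \oc x M = xi i M \oc fs_prj SF i M) ->
  (forall i M, exists n, iter n (ccomp (xi i M)) (idm (Ft i M)) = 0) ->
  forall M, exists n, iter n (ccomp (x M)) (idm (F M)) = 0.
Proof.
move=> xE nil M; pose n i := sval (cid (nil i M)).
have nE i : iter (n i) (ccomp (xi i M)) (idm (Ft i M)) = 0 := svalP (cid (nil i M)).
have [s [_ sz _]] := fs_finite SF M.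
have prj_iter m i : fs_prj SF i M \oc iter m (ccomp (x M)) (idm (F M))
    = iter m (ccomp (xi i M)) (idm (Ft i M)) \oc fs_prj SF i M.
  elim: m => [|m IH] /=; first by rewrite ccompm1 ccomp1m.
  by rewrite ccompA xE -ccompA IH ccompA.
(* The sum of the exponents over the support bounds each of them; outside the support the component
   lands in a zero object. *)
exists (\sum_(i <- s) n i)%N; apply: (dsum_monoP (d := fs_dsum SF M)) => i.
change (fs_prj SF i M \oc iter (\sum_(i <- s) n i)%N (ccomp (x M)) (idm (F M))
  = fs_prj SF i M \oc 0).
rewrite prj_iter ccompx0; have [iin|iout] := boolP (i \in s); last first.
  exact: (zero_ob_to _ _ (sz i iout)).
rewrite (big_rem i) //= addnC iterD nE.
by elim: (\sum_(_ <- _) _)%N => [|m IH] /=; rewrite ?ccomp0x // -ccompA IH ccompx0.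
Qed.
End Extension.

(** * Biadjunctions of the components, by weight and by restriction *)

Section Biadjunctions.
Variable k : fieldType.

(** By naturality [t] is determined on the weight components of X, and there it maps weight
    [al + be] to weight [al]. *)
Lemma weight_shift_zero (C : lcat k) (I : choiceType) (D : root_lattice I -> C -> Prop)
    (G : functor C C) (be : root_lattice I) (t : nt G (fid C)) :
  cat_decomposition D -> (forall al M, D al M -> D (al + be) (G M)) -> be <> 0 ->
  forall X, t X = 0.
Proof.
move=> [orth dec] DG be0 X; have [N [i [p [supp [DN _ _ _ ids]]]]] := dec X.
rewrite -[t X]ccompm1 -fmap_id -ids fmap_sum ccomp_sumr big1 // => al _.
rewrite fmap_comp ccompA; have := nt_nat t (i al); rewrite /= => ->.
suff -> : t (N al) = 0 by rewrite ccompx0 ccomp0x.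
apply: (orth (al + be) al) => //; last exact: DG.
by move=> e; apply: be0; apply: (addrI al); rewrite e addr0.
Qed.

Lemma sroot_neq (I : choiceType) (s t : I) : s <> t -> sroot s - sroot t <> 0 :> root_lattice I.
Proof.
move=> st /(congr1 (coeff s)); rewrite /sroot raddfB /= !coeffU coeff0 eqxx eq_sym.
by move/eqP: st => /negbTE->.
Qed.

Lemma rep_biadjoint (I : choiceType) (h : quiver I) (C : lcat k)
    (D : root_lattice I -> C -> Prop) (Ei Fi : I -> functor C C)
    (rep : quasi_categorical_rep h D Ei Fi) i : biadjoint (Ei i) (Fi i).
Proof.
have [LR RL] := qc_biadjoint rep; split.
- apply: (left_adjoint_summand (qc_sumE rep) (qc_sumF rep) LR) => s t st d X.
  apply: (weight_shift_zero d (qc_decomposition rep) (be := sroot t - sroot s)).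
    by move=> al M DM; rewrite addrA; apply: (qc_weightE rep); apply: (qc_weightF rep).
  by apply: sroot_neq => e; apply: st.
- apply: (left_adjoint_summand (qc_sumF rep) (qc_sumE rep) RL) => s t st d X.
  apply: (weight_shift_zero d (qc_decomposition rep) (be := sroot s - sroot t)).
    by move=> al M DM; rewrite [sroot s - _]addrC addrA;
      apply: (qc_weightF rep); apply: (qc_weightE rep).
  exact: sroot_neq.
Qed.

(** The subcategory is full, so the ambient unit and counit are already morphisms in it. *)
Lemma left_adjoint_restrict (C : lcat k) (P : C -> Prop) (L R : functor C C)
    (PL : forall M, P M -> P (L M)) (PR : forall M, P M -> P (R M)) :
  left_adjoint L R -> left_adjoint (frestrict PL) (frestrict PR).
Proof.
move=> [eta [eps [tL tR]]].
unshelve eexists.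
  exists (fun M : fullsub P => eta (sval M)) => M N f; exact: (nt_nat eta (f : @hom k C _ _)).
unshelve eexists.
  exists (fun M : fullsub P => eps (sval M)) => M N f; exact: (nt_nat eps (f : @hom k C _ _)).
by split=> M; [exact: tL | exact: tR].
Qed.
End Biadjunctions.

(** * Values of psi' composed with Phi on the generators *)

Section Generators.
Variables (k : fieldType) (I0 I1 : choiceType) (h : quiver (I0 + I1)%type) (C : lcat k).
Variables (Db : root_lattice (dbl I0 I1) -> C -> Prop) (Eb Fb : dbl I0 I1 -> functor C C).
Variable rep : quasi_categorical_rep (dbl_quiver h) Db Eb Fb.
Variable P : C -> Prop.
Hypothesis PF0 : forall i M, P M -> P (Fb (v0 i) M).
Hypothesis PF1 : forall i M, P M -> P (fcomp (Fb (v2 i)) (Fb (v1 i)) M).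
Hypothesis F_zero : forall i (X : C), P X -> zero_ob (Fb (v2 i) X).
Local Notation A := (fullsub P).
Local Notation inc := (inclusion P).
Local Notation Fr := (F_restr PF0 PF1).
Local Notation Sb := (qc_sumF rep).
Variables (al : root_lattice (I0 + I1)%type) (Fa : functor A A).
Variable S : Falpha_sum PF0 PF1 al Fa.
Hypothesis hal : rpos al.
Local Notation alb := (phi_root al).
Local Notation d := (height alb).
Local Notation R := (klr k (dbl_quiver h) alb).
Local Notation psi a M := (qc_psi rep d (a : R) M).
Local Notation E w := (kcl (dbl_quiver h) (fe w) : R).
Local Notation X r := (kcl (dbl_quiver h) (fx r) : R).
Local Notation T r := (kcl (dbl_quiver h) (ft r) : R).
Local Notation word := {w : seq (I0 + I1) | wt w == al}.
Local Opaque fe fx ft.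
Implicit Types (w : word) (M : A).
Variable Phi : klr k h al -> balanced_klr h k al.
Hypothesis Phi_spec : is_Phi Phi.
Local Notation psi_al a := (psi_bar rep S (Phi a)).

Lemma psi_al_e w M :
  psi_al (kcl h (fe (val w))) M = fs_inj S w M \oc idm (fword Fr (val w) M) \oc fs_prj S w M.
Proof.
rewrite (Phi_e Phi_spec (eqP (valP w))).
apply: (@psi_bar_free k I0 I1 h C Db Eb Fb rep P PF0 PF1 al Fa S hal F_zero _ w w M _ (idm _)).
  by rewrite (psiE rep _ (wt_phi w)) ccompm1.
by rewrite (fmap_id inc) ccompm1 phi_fromK.
Qed.

Lemma psi_al_x w u a v M : val w = u ++ a :: v ->
  psi_al (kcl h (fx (size u) * fe (val w))) M
  = fs_inj S w M \oc x_comp (sub_xi rep PF0 PF1) (val w) (size u) M \oc fs_prj S w M.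
Proof.
move=> wE; have hw := eqP (valP w); have hwb := wt_phi w.
have -> : Phi (kcl h (fx (size u) * fe (val w)))
    = bcl_free h (fx (size (phi_word u)) * fe (phi_word (val w))).
  by rewrite wE; apply: (Phi_x Phi_spec); rewrite -wE.
have rd : (size (phi_word u) < d)%N.
  rewrite -(size_wt hwb) wE phi_word_cat size_cat.
  by case: (a) => i /=; lia.
apply: (@psi_bar_free k I0 I1 h C Db Eb Fb rep P PF0 PF1 al Fa S hal F_zero _ w w M _
  (x_entry (qc_x rep) Sb (size (phi_word u)) (phi_word (val w)) (sval M))).
  have e : E (phi_word (val w)) *k (X (size (phi_word u)) *k E (phi_word (val w)))
      = X (size (phi_word u)) *k E (phi_word (val w)).
    by rewrite XE // kmulA EEid.
  rewrite kclM -[in LHS]e (psiM rep (rpos_phi hal)) (psiE rep _ hwb) -kclM.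
  rewrite (qc_psi_x rep _ erefl rd hwb) /word_proj /x_entry (size_wt hwb).
  by rewrite !ccompA.
move: (x_entry_phi rep PF0 PF1 u a v M); rewrite -wE => ->.
by [].
Qed.

Lemma acts_cat (I : choiceType) (u v : seq I) l :
  acts (map (addn (size u)) l) (u ++ v) = u ++ acts l v.
Proof.
elim: l => //= r l ->; elim: u => //= i u IH.
by rewrite -IH.
Qed.

Lemma acts_cross (a b : I0 + I1) (u v : seq (I0 + I1)) :
  acts (map (addn (size (phi_word u))) (cross_list a b)) (phi_word (u ++ [:: a, b & v]))
  = phi_word (u ++ [:: b, a & v]).
Proof. by rewrite !phi_word_cat acts_cat; case: a b => [i|i] [j|j]. Qed.

Lemma kcl_crossing (a b : I0 + I1) r v : kcl (dbl_quiver h) (crossing k al a b r * fe v)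
  = cross_sign k a b *: tact (map (addn r) (cross_list a b)) (E v).
Proof.
have M2 (x y z : free_alg k (klr_gen alb)) : kcl (dbl_quiver h) (x * y * z)
    = kcl (dbl_quiver h) x *k (kcl (dbl_quiver h) y *k kcl (dbl_quiver h) z).
  by rewrite !kclM !kmulA.
have M4 (x y z t u : free_alg k (klr_gen alb)) : kcl (dbl_quiver h) (x * y * z * t * u)
    = kcl (dbl_quiver h) x *k (kcl (dbl_quiver h) y *k (kcl (dbl_quiver h) z *k
       (kcl (dbl_quiver h) t *k kcl (dbl_quiver h) u))).
  by rewrite !kclM !kmulA.
case: a b => [i|i] [j|j].
- by rewrite scale1r /= addn0 -kclM.
- by rewrite scale1r /= addn0 addn1 -M2.
- by rewrite scale1r /= addn0 addn1 -M2.
- rewrite /crossing /cross_sign /cross_list /= addn0 addn1 addn2; case: eqP => _.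
    by rewrite kclM kclN kmulNx scaleN1r -kclM M4.
  by rewrite scale1r -M4.
Qed.

Lemma psi_al_t u a b v (w := u ++ [:: a, b & v]) (w' := swp (size u) w)
    (hw : wt w == al) (hw' : wt w' == al) M :
  psi_al (kcl h (ft (size u) * fe w)) M
  = fs_inj S (exist _ w hw) M \oc tau_comp (sub_ti rep PF0 PF1) w (size u) M
    \oc fs_prj S (exist _ w' hw') M.
Proof.
have w'E : w' = u ++ [:: b, a & v] by rewrite /w' /w swp_cat.
have hwb : wt (phi_word w) = alb by rewrite -phi_root_wt (eqP hw).
have hwb' : wt (phi_word w') = alb by rewrite -phi_root_wt (eqP hw').
set rs := map (addn (size (phi_word u))) (cross_list a b).
have rng : all (fun r => r.+1 < d)%N rs.
  rewrite -(size_wt hwb) all_map /w phi_word_cat size_cat /=.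
  by case: (a) (b) => [i|i] [j|j] /=; lia.
rewrite (Phi_t Phi_spec (eqP hw)).
apply: (@psi_bar_free k I0 I1 h C Db Eb Fb rep P PF0 PF1 al Fa S hal F_zero _
  (exist _ w hw) (exist _ w' hw') M _
  (cross_sign k a b *: tau_entry (qc_tau rep) Sb rs (size (phi_word w))
     (phi_word w) (phi_word w') (sval M))); last first.
  exact: tau_entry_phi.
rewrite kcl_crossing (psiZ rep (rpos_phi hal)).
have fix_l : E (phi_word w') *k tact rs (E (phi_word w)) = tact rs (E (phi_word w)).
  rewrite w'E -(acts_cross a b u v); exact: (Eterm k (dbl_quiver h) hwb rs [::]).
rewrite -/rs -fix_l (psiM rep (rpos_phi hal)) (psiE rep _ hwb') (psi_tact rep (rpos_phi hal)) //.
by rewrite /word_proj /tau_entry (size_wt hwb) ccompZr ccompZl !ccompA.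
Qed.
End Generators.

(** * Adjunction, finiteness, weights and nilpotency for the restricted functors *)

Section Restrictions.
Variables (k : fieldType) (I0 I1 : choiceType) (h : quiver (I0 + I1)%type) (C : lcat k).
Variables (Db : root_lattice (dbl I0 I1) -> C -> Prop) (Eb Fb : dbl I0 I1 -> functor C C).
Variable rep : quasi_categorical_rep (dbl_quiver h) Db Eb Fb.
Variable P : C -> Prop.
Hypothesis PF0 : forall i M, P M -> P (Fb (v0 i) M).
Hypothesis PE0 : forall i M, P M -> P (Eb (v0 i) M).
Hypothesis PF1 : forall i M, P M -> P (fcomp (Fb (v2 i)) (Fb (v1 i)) M).
Hypothesis PE1 : forall i M, P M -> P (fcomp (Eb (v1 i)) (Eb (v2 i)) M).
Local Notation A := (fullsub P).
Local Notation Fr := (F_restr PF0 PF1).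
Local Notation Er := (E_restr PE0 PE1).

Lemma restr_biadjoint i : biadjoint (Er i) (Fr i).
Proof.
have ad j := rep_biadjoint rep j.
case: i => i; first by have [l r] := ad (v0 i); split; apply: left_adjoint_restrict.
have [l1 r1] := ad (v1 i); have [l2 r2] := ad (v2 i); split; apply: left_adjoint_restrict.
  (* Adjoints compose in reverse order, which matches E_{i^1} E_{i^2} with F_{i^2} F_{i^1}. *)
  exact: left_adjoint_comp l2 l1.
exact: left_adjoint_comp r1 r2.
Qed.

Definition undbl (a : dbl I0 I1) : I0 + I1 :=
  match a with inl i => inl i | inr (inl i) => inr i | inr (inr i) => inr i end.

Lemma Er_finite (M : A) : exists s : seq (I0 + I1), forall i, i \notin s -> zero_ob (Er i M).
Proof.
have [s [_ zs _]] := fs_finite (qc_sumE rep) (sval M).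
exists (map undbl s) => -[i|i] /negP iout.
  by apply: (zs (v0 i)); apply/negP => si; apply: iout; apply: (map_f undbl si).
apply: (zero_ob_functor (Eb (v1 i)) (zs (v2 i) _)).
by apply/negP => si; apply: iout; apply: (map_f undbl si).
Qed.

Lemma Fr_finite (M : A) : exists s : seq (I0 + I1), forall i, i \notin s -> zero_ob (Fr i M).
Proof.
have [s [_ zs _]] := fs_finite (qc_sumF rep) (sval M).
exists (map undbl s) => -[i|i] /negP iout.
  by apply: (zs (v0 i)); apply/negP => si; apply: iout; apply: (map_f undbl si).
apply: (zero_ob_functor (Fb (v2 i)) (zs (v1 i) _)).
by apply/negP => si; apply: iout; apply: (map_f undbl si).
Qed.

Lemma Er_weight i al M : sub_weights P Db al M -> sub_weights P Db (al - sroot i) (Er i M).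
Proof.
rewrite /sub_weights phi_rootB phi_root_sroot; case: i => i /=.
  by rewrite wt_cons wt_nil addr0; apply: (qc_weightE rep).
rewrite !wt_cons wt_nil addr0 => DM.
rewrite opprD addrCA addrC; apply: (qc_weightE rep (v1 i)).
exact: (qc_weightE rep (v2 i)).
Qed.

Lemma Fr_weight i al M : sub_weights P Db al M -> sub_weights P Db (al + sroot i) (Fr i M).
Proof.
rewrite /sub_weights phi_rootD phi_root_sroot; case: i => i /=.
  by rewrite wt_cons wt_nil addr0; apply: (qc_weightF rep).
rewrite !wt_cons wt_nil addr0 addrA => DM.
by apply: (qc_weightF rep (v2 i)); apply: (qc_weightF rep (v1 i)).
Qed.

(** As x has no mixed components, powers of its component on a summand are components of its powers.
    For i in I_1 the endomorphism is the image under F_{i^2} of the component on F_{i^1}. *)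
Lemma sub_xi_nilpotent i (M : A) :
  exists n, iter n (ccomp (sub_xi rep PF0 PF1 i M)) (idm (Fr i M)) = 0.
Proof.
have entry_nil (a : dbl I0 I1) (X : C) : exists n,
    iter n (ccomp (fs_prj (qc_sumF rep) a X \oc qc_x rep X \oc fs_inj (qc_sumF rep) a X))
      (idm (Fb a X)) = 0.
  have [n xn] := qc_nilpotent rep X; exists n; set y := _ \oc _ \oc _.
  have yn : iter n (ccomp y) (idm (Fb a X)) \oc fs_prj (qc_sumF rep) a X
      = fs_prj (qc_sumF rep) a X \oc iter n (ccomp (qc_x rep X)) (idm (qc_F rep X)).
    elim: (n) => [|m IH] /=; first by rewrite ccomp1m ccompm1.
    by rewrite -ccompA IH !ccompA -x_diagonal.
  have := congr1 (fun z => z \oc fs_inj (qc_sumF rep) a X) yn.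
  by rewrite xn ccompx0 ccomp0x -ccompA fs_injK ccompm1.
case: i => i.
- have [n en] := entry_nil (v0 i) (sval M); exists n.
  have e : sub_xi rep PF0 PF1 (inl i) M = fs_prj (qc_sumF rep) (v0 i) (sval M)
      \oc qc_x rep (sval M) \oc fs_inj (qc_sumF rep) (v0 i) (sval M) :> @hom k C _ _.
    by rewrite /= x_entry0 /= ccomp1m ccompm1.
  rewrite -[RHS]en; elim: (n) => //= m ->; rewrite -e //.
- have [n en] := entry_nil (v1 i) (sval M); exists n.
  set y := _ \oc _ \oc _ in en.
  have e : sub_xi rep PF0 PF1 (inr i) M = fmap (Fb (v2 i)) y :> @hom k C _ _.
    by rewrite /= x_entry0 /= ccomp1m ccompm1.
  have := congr1 (fmap (Fb (v2 i))) en; rewrite fmap0 => <-.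
  elim: (n) => [|m IH]; first by rewrite /= fmap_id.
  by rewrite /= fmap_comp -IH -e.
Qed.
End Restrictions.

Lemma cut1 (T : Type) (r : nat) (w : seq T) : (r < size w)%N ->
  exists u a v, w = u ++ a :: v /\ size u = r.
Proof.
elim: r w => [|r IH] [|a w] //= rw; first by exists [::], a, w.
by have [u [b [v [-> <-]]]] := IH w rw; exists (a :: u), b, v.
Qed.

(** * Assembling the quasi-categorical representation on the subcategory *)

Unset Implicit Arguments.

Theorem theorem3p9
  (k : fieldType) (I0 I1 : choiceType) (h : quiver (I0 + I1)%type)
  (no_arrows_I1 : forall i j : I1, h (inr i) (inr j) = 0%N)
  (Cb : lcat k) (Cb_homfin : hom_finite Cb) (Cb_abelian : abelian Cb)
  (Db : root_lattice (dbl I0 I1) -> Cb -> Prop)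
  (Eb Fb : dbl I0 I1 -> functor Cb Cb)
  (rep : quasi_categorical_rep (dbl_quiver h) Db Eb Fb)
  (P : Cb -> Prop) (P_abelian : abelian_subcategory P)
  (F_stable0 : forall i M, P M -> P (Fb (v0 i) M))
  (E_stable0 : forall i M, P M -> P (Eb (v0 i) M))
  (F_stable1 : forall i M, P M -> P (fcomp (Fb (v2 i)) (Fb (v1 i)) M))
  (E_stable1 : forall i M, P M -> P (fcomp (Eb (v1 i)) (Eb (v2 i)) M))
  (F_zero : forall i M, P M -> zero_ob (Fb (v2 i) M))
  (C_decomposition : cat_decomposition (sub_weights P Db))
  (Fa : root_lattice (I0 + I1)%type -> functor (fullsub P) (fullsub P))
  (Fa_sum : forall al, Falpha_sum F_stable0 F_stable1 al (Fa al))
  (Phi : forall al, klr k h al -> balanced_klr h k al)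
  (Phi_spec : forall al, rpos al -> is_Phi (@Phi al)) :
  hom_finite (fullsub P) /\
  exists psi' : forall al, balanced_klr h k al -> End_op (Fa al),
    (forall al, rpos al -> is_psi_bar' rep (Fa_sum al) (@psi' al)) /\
    exists r : quasi_categorical_rep h (sub_weights P Db)
                 (E_restr E_stable0 E_stable1) (F_restr F_stable0 F_stable1),
      forall al, rpos al ->
      forall (a : klr k h al) (w w' : {w | wt w == al}) (M : fullsub P),
        word_prj (qc_sumF r) (height al) (val w') M
          \oc qc_psi r (height al) a M
          \oc word_inj (qc_sumF r) (height al) (val w) M
        = fs_prj (Fa_sum al) w' M \oc psi' al (Phi al a) M
          \oc fs_inj (Fa_sum al) w M.
Proof.
split; first by move=> A B; apply: Cb_homfin.
exists (fun al => psi_bar rep (Fa_sum al)); split.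
  by move=> al hal; apply: psi_bar_spec.
have Aab := absub_abelian P_abelian.
(* The sums are formed inside the subcategory, from its own abelian structure; finiteness is
   inherited from the supports of the ambient functors. *)
have [E [SE]] := functor_sum_exists Aab (Er_finite rep E_stable0 E_stable1).
have [F [SF]] := functor_sum_exists Aab (Fr_finite rep F_stable0 F_stable1).
have bi : biadjoint E F.
  have ad i := restr_biadjoint rep F_stable0 E_stable0 F_stable1 E_stable1 i.
  split; [apply: (left_adjoint_sum SE SF) | apply: (left_adjoint_sum SF SE)] => i;
    [exact: (ad i).1 | exact: (ad i).2].
have exE : exact_functor E by apply: biadjoint_exact bi.
have exF : exact_functor F by apply: (@biadjoint_exact _ _ _ F E); split; case: bi.
have [x xE] := x_exists SF (sub_xi rep F_stable0 F_stable1).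
have [tau tauE] := tau_exists SF (sub_ti rep F_stable0 F_stable1).
(* Defined for every [d] and [al]; multiplicativity and linearity are claimed for positive [al] of
   height [d], where Phi is specified. *)
pose psi d al (a : klr k h al) : End_op (fpow F d) :=
  extend SF (Fa_sum al) d (psi_bar rep (Fa_sum al) (Phi al a)).
have morph al (hal : rpos al) : kalg_morphism (fun a => psi_bar rep (Fa_sum al) (Phi al a)).
  have [[lin1 one1 mul1] _ _ _] := Phi_spec al hal.
  have [[lin2 one2 mul2] _] := psi_bar_spec rep (Fa_sum al) hal F_zero.
  split=> [c a b||a b]; first by rewrite lin1 lin2.
    by rewrite one1 one2.
  by rewrite mul1 mul2.
(* The values on generators are to be proved for any weight that carries a word, and this makes the
   weight positive. *)
have rp (al : root_lattice (I0 + I1)%type) w : wt w = al -> rpos al by move=> <-; apply: rpos_wt.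
have psi_lin d al : rpos al -> height al = d -> linear (psi d al).
  move=> hal _ c a b; have [lin _ _] := morph al hal.
  by rewrite /psi (lin c a b) extend_lin.
have psiM' d al : rpos al -> height al = d -> {morph psi d al : a b / a *k b}.
  move=> hal hd a b; have [_ _ mul] := morph al hal.
  by rewrite /psi (mul a b) extendM.
have psi_orth d al be : rpos al -> height al = d -> rpos be -> height be = d ->
    al <> be -> forall a b, psi d al a *k psi d be b = 0.
  by move=> _ _ _ _ ne a b; apply: extend_orth.
have psi_e d al w M : height al = d -> wt w = al ->
    psi d al (kcl h (fe w)) M = word_proj SF d w M.
  move=> hd hw; have hal := rp al w hw.
  pose t : {w | wt w == al} := exist _ w (introT eqP hw).
  have e := psi_al_e rep F_zero (Fa_sum al) hal (Phi_spec al hal) t M.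
  have := @extend_entry k _ _ _ F SF al (Fa al) (Fa_sum al) d _ t t M _ e.
  by rewrite ccompm1.
have psi_x d al r w M : height al = d -> (r < d)%N -> wt w = al ->
    psi d al (kcl h (fx r * fe w)) M = word_proj SF d w M \oc x_at x d r M.
  move=> hd rd hw; have hal := rp al w hw.
  have sw : size w = d by rewrite (size_wt hw).
  have [u [a [v [wE ur]]]] : exists u a v, w = u ++ a :: v /\ size u = r.
    by apply: cut1; rewrite sw.
  pose t : {w | wt w == al} := exist _ w (introT eqP hw).
  have e := psi_al_x rep F_zero (Fa_sum al) hal (Phi_spec al hal) (w := t) M wE.
  rewrite ur in e; have e' := @extend_entry k _ _ _ F SF al (Fa al) (Fa_sum al) d _ t t M _ e.
  rewrite /psi e' /word_proj -!ccompA; congr (_ \oc _).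
  by rewrite -sw; apply/esym/word_prj_x; rewrite ?sw.
have psi_t d al r w M : height al = d -> (r.+1 < d)%N -> wt w = al ->
    psi d al (kcl h (ft r * fe w)) M = word_proj SF d w M \oc tau_at tau d r M.
  move=> hd rd hw; have hal := rp al w hw.
  have sw : size w = d by rewrite (size_wt hw).
  have [u [a [b [v [wE ur]]]]] : exists u a b v, w = u ++ [:: a, b & v] /\ size u = r.
    by apply: cut2; rewrite sw.
  have hw1 : wt w == al by apply/eqP.
  have hw2 : wt (swp r w) == al by rewrite wt_swp.
  rewrite -{}ur in hw2 rd *; rewrite {}wE in hw hw1 hw2 sw *.
  have e := psi_al_t rep F_zero (Fa_sum al) hal (Phi_spec al hal) hw1 hw2 M.
  have e' := @extend_entry k _ _ _ F SF al (Fa al) (Fa_sum al) d _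
    (exist (fun w => wt w == al) _ hw1) (exist (fun w => wt w == al) _ hw2) M _ e.
  rewrite /psi e' /word_proj -!ccompA; congr (_ \oc _).
  by rewrite -sw; apply/esym/word_prj_tau; rewrite ?sw.
have nil M : exists n, iter n (ccomp (x M)) (idm (F M)) = 0.
  exact: (x_nilpotent xE (sub_xi_nilpotent rep F_stable0 F_stable1)).
exists (QuasiCategoricalRep C_decomposition bi exE exF SE
  (Er_weight rep E_stable0 E_stable1) (Fr_weight rep F_stable0 F_stable1)
  psi_lin psiM' psi_orth psi_e psi_x psi_t nil).
by move=> al hal a w w' M; apply: extend_component.
Qed.
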